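(* Let $1\le p<\infty$, $r,s\in\mathbb{N}$ with $s\le 2r$, $\alpha\in(0,s)$, and let $(G_n)_{n\in\mathbb{N}}$ be a family of linear sampling operators with nodes $X_n=(x_{k,n})_{k=1}^n$ and separation constant $\gamma\in(0,1]$ (see context). Suppose that there are constants $K_1,K_2,K_3,K_4>0$ such that $$K_2\|g\|_{\ell_p(X_n)}\le\|G_n(g)\|_p\le K_1\|g\|_{\ell_p(X_n)}\quad\text{for all } g\in L_p(\mathbb{T}),\ n\in\mathbb{N},$$ $$\|g-G_n(g)\|_p\le K_3n^{-s}\|g^{(s)}\|_p\quad\text{for all } g\in W_p^s(\mathbb{T}),\ n\in\mathbb{N},$$ $$\|(G_{2^\nu}(g)-G_{2^{\nu-1}}(g))^{(s)}\|_p\le K_4\,2^{s\nu}\|G_{2^\nu}(g)-G_{2^{\nu-1}}(g)\|_p\quad\text{for all } g\in L_p(\mathbb{T}),\ \nu\in\mathbb{N}$$ (where it is understood that $G_{2^\nu}(g)-G_{2^{\nu-1}}(g)\in W_p^s(\mathbb{T})$). Then for every $f\in L_p(\mathbb{T})$ the following properties are equivalent: (i) $\|f-G_n(f)\|_p=\mathcal{O}(n^{-\alpha})$; (ii) $\|f_{\gamma/n,\,r}-f\|_{\ell_p(X_n)}+\omega_s(f,1/n)_p=\mathcal{O}(n^{-\alpha})$.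
   Context: $\mathbb{T}=[0,1)$. For $1\le p<\infty$, $L_p(\mathbb{T})$ is the space of all 1-periodic measurable functions $f$, finite at every point, with $\|f\|_p=(\int_0^1|f(x)|^p\,dx)^{1/p}<\infty$; functions coinciding almost everywhere are not identified, so $f\in L_p(\mathbb{T})$ is given by its value at each point. For $s\in\mathbb{N}$, $f\in W_p^s(\mathbb{T})$ means that $f$ is 1-periodic, $f^{(s-1)}$ is absolutely continuous and $f^{(s)}\in L_p(\mathbb{T})$. For a set of $n$ points $X_n=(x_{k,n})_{k=1}^n$, $\|f\|_{\ell_p(X_n)}=\big(\frac1n\sum_{k=1}^n|f(x_{k,n})|^p\big)^{1/p}$. $\mathbb{N}=\{1,2,\dots\}$. Modulus of smoothness: for $s\in\mathbb{N}$, $\delta>0$, $\omega_s(f,\delta)_p=\sup_{0<h<\delta}\|\Delta_h^sf\|_p$, where $\Delta_h^sf(x)=\sum_{\nu=0}^s\binom{s}{\nu}(-1)^\nu f(x+(s-\nu)h)$. Generalized Steklov average: for $r\in\mathbb{N}$, $\delta>0$ and integrable $f$, $$f_{\delta,r}(x)=(-1)^{r+1}\binom{2r}{r}^{-1}\frac2\delta\int_{-\delta/2}^{\delta/2}\sum_{\nu=0}^{r-1}(-1)^\nu\binom{2r}{\nu}f\Big(x+\frac{r-\nu}{r}t\Big)dt .$$ Sampling operators: for each $n\in\mathbb{N}$, $G_n(f)(x)=\sum_{k=1}^nf(x_{k,n})\varphi_{k,n}(x)$, where $\varphi_{k,n}\in L_p(\mathbb{T})$ are fixed 1-periodic functions and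 the nodes $X_n=(x_{k,n})_{k=1}^n$ satisfy $0\le x_{1,n}<x_{2,n}<\dots<x_{n,n}<1$. It is assumed that $\gamma\in(0,1]$ is such that $\min_{1\le k\le n}(x_{k+1,n}-x_{k,n})\ge\gamma/n$ for all $n\in\mathbb{N}$, where $x_{n+1,n}=1+x_{1,n}$. *)

(* Defs.v *)
From HB Require Import structures.
From mathcomp Require Import all_boot all_order all_algebra.
From mathcomp Require Import all_classical all_reals all_analysis.

Set Implicit Arguments.
Unset Strict Implicit.
Unset Printing Implicit Defensive.

Import Order.TTheory GRing.Theory Num.Theory.
Import numFieldNormedType.Exports.

Local Open Scope classical_set_scope.
Local Open Scope ring_scope.

(* The real line with the sigma-algebra of Lebesgue (Caratheodory) measurable
   sets, on which [completed_lebesgue_measure] lives; as a bare type it is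
   convertible to [R]. *)
Notation lebesgueTypeR R :=
  (caratheodory_type (mu_ext (@wlength R idfun))).

Section Definitions.
Context {R : realType}.
Implicit Types (f g : R -> R) (p delta : R).

Local Notation leb := (@completed_lebesgue_measure R).

(* Norm over one period; a function is not identified with its a.e. class. *)
Definition Lpnorm p f : \bar R :=
  Lnorm leb p%:E ((EFin \o f) \_ `[0%R, 1%R[%classic : lebesgueTypeR R -> \bar R).

Definition LpT p f : Prop :=
  [/\ measurable_fun [set: lebesgueTypeR R] (f : lebesgueTypeR R -> R),
      periodic f 1 & (Lpnorm p f < +oo)%E].

Definition abs_continuous (a b : R) f : Prop :=
  forall e : R, 0 < e -> exists2 d : R, 0 < d &
    forall (m : nat) (u v : 'I_m -> R),
      (forall i, a <= u i /\ u i <= v i /\ v i <= b) ->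
      trivIset [set: 'I_m] (fun i => `]u i, v i[%classic) ->
      \sum_(i < m) (v i - u i) < d ->
      \sum_(i < m) `|f (v i) - f (u i)| < e.

(* For 1-periodic functions, absolute continuity on [0, 1] amounts to absolute
   continuity on every compact interval. The a.e. defined derivative of order s
   is represented by [derive1n s f], which is 0 where the derivative of
   [derive1n s.-1 f] does not exist. *)
Definition Wps (s : nat) p f : Prop :=
  [/\ periodic f 1,
      forall j, (j < s.-1)%N -> forall x, derivable (derive1n j f) x 1,
      abs_continuous 0 1 (derive1n s.-1 f)
    & LpT p (derive1n s f)].

(* Nodes are indexed as in x n 1, ..., x n n. *)
Definition lpnorm p (x : nat -> nat -> R) (n : nat) f : R :=
  (n%:R^-1 * \sum_(1 <= k < n.+1) `|f (x n k)| `^ p) `^ p^-1.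

Definition fdiff (s : nat) (h : R) f (x : R) : R :=
  \sum_(0 <= nu < s.+1) 'C(s, nu)%:R * (-1) ^+ nu * f (x + (s - nu)%:R * h).

Definition omega (s : nat) p f delta : \bar R :=
  ereal_sup [set Lpnorm p (fdiff s h f) | h in `]0, delta[%classic].

Definition steklov (delta : R) (r : nat) f (x : R) : R :=
  (-1) ^+ r.+1 * ('C(2 * r, r)%:R)^-1 * (2 / delta) *
  \int[leb]_(t in `[- (delta / 2), delta / 2]%classic)
     \sum_(0 <= nu < r) (-1) ^+ nu * 'C(2 * r, nu)%:R *
       f (x + (r - nu)%:R / r%:R * t).

Definition sampling_op (x : nat -> nat -> R) (phi : nat -> nat -> R -> R)
    (n : nat) f (y : R) : R :=
  \sum_(1 <= k < n.+1) f (x n k) * phi n k y.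

(* The value x n n.+1 is not a node: it encodes the wrap-around convention. *)
Definition separated_nodes (gamma : R) (x : nat -> nat -> R) : Prop :=
  forall n, (1 <= n)%N ->
  [/\ 0 <= x n 1,
      forall k, (1 <= k < n)%N -> x n k < x n k.+1,
      x n n < 1,
      x n n.+1 = 1 + x n 1
    & forall k, (1 <= k <= n)%N -> gamma / n%:R <= x n k.+1 - x n k].

(* u n = O(n ^ (- alpha)) for a sequence of extended reals; in particular u is
   eventually finite when it is nonnegative. *)
Definition bigO_powN (alpha : R) (u : nat -> \bar R) : Prop :=
  exists C : R, \forall n \near \oo, (u n <= (C * n%:R `^ (- alpha))%:E)%E.

End Definitions.

(* Main.v *)
From HB Require Import structures.
Require Import Defs.
From mathcomp Require Import all_boot all_order all_algebra.
From mathcomp Require Import all_classical all_reals all_analysis.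
From mathcomp Require Import measurable_realfun.
From mathcomp Require Import zify ring lra.
Import Order.TTheory GRing.Theory Num.Theory.
Import numFieldNormedType.Exports.
Local Open Scope classical_set_scope.
Local Open Scope ring_scope.

Set Implicit Arguments.
Unset Strict Implicit.
Unset Printing Implicit Defensive.

(** Both properties are compared with one smooth function. For each n there is
a g in W_p^s such that, with w = omega_s(f, 1/n)_p,
  - ||f - g||_p <= w and ||g^(s)||_p <= C n^s w, and
  - ||f_(gamma/n, r) - g||_(l_p(X_n)) <= C w,
with C independent of f and n ([smooth_approximation]).

(ii) => (i). Write f - G_n f = (f - g) + (g - G_n g) + G_n(g - f). The first
term is at most w; the second is O(w) by the Jackson inequality; the third is,
by the upper Marcinkiewicz-Zygmund inequality, O(||g - f||_(l_p(X_n))), and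
g - f = (g - f_(gamma/n, r)) + (f_(gamma/n, r) - f).

(i) => (ii). The rate for omega_s is the usual inverse theorem
([omega_sampling_le]): along 2^m <= n < 2^(m+1), f is the sum of
f - G_(2^m) f, of the blocks G_(2^k) f - G_(2^(k-1)) f, and of G_1 f. A block
has norm O(2^(-alpha k)), so its s-th difference with step h < 1/n is
O(h^s 2^((s - alpha) k)) by the Bernstein inequality, a geometric sum since
alpha < s. Differences of G_1 f vanish: the Jackson inequality for the constant
1 says that G_1 maps it to itself almost everywhere, so phi_(1,1) = 1 and
G_1 f = f(x_(1,1)) almost everywhere. Then the lower Marcinkiewicz-Zygmund
inequality applied to g - f, and the same splitting of f - G_n f, bound
||g - f||_(l_p(X_n)), hence also ||f_(gamma/n, r) - f||_(l_p(X_n)).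

Construction of g. Let A_v F(x) be the mean of F(x + v t) over t in [0, 1] and
u = 1 / (n (s + 2)). In the sum Delta^s_y f(x), average y over sums of s + 1
variables ranging in [0, u]: the result has norm at most w by the integral form
of Minkowski's inequality ([Lpnorm_average]), its last term is f(x) up to sign,
and its other terms, which make up g, are multiples of A_v^(s+1) f with v a
positive multiple of u. Each A_v gains one derivative, with
(A_v F)' = v^(-1) Delta_v F, so g^(s) is a combination of
v^(-s) A_v Delta^s_v f.

Steklov averages at the nodes. The mean f_(delta, r)(x) - g(x) is controlled by
the mean over [x - delta/2, x + delta/2] of |f - g| + delta^s |g^(s)|
([steklov_error]), because g_(delta, r) - g is an average of central
differences of g of order 2r >= s. With delta = gamma/n the intervals around
the nodes do not overlap modulo 1, so that summing p-th powers over the nodes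
gives one integral over a period ([lpnorm_local]).

Differences of W_p^s functions are bounded by integrals of |g^(s)|: iterated
mean value theorem ([fdiff_le_integral]), and for the last derivative, which is
only absolutely continuous, the fundamental theorem of calculus for absolutely
continuous functions ([abs_continuous_FTC]).

Measurability. Members of L_p are measurable for the Lebesgue sigma-algebra
only; product measures and Tonelli's theorem are used on Borel functions. Every
periodic measurable f is therefore replaced by a periodic Borel function equal
to it almost everywhere ([ex_borel_version]). *)

(** * Absolutely continuous functions as indefinite integrals *)

(** Holds past the end as well: the default value is the right end point [b], the
last point of the partition. *)
Lemma itv_partition_nth_homo {R : realType} (a b : R) s : itv_partition a b s ->
  {homo nth b (a :: s) : m n / (m <= n)%N >-> m <= n}.
Proof.
move=> ps; apply: homo_leq => [//|? ? ?|j]; first exact: le_trans.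
case: (ltnP j (size s)) => js.
  by case: ps => /(pathP b)/(_ j js)/ltW.
rewrite [leRHS]nth_default//; move: js; rewrite leq_eqVlt => /orP[/eqP<-|js].
  by rewrite (itv_partition_nth_size b ps).
by rewrite nth_default.
Qed.

(** Any finite index type is allowed, so that the pieces of several partitions can
be indexed by pairs. *)
Lemma abs_continuous_fin {R : realType} (a b : R) f : abs_continuous a b f ->
  forall e : R, 0 < e -> exists2 d : R, 0 < d &
    forall (I : finType) (u v : I -> R),
      (forall i, a <= u i /\ u i <= v i /\ v i <= b) ->
      trivIset [set: I] (fun i => `]u i, v i[%classic) ->
      \sum_i (v i - u i) < d ->
      \sum_i `|f (v i) - f (u i)| < e.
Proof.
move=> acf e e0; have [d d0 H] := acf e e0; exists d => // I u v uv tuv suv.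
have E (F : I -> R) : \sum_(i < #|I|) F (enum_val i) = \sum_i F i.
  by rewrite -(big_enum_val F); apply: eq_bigl.
have := H #|I| (u \o enum_val) (v \o enum_val).
rewrite /= (E (fun i => v i - u i)) (E (fun i => `|f (v i) - f (u i)|)).
apply => //.
move=> i j _ _ uvij; apply/enum_val_inj; exact: tuv.
Qed.

(** Partitioning each interval leaves the total length unchanged, so that the bound
on the sum of increments is also one on the sum of variations. *)
Lemma abs_continuous_variation {R : realType} (a b : R) f : abs_continuous a b f ->
  forall e : R, 0 < e -> exists2 d : R, 0 < d &
    forall (m : nat) (u v : 'I_m -> R) (s : 'I_m -> seq R),
      (forall i, a <= u i /\ u i <= v i /\ v i <= b) ->
      trivIset [set: 'I_m] (fun i => `]u i, v i[%classic) ->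
      (forall i, itv_partition (u i) (v i) (s i)) ->
      \sum_(i < m) (v i - u i) < d ->
      \sum_(i < m) variation (u i) (v i) f (s i) < e.
Proof.
move=> acf e e0; have [d d0 H] := abs_continuous_fin acf e0.
exists d => // m u v s uv tuv ps suv.
(* All partitions are padded to [K] pieces by repeating their last point. *)
pose K := \max_(i < m) size (s i).
have sK i : (size (s i) <= K)%N by exact: leq_bigmax.
pose t i j := nth (v i) (u i :: s i) j.
have th i := itv_partition_nth_homo (ps i).
have tK' i j : (K <= j)%N -> t i j = v i.
  move=> Kj; case: (ltnP (size (s i)) j) => [sj|js]; first by rewrite /t nth_default.
  rewrite /t -[RHS](itv_partition_nth_size (v i) (ps i)); congr nth.
  by apply/eqP; rewrite eqn_leq js (leq_trans _ Kj).
have t0 i : t i 0 = u i by [].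
have tu i j : u i <= t i j by rewrite -t0; exact: th.
have tv i j : t i j <= v i.
  by case: (leqP j K) => [jK|/ltnW Kj]; [rewrite -(tK' i K)// th|rewrite tK'].
have := H ('I_m * 'I_K)%type (fun ij => t ij.1 ij.2) (fun ij => t ij.1 ij.2.+1).
rewrite -(pair_bigA _ (fun (i : 'I_m) (j : 'I_K) => t i j.+1 - t i j))/=.
rewrite -(pair_bigA _ (fun (i : 'I_m) (j : 'I_K) => `|f (t i j.+1) - f (t i j)|))/=.
have -> : \sum_(i < m) \sum_(j < K) (t i j.+1 - t i j) = \sum_(i < m) (v i - u i).
  apply: eq_bigr => i _; rewrite -(big_mkord xpredT (fun j => t i j.+1 - t i j)).
  by rewrite telescope_sumr// tK'.
move=> {}H; apply: (@le_lt_trans _ _ (\sum_(i < m) \sum_(j < K) `|f (t i j.+1) - f (t i j)|)).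
  apply: ler_sum => i _; rewrite -(big_mkord xpredT (fun j => `|f (t i j.+1) - f (t i j)|)).
  by rewrite (@big_cat_nat _ _ _ (size (s i)))//= lerDl sumr_ge0.
apply: H => //.
  by move=> [i j]/=; case: (uv i) => au [_ vb]; rewrite (le_trans au)// (le_trans _ vb)// th.
move=> [i j] [i' j'] _ _ [z []] /=; rewrite !in_itv/= => /andP[h1 h2] /andP[h3 h4].
have ii' : i = i'.
  apply: tuv => //; exists z; split; rewrite /= in_itv/=.
    by rewrite (le_lt_trans _ h1)//= (lt_le_trans h2).
  by rewrite (le_lt_trans _ h3)//= (lt_le_trans h4).
subst i'; congr pair; apply/val_inj; case: (ltngtP j j') => // jj'.
  by have := lt_trans (lt_le_trans h2 (th i _ _ jj')) h3; rewrite ltxx.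
by have := lt_trans (lt_le_trans h4 (th i _ _ jj')) h1; rewrite ltxx.
Qed.

(** The variation is at most 1 on every interval shorter than some d; [a, b] is
covered by finitely many steps of length d/2. *)
Lemma abs_continuous_bounded_variation {R : realType} (a b : R) f : a <= b ->
  abs_continuous a b f -> bounded_variation a b f.
Proof.
move=> ab acf; have [d d0 H] := abs_continuous_variation acf ltr01.
have loc u v : a <= u -> u <= v -> v <= b -> v - u < d -> bounded_variation u v f.
  move=> au uv vb vud; exists 1 => _ [s ps <-].
  have := H 1%N (fun=> u) (fun=> v) (fun=> s); rewrite !big_ord1 => /(_ _ _ _ _)/ltW; apply => //.
  by move=> i j _ _ _; rewrite !ord1.
have [N bN] : exists N : nat, (b - a) < N%:R * (d / 2).
  exists (Num.bound ((b - a) / (d / 2))).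
  by rewrite -ltr_pdivrMr ?divr_gt0// archi_boundP// divr_ge0 ?subr_ge0// divr_ge0// ltW.
apply/bounded_variationP => //.
suff: forall n c, a <= c -> c <= b -> c - a <= n%:R * (d / 2) -> total_variation a c f \is a fin_num.
  by move=> /(_ N b ab (lexx b) (ltW bN)).
elim=> [|n ih] c ac cb.
  rewrite mul0r subr_le0 => ca; have -> : c = a by apply/le_anti; rewrite ca ac.
  by rewrite total_variationxx.
move=> cn.
have [hca|hca] := leP (c - d/2) a.
  apply/bounded_variationP => //; apply: loc; lra.
rewrite (total_variationD _ (ltW hca)); last lra.
rewrite fin_numD ih; [|lra|lra|]; last by move: cn; rewrite -natr1; lra.
apply/bounded_variationP; [lra|apply: loc; lra].
Qed.

(** The increment of the total variation over an interval is the supremum of the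
variations along its partitions, and [abs_continuous_variation] bounds the
latter for partitions that are optimal up to e / (4 (m + 1)). *)
Lemma abs_continuous_total_variation {R : realType} (a b : R) f : a <= b ->
  abs_continuous a b f -> abs_continuous a b (fun x => fine (total_variation a x f)).
Proof.
move=> ab acf e e0; have e20 : 0 < e / 2 by lra.
have bv := abs_continuous_bounded_variation ab acf.
have [d d0 H] := abs_continuous_variation acf e20; exists d => // m u v uv tuv suv.
have e40 : 0 < e / 4 / m.+1%:R by rewrite !divr_gt0.
have fin x y : a <= x -> x <= y -> y <= b -> total_variation x y f \is a fin_num.
  move=> ax xy yb; apply/bounded_variationP => //.
  by apply: (@bounded_variationr _ a) => //; apply: (bounded_variationl _ yb) => //; exact: le_trans xy.
have /choice[s sP] i : exists s, itv_partition (u i) (v i) s /\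
    fine (total_variation (u i) (v i) f) - e / 4 / m.+1%:R < variation (u i) (v i) f s.
  have [au [uvi vb]] := uv i.
  have := ub_ereal_sup_adherent e40 (fin _ _ au uvi vb).
  move=> [_ [_ [s ps <-] <-]] h; exists s; split => //.
  by rewrite -lte_fin EFinB fineK ?fin.
apply: (@le_lt_trans _ _ (\sum_(i < m) (variation (u i) (v i) f (s i) + e / 4 / m.+1%:R))).
  apply: ler_sum => i _; have [au [uvi vb]] := uv i; have [_] := sP i.
  rewrite (total_variationD f au uvi) fineD ?fin//; last by rewrite (le_trans uvi).
  rewrite (addrAC (fine _)) subrr add0r ger0_norm ?fine_ge0 ?total_variation_ge0//; by rewrite ltrBlDr => /ltW.
rewrite big_split/= sumr_const card_ord.
have h1 : \sum_(i < m) variation (u i) (v i) f (s i) < e / 2.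
  by apply: H => // i; have [] := sP i.
have h2 : (e / 4 / m.+1%:R) *+ m <= e / 4.
  rewrite -[leLHS]mulr_natr mulrAC ler_pdivrMr ?ltr0n//.
  by rewrite ler_pM2l ?ler_nat//; lra.
apply: (le_lt_trans (lerD (ltW h1) h2)); lra.
Qed.

(** Thus the part of an open set in ]0, 1] is covered by the dyadic cells contained
in that open set. *)
Lemma dyadic_approx_open {R : realType} (U : set R) (x : R) : open U -> U x -> 0 < x <= 1 ->
  exists n : nat, exists2 i : nat, (i < 2 ^ n)%N &
   `]i%:R / 2 ^+ n, i.+1%:R / 2 ^+ n]%classic `<=` U /\ i%:R / 2 ^+ n < x <= i.+1%:R / 2 ^+ n.
Proof.
move=> oU Ux /andP[x0 x1].
have /nbhs_ballP[e/= e0 he] : nbhs x U by exact: open_nbhs_nbhs.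
have [n ne] : exists n : nat, (2 : R)^-n < e.
  have h2 : `|2^-1 : R| < 1 by rewrite ger0_norm; lra.
  have /cvgrPdist_lt/(_ e e0) := cvg_expr h2.
  case=> n _ /(_ n (leqnn _)).
  by rewrite sub0r normrN normrX ger0_norm// => h; exists n; rewrite -exprVn.
have n0 : 0 < (2 : R) ^+ n by rewrite exprn_gt0.
have x2 : 0 < x * 2 ^+ n by rewrite mulr_gt0.
have [i ix] : exists i : nat, i%:R < x * 2 ^+ n <= i.+1%:R.
  have ex : exists k : nat, x * 2 ^+ n <= k.+1%:R.
    exists (Num.bound (x * 2 ^+ n)); rewrite ltW// (lt_trans (archi_boundP (ltW x2)))//.
    by rewrite ltr_nat.
  case: (ex_minnP ex) => k xk kmin; exists k; rewrite xk andbT ltNge; apply/negP => kx.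
  case: k xk kmin kx => [|k] xk kmin kx; first by move: (lt_le_trans x2 kx); rewrite ltxx.
  by have := kmin _ kx; rewrite ltnn.
move: ix => /andP[ix xi].
exists n, i; last split.
- rewrite -(ltr_nat R) (lt_le_trans ix)// natrX.
  by rewrite -[leRHS]mul1r ler_pM2r.
- move=> y /=; rewrite in_itv/= => /andP[iy yi].
  apply: he; rewrite /ball/=.
  rewrite ltr_pdivrMr// in iy; rewrite ler_pdivlMr// in yi.
  rewrite -(ltr_pM2r n0) -[X in _ * X](gtr0_norm n0) -normrM mulrBl.
  apply: (@lt_le_trans _ _ 1); last by rewrite -ler_pdivrMr// div1r ltW.
  by rewrite ltr_norml; rewrite -natr1 in yi xi; lra.
- by rewrite ltr_pdivrMr// ix ler_pdivlMr.
Qed.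

(** Radon-Nikodym theorem for the Lebesgue-Stieltjes measure nu of [W] on ]0, 1].
It is dominated by Lebesgue measure: a null set A lies in an open U of measure
less than d. The dyadic cells of level n inside U are disjoint intervals of total
length less than d, so absolute continuity gives them nu-measure at most e, and
they exhaust U on ]0, 1] as n grows. *)
Lemma abs_continuous_nondecreasing_density {R : realType} (W : R -> R) :
  {homo W : x y / x <= y} -> continuous W -> abs_continuous 0 1 W ->
  exists h : R -> R, [/\ forall x, 0 <= h x, (@lebesgue_measure R).-integrable setT (EFin \o h) &
    forall a b, 0 <= a -> a <= b -> b <= 1 ->
      W b - W a = \int[@lebesgue_measure R]_(x in `]a, b]) h x].
Proof.
move=> Wnd Wc Wac.
pose F : cumulative R R := HB.pack W (isCumulative.Build R _ R W Wnd (right_continuousW Wc)).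
pose nu := lebesgue_stieltjes_measure F.
have nuE (a b : R) : a <= b -> nu `]a, b]%classic = (W b - W a)%:E.
  move=> ab; rewrite /nu /lebesgue_stieltjes_measure/= /measure_extension.
  rewrite measurable_mu_extE/=; last exact: is_ocitv.
  by rewrite wlength_itv_bnd.
pose D : set (measurableTypeR R) := `]0, 1]%classic.
have mD : measurable D by exact: measurable_itv.
have nuD : (nu D < +oo)%E by rewrite nuE// ltry.
pose mu := @lebesgue_measure R.
have dom : mfrestr mD nuD `<< mu.
  apply/null_content_dominatesP => A mA muA0.
  apply/eqP; rewrite eq_le measure_ge0 andbT.
  apply/lee_addgt0Pr => e e0; rewrite add0e.
  have [d d0 H] := Wac e e0.
  have [|U [oU AU Ud]] := @lebesgue_regularity_outer R A d mA _ d0; first by rewrite muA0 ltry.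
  have mU : measurable (U : set (measurableTypeR R)) by exact: open_measurable.
  have {}Ud : (mu U < d%:E)%E.
    apply: le_lt_trans Ud; rewrite -(setDUK AU) (le_trans (measureU2 _ _ _))//.
    - exact: measurableD.
    - by rewrite [X in (X + _)%E](_ : _ = 0%E)// add0e setDUK.
  (* [V n] is the union of the cells of level n that are contained in U. *)
  pose c n i : set (measurableTypeR R) := `]i%:R / 2 ^+ n, i.+1%:R / 2 ^+ n]%classic.
  pose G n (i : nat) : set (measurableTypeR R) := if `[< c n i `<=` U >] then c n i else set0.
  pose V n := \big[setU/set0]_(i < (2 ^ n)%N) G n i.
  have mG n i : measurable (G n i).
    by rewrite /G; case: ifPn => // _; exact: measurable_itv.
  have mV n : measurable (V n) by exact: bigsetU_measurable.
  have n0 n : 0 < (2 : R) ^+ n by rewrite exprn_gt0.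
  have tG n : trivIset setT (G n).
    move=> i j _ _; rewrite /G => -[z]; do 2!(case: ifPn => _; last by case).
    rewrite /c => -[/=]; rewrite !in_itv/= => /andP[h1 h2] /andP[h3 h4].
    have := lt_le_trans h1 h4; have := lt_le_trans h3 h2.
    rewrite !ltr_pM2r ?invr_gt0// !ltr_nat !ltnS => ij ji.
    by apply/eqP; rewrite eqn_leq ij ji.
  have VU n : V n `<=` U.
    move=> z; rewrite /V -bigcup_mkord => -[i _]; rewrite /G; case: ifPn => // /asboolP; exact.
  have ndV : {homo V : n m / (n <= m)%N >-> (n <= m)%O}.
    apply: homo_leq => // [X Y Z|n]; first exact: le_trans.
    apply/subsetPset => z; rewrite /V -!bigcup_mkord => -[i /= i2]; rewrite /G.
    case: ifPn => // /asboolP cU; rewrite /c/= in_itv/= => /andP[iz zi].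
    have sub j : i%:R / 2 ^+ n <= j%:R / 2 ^+ n.+1 :> R ->
        j.+1%:R / 2 ^+ n.+1 <= i.+1%:R / 2 ^+ n :> R ->
        c n.+1 j `<=` U.
      move=> h1 h2 y; rewrite /c/= in_itv/= => /andP[y1 y2]; apply: cU.
      by rewrite /c/= in_itv/=; apply/andP; split; [exact: le_lt_trans h1 y1|exact: le_trans y2 h2].
    have half k : (2 * k)%N%:R / 2 ^+ n.+1 = k%:R / 2 ^+ n :> R.
      by rewrite exprS natrM -mulf_div divff ?mul1r.
    have [zh|zh] := leP z ((2 * i).+1%:R / 2 ^+ n.+1).
      exists (2 * i)%N => /=; first by rewrite expnS ltn_pmul2l.
      rewrite ifT; first by rewrite /c/= in_itv/= half iz zh.
      apply/asboolP/sub; first by rewrite half.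
      rewrite -half ler_pM2r ?invr_gt0// ler_nat; lia.
    exists (2 * i).+1%N => /=; first by rewrite expnS; lia.
    have e2 : (2 * i).+2%:R / 2 ^+ n.+1 = i.+1%:R / 2 ^+ n :> R.
      by rewrite -half; congr (_%:R / _); lia.
    rewrite ifT; first by rewrite /c/= in_itv/= zh e2.
    apply/asboolP/sub; last by rewrite e2.
    rewrite -half ler_pM2r ?invr_gt0// ler_nat; lia.
  (* A cell that is not contained in U becomes the empty interval [u, u]. *)
  pose u n (i : 'I_(2 ^ n)%N) : R := i%:R / 2 ^+ n.
  pose v n (i : 'I_(2 ^ n)%N) : R := if `[< c n i `<=` U >] then i.+1%:R / 2 ^+ n else i%:R / 2 ^+ n.
  have uv n i : u n i <= v n i.
    by rewrite /u/v; case: ifP => // _; rewrite ler_pM2r ?invr_gt0// ler_nat.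
  have GE n (i : 'I_(2 ^ n)%N) : G n i = `]u n i, v n i]%classic.
    by rewrite /G /u /v; case: ifP => // _; rewrite set_itv_ge// bnd_simp ltxx.
  have nuV n : (nu (V n) <= e%:E)%E.
    have -> : nu (V n) = (\sum_(i < (2 ^ n)%N) nu (G n i))%E := measure_bigsetU nu (mG n) (tG n) (2 ^ n)%N.
    rewrite (eq_bigr (fun i : 'I_(2^n)%N => (W (v n i) - W (u n i))%:E)); last first.
      by move=> i _; rewrite GE nuE.
    rewrite sumEFin lee_fin (le_trans (ler_norm _))// (le_trans (ler_norm_sum _ _ _))// ltW//.
    apply: H.
    - move=> i; split; first by rewrite /u divr_ge0// ltW.
      split => //; rewrite /v; have := ltn_ord i; case: ifP => _ hi.
        by rewrite ler_pdivrMr// mul1r -natrX ler_nat.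
      by rewrite ler_pdivrMr// mul1r -natrX ler_nat ltnW.
    - move=> i j _ _ [z [zi zj]]; apply/val_inj/(tG n) => //; exists z.
      by rewrite /= !GE; split; exact: subset_itv_oo_oc.
    - rewrite -lte_fin; apply: le_lt_trans Ud.
      apply: (@le_trans _ _ (mu (V n))); last by rewrite le_measure// inE.
      have -> : mu (V n) = (\sum_(i < (2 ^ n)%N) mu (G n i))%E := measure_bigsetU mu (mG n) (tG n) (2 ^ n)%N.
      rewrite -sumEFin le_eqVlt; apply/orP; left; apply/eqP.
      apply: eq_bigr => i _; rewrite GE /mu lebesgue_measure_itv/= lte_fin.
      by case: ltP => // vu; congr EFin; apply/eqP; rewrite subr_eq0 eq_le vu uv.
  have mbV : measurable (\bigcup_n V n) by exact: bigcupT_measurable.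
  apply: (@le_trans _ _ (nu (\bigcup_n V n))).
    rewrite /mfrestr /mrestr le_measure ?inE//; first exact: measurableI.
    move=> z [/AU Uz]; rewrite /D/= in_itv/= => z01.
    have [n [i i2 [ciU ci]]] := dyadic_approx_open oU Uz z01.
    exists n => //; rewrite /V -bigcup_mkord; exists i => //.
    by rewrite /G ifT ?/c/= ?in_itv//; exact/asboolP.
  have cv := @nondecreasing_cvg_mu _ _ _ nu V mV mbV ndV.
  have <- : lim ((nu \o V) x @[x --> \oo]) = nu (\bigcup_n V n) by exact/cvg_lim/cv.
  apply: lime_le; first by apply/cvg_ex; eexists; exact: cv.
  by apply: nearW.
have [h [h0 hfin hint hE]] := radon_nikodym_sigma_finite dom.
exists (fine \o h).
have hh : EFin \o (fine \o h) = h by apply/funext => x /=; rewrite fineK.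
split; [by move=> x; exact: fine_ge0|by rewrite hh|].
move=> a b a0 ab b1.
have e1 : nu (`]a, b]%classic `&` D) = _ := hE `]a, b]%classic (measurable_itv _).
move: e1; rewrite setIidl; last first.
  by move=> z; rewrite /D/= !in_itv/= => /andP[az zb]; rewrite (le_lt_trans a0 az) (le_trans zb b1).
rewrite nuE// => e1; rewrite /Rintegral -[LHS]/(fine (W b - W a)%:E) e1; congr fine.
by apply: eq_integral => x _; rewrite /= fineK.
Qed.

Lemma abs_continuousB {R : realType} (a b : R) f g :
  abs_continuous a b f -> abs_continuous a b g -> abs_continuous a b (f \- g).
Proof.
move=> acf acg e e0; have e2 : 0 < e / 2 by lra.
have [d d0 H] := acf _ e2; have [d' d'0 H'] := acg _ e2.
exists (Num.min d d'); first by rewrite lt_min d0.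
move=> m u v uv tuv; rewrite lt_min => /andP[h h'].
have := ltrD (H m u v uv tuv h) (H' m u v uv tuv h').
rewrite -splitr -big_split/=; apply: le_lt_trans; apply: ler_sum => i _.
by rewrite (_ : f (v i) - g (v i) - (f (u i) - g (u i)) = (f (v i) - f (u i)) - (g (v i) - g (u i))) ?ler_normB//; ring.
Qed.

Lemma abs_continuous_uniform {R : realType} (a b : R) f : abs_continuous a b f ->
  forall e : R, 0 < e -> exists2 d : R, 0 < d &
    forall x y, a <= x <= b -> a <= y <= b -> `|x - y| < d -> `|f x - f y| < e.
Proof.
move=> acf e e0; have [d d0 H] := acf e e0; exists d => //.
suff K x y : x <= y -> a <= x <= b -> a <= y <= b -> `|x - y| < d -> `|f x - f y| < e.
  move=> x y xab yab; have [xy|/ltW yx] := leP x y; first exact: K.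
  by rewrite distrC (distrC (f x)); exact: K.
move=> xy /andP[ax xb] /andP[ay yb]; rewrite distrC ger0_norm ?subr_ge0// => xyd.
have := H 1%N (fun=> x) (fun=> y); rewrite !big_ord1 distrC; apply => //.
by move=> i j _ _ _; rewrite !ord1.
Qed.

(** With V the total variation of f on [0, x], both V and V - f are nondecreasing
and absolutely continuous. *)
Lemma abs_continuous_density {R : realType} (f : R -> R) : abs_continuous 0 1 f ->
  exists2 h : R -> R, (@lebesgue_measure R).-integrable setT (EFin \o h) &
    forall a b, 0 <= a -> a <= b -> b <= 1 ->
      f b - f a = \int[@lebesgue_measure R]_(x in `]a, b]) h x.
Proof.
move=> acf.
have nondec (W : R -> R) : (forall x y, 0 <= x -> x <= y -> y <= 1 -> W x <= W y) ->
    abs_continuous 0 1 W ->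
    exists2 h : R -> R, (@lebesgue_measure R).-integrable setT (EFin \o h) &
    forall a b, 0 <= a -> a <= b -> b <= 1 ->
      W b - W a = \int[@lebesgue_measure R]_(x in `]a, b]) h x.
  (* [cl] clamps to [0, 1], to get a function that is monotone on the whole line. *)
  move=> Wnd acW; pose cl (x : R) : R := if x <= 0 then 0 else if 1 <= x then 1 else x.
  have cl01 x : 0 <= cl x <= 1 by rewrite /cl; case: (leP x 0) => ?; [|case: (leP 1 x) => ?]; lra.
  have clE x : 0 <= x -> x <= 1 -> cl x = x by move=> x0 x1; rewrite /cl; case: (leP x 0) => ?; [|case: (leP 1 x) => ?]; lra.
  have clm x y : x <= y -> 0 <= cl y - cl x <= y - x.
    move=> xy; rewrite /cl.
    by case: (leP x 0) => ?; [|case: (leP 1 x) => ?]; (case: (leP y 0) => ?; [|case: (leP 1 y) => ?]); lra.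
  have cld x y : `|cl x - cl y| <= `|x - y|.
    wlog xy : x y / x <= y.
      by move=> H; have [/H//|/ltW/H] := leP x y; rewrite distrC (distrC y).
    rewrite distrC (distrC x); have /andP[h1 h2] := clm _ _ xy.
    by rewrite !ger0_norm// subr_ge0.
  have [| | |h [_ hi hE]] := @abs_continuous_nondecreasing_density R (W \o cl).
  - move=> x y xy /=; apply: Wnd; [by case/andP: (cl01 x)| |by case/andP: (cl01 y)].
    by have := clm _ _ xy; lra.
  - move=> x; apply/cvgrPdist_lt => e e0.
    have [d d0 H] := abs_continuous_uniform acW e0.
    near=> y; apply: H => //=; apply: le_lt_trans (cld _ _) _.
    by near: y; apply: cvgr_dist_lt => //; exact: cvg_id.
  - move=> e e0; have [d d0 H] := acW e e0; exists d => // m u v uv tuv suv.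
    rewrite (eq_bigr (fun i => `|W (v i) - W (u i)|)) ?H// => i _ /=.
    by have [u0 [uvi v1]] := uv i; rewrite !clE//; lra.
  exists h => // a b a0 ab b1; rewrite -hE//= !clE//; lra.
have le01 := @ler01 R.
have acV := abs_continuous_total_variation le01 acf.
have bv := abs_continuous_bounded_variation le01 acf.
set V := (fun x => _) in acV.
have VD x y : 0 <= x -> x <= y -> y <= 1 -> `|f y - f x| <= V y - V x.
  move=> x0 xy y1.
  have fin u v : 0 <= u -> u <= v -> v <= 1 -> total_variation u v f \is a fin_num.
    move=> ax ? yb; apply/bounded_variationP => //.
    by apply: (@bounded_variationr _ 0) => //; apply: (bounded_variationl _ yb) => //; exact: le_trans ax _.
  rewrite /V (total_variationD f x0 xy) fineD ?fin//; last exact: le_trans xy y1.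
  rewrite (addrAC (fine _)) subrr add0r -lee_fin fineK ?fin//.
  exact: total_variation_ge.
have [|//|h1 h1i h1E] := nondec V.
  by move=> x y x0 xy y1; rewrite -subr_ge0 (le_trans _ (VD _ _ x0 xy y1)).
have [||h2 h2i h2E] := nondec (V \- f); last 1 first.
- exists (h1 \- h2).
    by rewrite [X in _.-integrable _ X](_ : _ = (EFin \o h1) \- (EFin \o h2))%E//; exact: integrableB.
  move=> a b a0 ab b1; rewrite RintegralB//.
  + by rewrite -h1E// -h2E//=; ring.
  + by apply: integrableS h1i.
  + by apply: integrableS h2i.
- move=> x y x0 xy y1 /=; have := VD _ _ x0 xy y1; rewrite ler_norml; lra.
- exact: abs_continuousB.
Unshelve. all: by end_near. Qed.

(** The density of [abs_continuous_density] is almost everywhere the derivative of f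
by Lebesgue's differentiation theorem. *)
Lemma abs_continuous_FTC {R : realType} (f : R -> R) : abs_continuous 0 1 f ->
  exists h : R -> R, [/\ (@lebesgue_measure R).-integrable setT (EFin \o h),
    forall a b, 0 <= a -> a <= b -> b <= 1 ->
      f b - f a = \int[@lebesgue_measure R]_(x in `]a, b]) h x &
    {ae @lebesgue_measure R, forall x, 0 < x < 1 -> derive1 f x = h x}].
Proof.
move=> acf; have [h hi hE] := abs_continuous_density acf; exists h; split => //.
have := @FTC1 R h (BRight 0); move=> /(_ _ _)[||N [mN N0 NP]].
- by move=> y; apply: integrableS hi.
- by apply: open_integrable_locally => //; exact: openT.
exists N; split => //; apply: subset_trans NP => x /= hx Hx; apply: hx => /andP[x0 x1].
have [|dF <-] := Hx; first by [].
set F := (fun y : R => _) in dF *.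
rewrite !derive1E; have -> : 'D_1 F x = 'D_1 (F + cst (f 0)) x.
  by rewrite (deriveD dF (derivable_cst _ _ _)) derive_cst addr0.
apply: near_eq_derive; near=> y.
have /andP[y0 y1] : 0 < y < 1 by near: y; apply: near_in_itvoo; rewrite in_itv/= x0.
have -> : (F + cst (f 0)) y = F y + f 0 by [].
by rewrite /F -hE ?subrK// ltW.
Unshelve. all: by end_near. Qed.

(** * The Lebesgue sigma-algebra and affine changes of variable *)

Section integral_completed.
Context {R : realType}.
Local Notation mu := (@lebesgue_measure R).
Local Notation leb := (@completed_lebesgue_measure R).
Local Notation T := (lebesgueTypeR R).

Lemma borel_lebesgue_measurable (A : set R) : measurable A -> measurable (A : set T).
Proof. by move=> mA; exact: sub_caratheodory. Qed.

Lemma measurable_lebesgue_id :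
  measurable_fun [set: T] (idfun : T -> measurableTypeR R).
Proof. by move=> _ B mB; rewrite setTI; exact: borel_lebesgue_measurable. Qed.

Lemma borel_lebesgue_measurable_funT d (U : measurableType d) (f : R -> U) :
  measurable_fun [set: R] f -> measurable_fun [set: T] (f : T -> U).
Proof.
move=> mf _ B mB; rewrite setTI; apply: borel_lebesgue_measurable.
by rewrite -[X in measurable X]setTI; exact: mf.
Qed.

(** The identity map from the Lebesgue to the Borel sigma-algebra is measurable and
carries the completed measure to Lebesgue measure. *)
Lemma ge0_integral_completed (D : set R) (F : R -> \bar R) :
  measurable D -> measurable_fun D F -> (forall x, D x -> (0 <= F x)%E) ->
  (\int[leb]_(x in (D : set T)) F x = \int[mu]_(x in D) F x)%E.
Proof.
move=> mD mF F0.
have <- := @ge0_integral_pushforward _ _ _ _ _ _ measurable_lebesgue_id leb D F mD mF.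
  rewrite (@eq_measure_integral _ (measurableTypeR R) R D mu _ F)//.
  exact: measurable_lebesgue_id.
by move=> y; rewrite inE; exact: F0.
Qed.

Lemma ae_lebesgue_completed (P : R -> Prop) :
  {ae mu, forall x, P x} -> {ae leb, forall x, P x}.
Proof.
move=> [N [mN N0 NP]]; exists N; split => //; exact: borel_lebesgue_measurable.
Qed.

(** Both sides are measures in A that agree on half-open intervals. *)
Lemma lebesgue_measure_affine (c u : R) (A : set R) : 0 < u -> measurable A ->
  mu A = (u%:E * mu ((fun t => (c + u * t)%R) @^-1` A))%E.
Proof.
move=> u0 mA.
pose phi : measurableTypeR R -> measurableTypeR R := fun t => c + u * t.
have mphi : measurable_fun setT phi.
  by apply: measurable_funD => //; exact: measurable_funM.
pose nu : {measure set (measurableTypeR R) -> \bar R} := mscale (NngNum (ltW u0)) (pushforward mu phi).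
suff H : forall X : set R, ocitv X -> mu X = nu mphi X by exact: (lebesgue_measure_unique H mA).
move=> X /ocitvP[->|[[a b]/= ab ->]].
  by rewrite !measure0.
rewrite /nu /mscale/= /pushforward.
have -> : phi @^-1` `]a, b] = `](a - c) / u, (b - c) / u]%classic.
  apply/seteqP; split => t; rewrite /phi/= !in_itv/= ltr_pdivrMr// ler_pdivlMr// (mulrC t) => /andP[h1 h2]; lra.
rewrite !lebesgue_measure_itv/= !lte_fin ltr_pM2r ?invr_gt0// ltrD2r.
case: ifPn => _; last by rewrite mule0.
by rewrite -EFinM; congr EFin; field; rewrite gt_eqF.
Qed.

Lemma ge0_integral_affine (c u : R) (D : set R) (F : R -> \bar R) :
  0 < u -> measurable D -> measurable_fun D F -> (forall x, D x -> (0 <= F x)%E) ->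
  (\int[mu]_(x in D) F x =
   u%:E * \int[mu]_(t in (fun t => (c + u * t)%R) @^-1` D) F (c + u * t)%R)%E.
Proof.
move=> u0 mD mF F0.
pose phi : measurableTypeR R -> measurableTypeR R := fun t => c + u * t.
have mphi : measurable_fun setT phi.
  by apply: measurable_funD => //; exact: measurable_funM.
pose nu : {measure set (measurableTypeR R) -> \bar R} := mscale (NngNum (ltW u0)) (pushforward mu phi).
have -> : (\int[mu]_(x in D) F x = \int[nu mphi]_(x in D) F x)%E.
  rewrite (@eq_measure_integral _ (measurableTypeR R) R D (nu mphi) mu F)// => A mA AD.
  exact: lebesgue_measure_affine.
rewrite ge0_integral_mscale//; congr (_ * _)%E.
by rewrite ge0_integral_pushforward// => y; rewrite inE; exact: F0.
Qed.

Lemma preimage_affine_itv (c u a b : R) (x y : bool) : 0 < u ->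
  (fun t => c + u * t) @^-1` [set` Interval (BSide x (c + u * a)) (BSide y (c + u * b))] =
  [set` Interval (BSide x a) (BSide y b)].
Proof.
move=> u0; apply/seteqP; split => t /=; rewrite !in_itv;
  by case: x; case: y; rewrite /= ?lerD2l ?ltrD2l ?(ler_pM2l u0) ?(ltr_pM2l u0).
Qed.

Lemma measurable_affine (c u : R) : measurable_fun [set: R] (fun t : R => c + u * t).
Proof. by apply: measurable_funD => //; exact: measurable_funM. Qed.

Lemma integrable_affine (c u : R) (D : set R) (F : R -> R) :
  0 < u -> measurable D -> measurable_fun [set: R] F ->
  mu.-integrable D (EFin \o F) ->
  mu.-integrable ((fun t => c + u * t) @^-1` D) (fun t => (F (c + u * t))%:E).
Proof.
move=> u0 mD mF /integrableP[_ Foo]; apply/integrableP; split.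
  apply/measurable_EFinP; apply: (measurable_funS measurableT) => //.
  by apply: measurableT_comp => //; exact: measurable_affine.
have E : (\int[mu]_(x in D) `|F x|%:E = u%:E * \int[mu]_(t in (fun t => (c + u * t)%R) @^-1` D) `|F (c + u * t)|%:E)%E.
  apply: (@ge0_integral_affine c u D (fun x => `|F x|%:E)) => //.
  by apply/measurable_EFinP; apply: measurableT_comp => //; exact: measurable_funS mF.
move: Foo; rewrite /= E => h; rewrite ltey; apply/negP => /eqP h2.
by move: h; rewrite h2 gt0_muley ?lte_fin// ltxx.
Qed.

Lemma Rintegral_affine (c u : R) (D : set R) (F : R -> R) :
  0 < u -> measurable D -> measurable_fun [set: R] F ->
  mu.-integrable D (EFin \o F) ->
  \int[mu]_(x in D) F x =
   u * \int[mu]_(t in (fun t => c + u * t) @^-1` D) F (c + u * t).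
Proof.
move=> u0 mD mF Fi; have Fi' := integrable_affine c u0 mD mF Fi.
have mFD : measurable_fun D (EFin \o F) by case/integrableP: Fi.
rewrite /Rintegral integralE [in RHS]integralE.
have mpre : measurable ((fun t : R => c + u * t) @^-1` D : set (measurableTypeR R)).
  by rewrite -[X in measurable X]setTI; exact: measurable_affine.
(* [fine] commutes with the multiplication by [u] when both parts are finite. *)
have fp := integrable_fin_num mpre (integrable_funepos mpre Fi').
have fn := integrable_fin_num mpre (integrable_funeneg mpre Fi').
rewrite (ge0_integral_affine c u0 mD (measurable_funepos mFD))//.
rewrite (ge0_integral_affine c u0 mD (measurable_funeneg mFD))//.
rewrite -[X in _ = X * _]/(fine u%:E) -fineM//; last by rewrite fin_numB fp// fn.
congr fine; rewrite [RHS]muleBr; [congr (_ - _)%E; congr (_ * _)%E; apply: eq_integral => t _; by rewrite ?funeposE ?funenegE|by []|exact: fin_num_adde_defr].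
Qed.

Lemma ge0_integral_translation (c a b : R) (x y : bool) (F : R -> \bar R) :
  measurable_fun [set: R] F -> (forall x, (0 <= F x)%E) ->
  (\int[mu]_(t in [set` Interval (BSide x a) (BSide y b)]) F (t + c)%R =
   \int[mu]_(t in [set` Interval (BSide x (a + c)%R) (BSide y (b + c)%R)]) F t)%E.
Proof.
move=> mF F0; have mi (i : interval R) : measurable [set` i] by exact: measurable_itv.
rewrite [RHS](@ge0_integral_affine c 1)//; last exact: measurable_funS mF.
have E t : t + c = c + 1 * t by rewrite mul1r addrC.
rewrite !E preimage_affine_itv// mul1e.
by apply: eq_integral => t _; rewrite E.
Qed.

Lemma periodic_int (T : Type) (F : R -> T) (z : int) t : (forall x, F (x + 1) = F x) ->
  F (t + z%:~R) = F t.
Proof.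
move=> pF; have pn n u : F (u + n%:R) = F u by elim: n u => [|n ih] u; rewrite ?addr0// -natr1 addrA pF ih.
by case: z => n; rewrite ?NegzE ?intrN -?pmulrn ?pn// -[in RHS](subrK n.+1%:R t) pn.
Qed.

Lemma ge0_integral_co_split (F : R -> \bar R) (a b c : R) : measurable_fun [set: R] F ->
  (forall x, (0 <= F x)%E) -> a <= b -> b <= c ->
  (\int[mu]_(t in `[a, c[) F t = \int[mu]_(t in `[a, b[) F t + \int[mu]_(t in `[b, c[) F t)%E.
Proof.
move=> mF F0 ab bc.
have -> : `[a, c[%classic = `[a, b[ `|` `[b, c[ by rewrite -itv_bndbnd_setU.
rewrite ge0_integral_setU//; first exact: measurable_funS mF.
apply/disj_setPS => t [] /=; rewrite !in_itv/= => /andP[_ tb] /andP[bt _].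
by move: (lt_le_trans tb bt); rewrite ltxx.
Qed.

(** Cut at the integer m with a in [m, m + 1[ and at m + 1, and move the second
piece back by one period. *)
Lemma ge0_integral_periodic (F : R -> \bar R) (a : R) : measurable_fun [set: R] F ->
  (forall x, (0 <= F x)%E) -> (forall x, F (x + 1)%R = F x) ->
  (\int[mu]_(t in `[a, (a + 1)%R[) F t = \int[mu]_(t in `[0%R, 1%R[) F t)%E.
Proof.
move=> mF F0 pF; pose z := Num.floor a.
have za : z%:~R <= a by exact: floor_le.
have az : a <= z%:~R + 1 by have := floorD1_gt a; rewrite intrD => /ltW.
have -> : (\int[mu]_(t in `[0%R, 1%R[) F t = \int[mu]_(t in `[z%:~R, (z%:~R + 1)%R[) F t)%E.
  have e0 : z%:~R = 0 + z%:~R :> R by rewrite add0r.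
  rewrite (addrC z%:~R 1) {1}e0 -(ge0_integral_translation z%:~R)//.
  by apply: eq_integral => t _; rewrite periodic_int.
rewrite (ge0_integral_co_split mF F0 za az).
rewrite (@ge0_integral_co_split F a (z%:~R + 1) (a + 1))//; last by rewrite lerD2r.
rewrite addeC -(ge0_integral_translation 1)//; congr (_ + _)%E.
by apply: eq_integral => t _; rewrite pF.
Qed.

End integral_completed.

(** * Periodic Borel versions *)

Section borel_versions.
Context {R : realType}.
Local Notation mu := (@lebesgue_measure R).
Local Notation leb := (@completed_lebesgue_measure R).
Local Notation T := (lebesgueTypeR R).

Lemma measure0_translation (c : R) (N : set R) : measurable N ->
  mu N = 0%E -> measurable ((fun t => t + c) @^-1` N) /\ mu ((fun t => t + c) @^-1` N) = 0%E.
Proof.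
move=> mN N0; have -> : (fun t => t + c) @^-1` N = (fun t => c + 1 * t) @^-1` N.
  by apply/seteqP; split=> t /=; rewrite mul1r addrC.
split; last by rewrite -[LHS]mul1e -(lebesgue_measure_affine c ltr01 mN).
by rewrite -[X in measurable X]setTI; exact: measurable_affine.
Qed.

Lemma ae_translation (c : R) (P : R -> Prop) :
  {ae mu, forall x, P x} -> {ae mu, forall x, P (x + c)}.
Proof.
move=> [N [mN N0 NP]]; have [mN' N'0] := measure0_translation c mN N0.
by exists ((fun t => t + c) @^-1` N); split => // x /= Hx; exact: NP.
Qed.

(** This is where completeness of the measure is used: composing a Lebesgue
measurable function with a translation or a dilation is handled by composing its
Borel version instead. *)
Lemma ae_eq_lebesgue_measurable (f g : R -> R) : measurable_fun [set: R] g ->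
  {ae mu, forall x, f x = g x} -> measurable_fun [set: T] (f : T -> R).
Proof.
move=> mg fg; apply/measurable_EFinP.
apply: (ae_measurable_fun completed_lebesgue_measure_is_complete (f := EFin \o g)).
  have [N [mN N0 NP]] := ae_lebesgue_completed fg.
  exists N; split => //; apply: subset_trans NP => x /= h fgx; apply: h => _.
  by rewrite /= fgx.
by apply/measurable_EFinP; exact: borel_lebesgue_measurable_funT.
Qed.

(** A Lebesgue measurable set is a Borel set up to a subset of a null Borel set. *)
Lemma lebesgue_measurable_borel_diff (A : set R) : measurable (A : set T) ->
  exists2 N : set R, measurable N /\ mu N = 0%E &
    forall M : set R, measurable M -> N `<=` M -> measurable (A `\` M).
Proof.
move=> mA.
have : (completed_algebra_gen mu) A.
  by rewrite -g_sigma_completed_algebra_genE completed_caratheodory_measurable.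
move=> [B mB [N0 [N [mN mN0 N0N]]] <-]; exists N => // M mM NM.
have -> : (B `|` N0) `\` M = B `\` M.
  apply/seteqP; split=> t [] h Mt; last by split => //; left.
  by case: h => [//|/N0N/NM].
exact: measurableD.
Qed.

(** Each set [f < q], q rational, becomes Borel once a Borel null set N_q is removed.
The union M of all integer translates of the N_q is null and 1-periodic, and f
set to 0 on M is the required function. *)
Lemma ex_borel_version (f : R -> R) :
  measurable_fun [set: T] (f : T -> R) -> periodic f 1 ->
  exists g : R -> R, [/\ measurable_fun [set: R] g, periodic g 1 &
    {ae mu, forall x, f x = g x}].
Proof.
move=> mf pf.
pose q n : R := ratr (odflt 0 (@unpickle rat n)).
pose z n : R := (odflt 0 (@unpickle int n))%:~R.
have /choice[N NP] n : exists N : set R, (measurable N /\ mu N = 0%E) /\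
    forall M : set R, measurable M -> N `<=` M -> measurable ((f @^-1` `]-oo, q n[) `\` M).
  have [|N hN hM] := @lebesgue_measurable_borel_diff (f @^-1` `]-oo, q n[).
    rewrite -[X in measurable X]setTI; apply: mf => //; exact: measurable_itv.
  by exists N.
pose M : set R := \bigcup_i \bigcup_j ((fun t => t + z i) @^-1` N j).
have mM : measurable M.
  apply: bigcupT_measurable => i; apply: bigcupT_measurable => j.
  by have [[mN N0] _] := NP j; have [] := measure0_translation (z i) mN N0.
have NM n : N n `<=` M.
  by move=> t Nt; exists (pickle (0 : int)) => //; exists n => //=; rewrite /z pickleK/= addr0.
have M0 : mu M = 0%E.
  apply/eqP; rewrite eq_le measure_ge0 andbT.
  have neg : mu.-negligible M.
    apply: negligible_bigcup => i; apply: negligible_bigcup => j.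
    have [[mN N0] _] := NP j; have [m' e'] := measure0_translation (z i) mN N0.
    by exists ((fun t => t + z i) @^-1` N j); split.
  by case: neg => X [mX X0 MX]; rewrite -X0 le_measure// inE.
have M1 t k : M t -> M (t + k%:~R).
  move=> [i _ [j _ /= h]]; exists (pickle (odflt 0 (@unpickle int i) - k)) => //.
  exists j => //=; rewrite /z pickleK/= intrB.
  by rewrite -/(z i) (_ : t + k%:~R + (z i - k%:~R) = t + z i)//; ring.
have MP t : M (t + 1) <-> M t.
  by split=> [/(M1 _ (-1))|/(M1 _ 1)//]; rewrite -addrA addrN addr0.
exists (fun t => if t \in M then 0 else f t); split.
- move=> mT; apply: (measurability _ (RGenInftyO.measurableE R)) => // _ [_ [a ->] <-].
  rewrite setTI.
  have -> : (fun t => if t \in M then 0 else f t) @^-1` `]-oo, a[ =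
      (if 0 < a then M else set0) `|` (\bigcup_n (if q n <= a then (f @^-1` `]-oo, q n[) `\` M else set0)).
    apply/seteqP; split => t /=; rewrite in_itv/=.
      case: ifPn => [|/negP]; rewrite inE => Mt.
        by move=> a0; left; rewrite a0.
      move=> fa; right; have [r /=] := rat_in_itvoo fa; rewrite in_itv/= => /andP[fr ra].
      by exists (pickle r) => //; rewrite /q pickleK/= (ltW ra); split => //=; rewrite in_itv.
    case=> [|[n _]].
      by case: ifP => // a0 Mt; rewrite mem_set.
    case: ifP => // qa [/=]; rewrite in_itv/= => fq Mt.
    by rewrite memNset// (lt_le_trans fq).
  apply: measurableU; first by case: ifP.
  apply: bigcupT_measurable => n; case: ifP => // _.
  by have [_] := NP n; apply.
- move=> t /=; have -> : (t + 1 \in M) = (t \in M).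
    by apply/idP/idP; rewrite !inE => /MP.
  by rewrite pf.
- exists M; split => // t /= h; apply/not_notP => Mt; apply: h.
  by rewrite memNset.
Qed.
End borel_versions.

(** * The Lp norm over a period *)

Section Lp_norm.
Context {R : realType}.
Local Notation mu := (@lebesgue_measure R).
Local Notation leb := (@completed_lebesgue_measure R).
Local Notation T := (lebesgueTypeR R).
Implicit Types (f g : R -> R) (p : R).

Lemma ae_impl (P Q : R -> Prop) : (forall x, P x -> Q x) ->
  {ae mu, forall x, P x} -> {ae mu, forall x, Q x}.
Proof.
by move=> PQ [N [mN N0 NP]]; exists N; split => //; apply: subset_trans NP => x /= h /PQ.
Qed.

Lemma measurable_unit_co : measurable (`[0, 1[%classic : set T).
Proof. by apply: borel_lebesgue_measurable; exact: measurable_itv. Qed.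

(** [Lpnorm] restricts the function to the period; here the domain of integration is
restricted instead. *)
Lemma LpnormE p f : 1 <= p -> Lpnorm p f =
  ((\int[leb]_(x in (`[0%R, 1%R[%classic : set T)) (`|f x| `^ p)%:E) `^ p^-1)%E.
Proof.
move=> p1; have p0 : p != 0 by rewrite gt_eqF// (lt_le_trans ltr01).
rewrite /Lpnorm unlock; congr (_ `^ _)%E; rewrite [RHS]integral_mkcond.
apply: eq_integral => x _; rewrite !patchE; case: ifPn => _ //=.
by rewrite normr0 powR0.
Qed.

Lemma measurable_abs_powR d (U : measurableType d) p (D : set U) (f : U -> R) :
  measurable_fun D f -> measurable_fun D (fun x => (`|f x| `^ p)%:E).
Proof.
move=> mf; apply/measurable_EFinP.
by apply: (measurableT_comp (measurable_powR p)); exact: measurableT_comp.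
Qed.

Lemma Lpnorm_borelE p f : 1 <= p -> measurable_fun [set: R] f -> Lpnorm p f =
  ((\int[mu]_(x in `[0%R, 1%R[) (`|f x| `^ p)%:E) `^ p^-1)%E.
Proof.
move=> p1 mf; rewrite LpnormE//; congr (_ `^ _)%E.
rewrite ge0_integral_completed//.
by apply: measurable_abs_powR; exact: measurable_funS mf.
Qed.

Lemma Lpnorm_ge0 p f : (0 <= Lpnorm p f)%E.
Proof. exact: Lnorm_ge0. Qed.

Lemma Lpnorm_ae_le p f g : 1 <= p ->
  measurable_fun [set: T] (f : T -> R) -> measurable_fun [set: T] (g : T -> R) ->
  {ae mu, forall x, `|f x| <= `|g x|} -> (Lpnorm p f <= Lpnorm p g)%E.
Proof.
move=> p1 mf mg fg; have p0 : 0 < p by exact: lt_le_trans p1.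
have mD := measurable_unit_co.
have mh (h : R -> R) : measurable_fun [set: T] (h : T -> R) ->
    measurable_fun (`[0, 1[%classic : set T) (fun x : T => (`|h x| `^ p)%:E).
  by move=> hm; apply: measurable_abs_powR; exact: measurable_funS hm.
have h0 (h : R -> R) (x : T) : (`[0, 1[%classic : set T) x -> (0 <= (`|h x| `^ p)%:E)%E.
  by move=> _; rewrite lee_fin powR_ge0.
rewrite (LpnormE f p1) (LpnormE g p1); apply: gt0_ler_poweR.
- by rewrite invr_ge0 ltW.
- by rewrite in_itv/= leey andbT; apply: integral_ge0; exact: h0.
- by rewrite in_itv/= leey andbT; apply: integral_ge0; exact: h0.
apply: (ae_ge0_le_integral mD (h0 f) (mh f mf) (h0 g) (mh g mg)).
have [N [mN N0 NP]] := ae_lebesgue_completed fg.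
exists N; split => //; apply: subset_trans NP => x /= h fgx; apply: h => _.
by rewrite lee_fin ge0_ler_powR// ?nnegrE// ltW.
Qed.

Lemma Lpnorm_ae_eq p f g : 1 <= p ->
  measurable_fun [set: T] (f : T -> R) -> measurable_fun [set: T] (g : T -> R) ->
  {ae mu, forall x, f x = g x} -> Lpnorm p f = Lpnorm p g.
Proof.
move=> p1 mf mg fg; apply/le_anti/andP; split.
  by apply: (Lpnorm_ae_le p1 mf mg); apply: ae_impl fg => x ->.
by apply: (Lpnorm_ae_le p1 mg mf); apply: ae_impl fg => x ->.
Qed.

Lemma Lpnorm_le p f g : 1 <= p ->
  measurable_fun [set: T] (f : T -> R) -> measurable_fun [set: T] (g : T -> R) ->
  (forall x, `|f x| <= `|g x|) -> (Lpnorm p f <= Lpnorm p g)%E.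
Proof. by move=> p1 mf mg fg; apply: (Lpnorm_ae_le p1 mf mg); exact: aeW. Qed.

Lemma LpnormD p f g : 1 <= p ->
  measurable_fun [set: T] (f : T -> R) -> measurable_fun [set: T] (g : T -> R) ->
  (Lpnorm p (f \+ g)%R <= Lpnorm p f + Lpnorm p g)%E.
Proof.
move=> p1 mf mg; rewrite /Lpnorm.
pose D : set T := `[0, 1[%classic.
have mD : measurable D := measurable_unit_co.
have E (h : R -> R) : ((EFin \o h) \_ D)%E = EFin \o (h \_ D)%R.
  by apply/funext => x; rewrite /= !patchE; case: ifP.
have ED : (f \+ g) \_ D = (f \_ D \+ g \_ D)%R.
  by apply/funext => x; rewrite /= !patchE; case: ifP; rewrite // addr0.
have mr (h : R -> R) : measurable_fun [set: T] (h : T -> R) ->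
    measurable_fun [set: T] (h \_ D : T -> R).
  by move=> mh; apply/(measurable_restrictT _ mD); exact: measurable_funS mh.
rewrite -/D !E ED; exact: minkowski_EFin (mr f mf) (mr g mg) p1.
Qed.

Lemma LpnormZ p (c : R) f : 1 <= p -> measurable_fun [set: T] (f : T -> R) ->
  (Lpnorm p (fun x => (c * f x)%R) = `|c|%:E * Lpnorm p f)%E.
Proof.
move=> p1 mf; have p0 : 0 < p by exact: lt_le_trans p1.
rewrite !LpnormE//.
under eq_integral do rewrite normrM powRM// EFinM.
have mfp : measurable_fun (`[0, 1[%classic : set T) (fun x : T => (`|f x| `^ p)%:E).
  by apply: measurable_abs_powR; exact: measurable_funS mf.
rewrite (@ge0_integralZl _ _ _ leb _ measurable_unit_co _ mfp) ?lee_fin ?powR_ge0//.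
rewrite poweRM ?lee_fin ?powR_ge0//; last first.
  by apply: integral_ge0 => x _; rewrite lee_fin powR_ge0.
by rewrite poweR_EFin -powRrM mulfV ?gt_eqF// powRr1.
Qed.

Lemma LpnormN p f : 1 <= p -> measurable_fun [set: T] (f : T -> R) ->
  Lpnorm p (\- f) = Lpnorm p f.
Proof.
move=> p1 mf; rewrite (_ : \- f = fun x => -1 * f x).
  by rewrite (LpnormZ _ p1 mf) normrN1 mul1e.
by apply/funext => x; rewrite mulN1r.
Qed.

Lemma LpnormB p f g : 1 <= p ->
  measurable_fun [set: T] (f : T -> R) -> measurable_fun [set: T] (g : T -> R) ->
  (Lpnorm p (f \- g)%R <= Lpnorm p f + Lpnorm p g)%E.
Proof.
move=> p1 mf mg; rewrite -(LpnormN p1 mg).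
have mNg : measurable_fun [set: T] (\- g : T -> R) by exact: measurableT_comp.
exact: LpnormD p1 mf mNg.
Qed.

Lemma Lpnorm0 p : 1 <= p -> Lpnorm p (fun=> 0) = 0%E.
Proof.
move=> p1; have := @LpnormZ p 0 (fun=> 0) p1 (measurable_cst _).
rewrite normr0 mul0e => <-; congr Lpnorm.
by apply/funext => x; rewrite mulr0.
Qed.

Lemma measurable_lincomb d (U : measurableType d) (I : Type) (s : seq I) (c : I -> R) (u : I -> U -> R) :
  (forall i, measurable_fun setT (u i)) ->
  measurable_fun setT (fun x => \sum_(i <- s) c i * u i x).
Proof. by move=> mu_; apply: measurable_sum => i; exact: measurable_funM. Qed.

Lemma Lpnorm_lincomb p (I : Type) (s : seq I) (c : I -> R) (u : I -> R -> R) : 1 <= p ->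
  (forall i, measurable_fun [set: T] (u i : T -> R)) ->
  (Lpnorm p (fun x => \sum_(i <- s) c i * u i x)%R <= \sum_(i <- s) `|c i|%:E * Lpnorm p (u i))%E.
Proof.
move=> p1 mu_; elim: s => [|i s ih].
  rewrite big_nil (_ : (fun x => _) = fun=> 0) ?Lpnorm0//.
  by apply/funext => x; rewrite big_nil.
rewrite big_cons (_ : (fun x => _) = (fun x => c i * u i x) \+ (fun x => \sum_(i <- s) c i * u i x)); last first.
  by apply/funext => x; rewrite big_cons.
apply: le_trans (LpnormD p1 _ _) _.
- by apply: measurable_funM => //; exact: mu_.
- exact: measurable_lincomb.
by rewrite leeD// LpnormZ//; exact: mu_.
Qed.

(** Invariance under translation of an integral over a period, applied to a Borel
version of f. *)
Lemma Lpnorm_translation p (c : R) f : 1 <= p ->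
  measurable_fun [set: T] (f : T -> R) -> periodic f 1 ->
  measurable_fun [set: T] ((fun x => f (x + c)) : T -> R) /\
  Lpnorm p (fun x => f (x + c)) = Lpnorm p f.
Proof.
move=> p1 mf pf; have [g [mg pg fg]] := ex_borel_version mf pf.
have mgc : measurable_fun [set: R] (fun x => g (x + c)).
  by apply: measurableT_comp => //; exact: measurable_funD.
have fgc := ae_translation c fg.
have mfc := ae_eq_lebesgue_measurable mgc fgc.
split => //.
rewrite (Lpnorm_ae_eq p1 mf (borel_lebesgue_measurable_funT mg) fg).
rewrite (Lpnorm_ae_eq p1 mfc (borel_lebesgue_measurable_funT mgc) fgc).
apply: (etrans (Lpnorm_borelE p1 mgc)); apply: (etrans _ (esym (Lpnorm_borelE p1 mg))).
apply: (congr1 (fun I => (I `^ p^-1)%E)).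
pose G x := (`|g x| `^ p)%:E.
rewrite (@ge0_integral_translation R c 0 1 true true G)/=; last 2 first.
- exact: measurable_abs_powR.
- by move=> x; rewrite lee_fin powR_ge0.
rewrite add0r (addrC 1) ge0_integral_periodic//.
- exact: measurable_abs_powR.
- by move=> x; rewrite lee_fin powR_ge0.
- by move=> x; rewrite /G pg.
Qed.

End Lp_norm.

(** * Integral form of Minkowski's inequality *)

Section averages.
Context {R : realType}.
Local Notation mu := (@lebesgue_measure R).
Local Notation T := (lebesgueTypeR R).
Implicit Types (f F : R -> R) (p u : R).

Lemma lebesgue_measure_unit : mu `[0, 1]%classic = 1%E.
Proof. by rewrite lebesgue_measure_itv/= lte_fin ltr01 oppr0 adde0. Qed.

(** Hoelder's inequality against the constant 1, as [0, 1] has measure 1. *)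
Lemma ge0_integral_jensen p (h : R -> R) : 1 <= p -> measurable_fun [set: R] h ->
  (\int[mu]_(t in `[0%R, 1%R]) `|h t|%:E <=
   (\int[mu]_(t in `[0%R, 1%R]) (`|h t| `^ p)%:E) `^ p^-1)%E.
Proof.
move=> p1 mh; pose D : set R := `[0, 1]%classic.
have mD : measurable D by exact: measurable_itv.
have p0 : 0 < p by exact: lt_le_trans p1.
move: p1; rewrite le_eqVlt => /orP[/eqP <-|p1].
  rewrite invr1 poweRe1; last by apply: integral_ge0 => t _; rewrite lee_fin powR_ge0.
  by under [leRHS]eq_integral do rewrite powRr1//.
pose q := p / (p - 1).
have q0 : 0 < q by rewrite divr_gt0// subr_gt0.
have pq : p^-1 + q^-1 = 1.
  by rewrite /q invf_div mulrBl divff ?gt_eqF// mul1r addrCA subrr addr0.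
have mhD : measurable_fun setT (h \_ D).
  by apply/(measurable_restrictT _ mD); exact: measurable_funS mh.
have mI : measurable_fun setT (\1_D : R -> R) by exact: measurable_indic.
have := hoelder mu mhD mI p0 q0 pq.
rewrite Lnorm1 unlock.
have -> : (\int[mu]_x `|((EFin \o ((h \_ D) \* \1_D)%R) x)| = \int[mu]_(t in D) `|h t|%:E)%E.
  rewrite [RHS]integral_mkcond; apply: eq_integral => x _ /=.
  rewrite !patchE indicE; case: ifPn => xD; first by rewrite /= mulr1.
  by rewrite mul0r normr0.
have -> : (\int[mu]_x (`|(EFin \o (h \_ D)%R) x| `^ p) = \int[mu]_(t in D) (`|h t| `^ p)%:E)%E.
  rewrite [RHS]integral_mkcond; apply: eq_integral => x _ /=.
  by rewrite !patchE; case: ifPn => xD //=; rewrite normr0 powR0// gt_eqF.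
have -> : (\int[mu]_x (`|(EFin \o \1_D) x| `^ q) = 1)%E.
  rewrite (_ : (fun x => _) = (fun x => (\1_D x)%:E)).
    by rewrite integral_indic// setIT; exact: lebesgue_measure_unit.
  apply/funext => x /=; rewrite indicE; case: (x \in D) => /=.
    by rewrite normr1 powR1.
  by rewrite normr0 powR0// gt_eqF.
by rewrite poweR1r mule1.
Qed.

Lemma Rintegral_jensen p (h : R -> R) : 1 <= p -> measurable_fun [set: R] h ->
  ((`|\int[mu]_(t in `[0, 1]) h t| `^ p)%:E <=
   \int[mu]_(t in `[0%R, 1%R]) (`|h t| `^ p)%:E)%E.
Proof.
move=> p1 mh; have p0 : 0 < p by exact: lt_le_trans p1.
set b := (leRHS).
have b0 : (0 <= b)%E by apply: integral_ge0 => t _; rewrite lee_fin powR_ge0.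
have h1 : (`|\int[mu]_(t in `[0%R, 1%R]) h t|%:E <= b `^ p^-1)%E.
  apply: le_trans (ge0_integral_jensen p1 mh).
  have le1 : (`|\int[mu]_(t in `[0%R, 1%R]) (h t)%:E| <= \int[mu]_(t in `[0%R, 1%R]) `|h t|%:E)%E.
    apply: le_abse_integral => //.
    by apply/measurable_EFinP; exact: measurable_funS mh.
  apply: le_trans le1; rewrite /Rintegral.
  (* An infinite extended integral has real value 0. *)
  by case: (integral _ _ _) => [r||] //=; rewrite normr0 leey.
rewrite -poweR_EFin; have -> : b = ((b `^ p^-1) `^ p)%E.
  by rewrite -poweRrM mulVf ?gt_eqF// poweRe1.
apply: gt0_ler_poweR => //; first exact: ltW.
- by rewrite in_itv/= leey lee_fin normr_ge0.
- by rewrite in_itv/= leey poweR_ge0.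
Qed.

Lemma ge0_tonelli_on (D E : set R) (G : R * R -> \bar R) :
  measurable D -> measurable E -> measurable_fun [set: R * R] G -> (forall z, (0 <= G z)%E) ->
  (\int[mu]_(x in D) \int[mu]_(t in E) G (x, t) =
   \int[mu]_(t in E) \int[mu]_(x in D) G (x, t))%E.
Proof.
move=> mD mE mG G0; pose K := (G \_ (D `*` E))%E.
have mK : measurable_fun [set: R * R] K.
  by apply/(measurable_restrictT _ (measurableX mD mE)); exact: measurable_funS mG.
have K0 z : (0 <= K z)%E by rewrite /K patchE; case: ifP.
transitivity (\int[mu]_x \int[mu]_t K (x, t))%E.
  rewrite integral_mkcond; apply: eq_integral => x _; rewrite patchE; case: ifPn => xD.
    rewrite integral_mkcond; apply: eq_integral => t _; rewrite /K !patchE.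
    by rewrite in_setX xD.
  by rewrite integral0_eq// => t _; rewrite /K patchE in_setX (negbTE xD).
transitivity (\int[mu]_t \int[mu]_x K (x, t))%E; first exact: (@fubini_tonelli _ _ (measurableTypeR R) (measurableTypeR R) R mu mu K mK K0).
apply/esym; rewrite integral_mkcond; apply: eq_integral => t _; rewrite patchE; case: ifPn => tE.
  rewrite integral_mkcond; apply: eq_integral => x _; rewrite /K !patchE.
  by rewrite in_setX tE andbT.
by rewrite integral0_eq// => x _; rewrite /K patchE in_setX (negbTE tE) andbF.
Qed.

Lemma ge0_measurable_partial_integral (E : set R) (G : R * R -> \bar R) :
  measurable E -> measurable_fun [set: R * R] G -> (forall z, (0 <= G z)%E) ->
  measurable_fun [set: R] (fun x => \int[mu]_(t in E) G (x, t))%E.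
Proof.
move=> mE mG G0; pose K := (G \_ (setT `*` E))%E.
have mK : measurable_fun [set: R * R] K.
  by apply/(measurable_restrictT _ (measurableX measurableT mE)); exact: measurable_funS mG.
have K0 z : (0 <= K z)%E by rewrite /K patchE; case: ifP.
have := @measurable_fun_fubini_tonelli_F _ _ _ _ R mu K mK K0.
congr (measurable_fun _ _); apply/funext => x; rewrite /fubini_F [RHS]integral_mkcond.
by apply: eq_integral => t _; rewrite /K !patchE in_setX in_setT.
Qed.

Lemma measurable_partial_Rintegral (E : set R) (H : R -> R -> R) :
  measurable E -> measurable_fun [set: R * R] (fun z => H z.1 z.2) ->
  measurable_fun [set: R] (fun x => \int[mu]_(t in E) H x t).
Proof.
move=> mE mH; rewrite /Rintegral.
apply: (measurableT_comp (fine_measurable _)) => //.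
pose G (z : R * R) := (H z.1 z.2)%:E.
have mG : measurable_fun [set: R * R] G by exact/measurable_EFinP.
rewrite (_ : (fun x => _) = (fun x => \int[mu]_(t in E) (G^\+ (x, t)) - \int[mu]_(t in E) (G^\- (x, t)))%E).
  apply: emeasurable_funB; apply: ge0_measurable_partial_integral => //.
    exact: measurable_funepos.
  exact: measurable_funeneg.
apply/funext => x; rewrite integralE; congr (_ - _)%E.
  by apply: eq_integral => t _; rewrite !funeposE.
by apply: eq_integral => t _; rewrite !funenegE.
Qed.

(** Minkowski's inequality for integrals over a probability space, in the form needed
here: Jensen's inequality inside the integral, then Tonelli's theorem. *)
Lemma Lpnorm_average p (H : R -> R -> R) (M : \bar R) : 1 <= p ->
  measurable_fun [set: R * R] (fun z => H z.1 z.2) ->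
  (forall t, 0 <= t <= 1 -> (Lpnorm p (H ^~ t) <= M)%E) ->
  (Lpnorm p (fun x => \int[mu]_(t in `[0, 1]) H x t)%R <= M)%E.
Proof.
move=> p1 mH HM; have p0 : 0 < p by exact: lt_le_trans p1.
have M0 : (0 <= M)%E by apply: le_trans (HM 0 _); rewrite ?Lpnorm_ge0// lexx ler01.
have mH1 x : measurable_fun [set: R] (H x).
  exact: (measurableT_comp mH (pair1_measurable x)).
have mH2 t : measurable_fun [set: R] (H ^~ t).
  exact: (measurableT_comp mH (pair2_measurable t)).
rewrite Lpnorm_borelE//; last exact: measurable_partial_Rintegral.
have -> : M = ((M `^ p) `^ p^-1)%E by rewrite -poweRrM mulfV ?gt_eqF// poweRe1.
apply: gt0_ler_poweR; rewrite ?in_itv/= ?leey ?poweR_ge0 ?andbT ?invr_ge0//; first exact: ltW.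
  by apply: integral_ge0 => x _; rewrite lee_fin powR_ge0.
pose G (z : R * R) := (`|H z.1 z.2| `^ p)%:E.
have mG : measurable_fun [set: R * R] G by exact: measurable_abs_powR.
have G0 z : (0 <= G z)%E by rewrite lee_fin powR_ge0.
apply: (@le_trans _ _ (\int[mu]_(x in `[0%R, 1%R[) \int[mu]_(t in `[0%R, 1%R]) G (x, t))%E).
  apply: ge0_le_integral => //.
  - apply: measurable_abs_powR; apply: measurable_funS (measurable_partial_Rintegral _ mH) => //.
  - apply: measurable_funS (ge0_measurable_partial_integral _ mG G0) => //.
  - by move=> x _; exact: Rintegral_jensen.
rewrite ge0_tonelli_on//.
have -> : (M `^ p = \int[mu]_(t in `[0%R, 1%R]) (M `^ p))%E.
  by rewrite integral_cst// [X in (_ * X)%E]lebesgue_measure_unit mule1.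
apply: ge0_le_integral => //.
- by move=> x _; apply: integral_ge0 => t _.
- pose G' (z : R * R) := G (z.2, z.1).
  have mG' : measurable_fun [set: R * R] G'.
    exact: (measurableT_comp mG (@measurable_swap _ _ R R)).
  by apply: measurable_funS (ge0_measurable_partial_integral _ mG' _) => // z; exact: G0.
move=> t; rewrite /= in_itv/= => t01.
have := HM t t01; rewrite Lpnorm_borelE// => le1.
have -> : (\int[mu]_(x in `[0%R, 1%R[) G (x, t) =
   ((\int[mu]_(x in `[0%R, 1%R[) G (x, t)) `^ p^-1) `^ p)%E.
  rewrite -poweRrM mulVf ?gt_eqF// poweRe1//.
  by apply: integral_ge0 => x _; exact: G0.
by apply: gt0_ler_poweR; rewrite ?in_itv/= ?leey ?poweR_ge0 ?M0// ltW.
Qed.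

End averages.

(** * Moving averages of periodic functions *)

Section moving_averages.
Context {R : realType}.
Local Notation mu := (@lebesgue_measure R).
Local Notation T := (lebesgueTypeR R).
Implicit Types (f F : R -> R) (p u : R).

(** The Borel representatives on which moving averages are computed. *)
Definition periodic_integrable F := [/\ measurable_fun [set: R] F, periodic F 1 &
  forall a b : R, mu.-integrable `[a, b] (EFin \o F)].

Lemma continuous_periodic_integrable F : continuous F -> periodic F 1 ->
  periodic_integrable F.
Proof.
move=> cF pF; split => //; first exact: continuous_measurable_fun.
move=> a b; apply: continuous_compact_integrable; first exact: segment_compact.
exact: continuous_subspaceT.
Qed.

(** |F| <= 1 + |F|^p on one period, and any interval is covered by finitely many
periods. *)
Lemma Lp_periodic_integrable p F : 1 <= p -> measurable_fun [set: R] F -> periodic F 1 ->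
  (Lpnorm p F < +oo)%E -> periodic_integrable F.
Proof.
move=> p1 mF pF Foo; have p0 : 0 < p by exact: lt_le_trans p1.
split => // a b.
pose G x := `|F x|%:E.
have mG : measurable_fun [set: R] G by apply/measurable_EFinP; exact: measurableT_comp.
have G0 x : (0 <= G x)%E by rewrite lee_fin.
have pG x : G (x + 1) = G x by rewrite /G pF.
have G1 : (\int[mu]_(t in `[0%R, 1%R[) G t < +oo)%E.
  move: Foo; rewrite Lpnorm_borelE// => /lty_poweRy h.
  have {}h := h _; have {h} := h (invr_neq0 (lt0r_neq0 p0)) => Foo.
  have m1 : measurable_fun (`[0%R, 1%R[%classic : set R) (fun x => (1 + `|F x| `^ p)%:E).
    apply/measurable_EFinP; apply: measurable_funD => //; apply/measurable_EFinP.
    by apply: measurable_abs_powR; exact: measurable_funS mF.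
  (* |F| <= 1 + |F|^p, by cases on |F| <= 1. *)
  apply: (@le_lt_trans _ _ (\int[mu]_(t in `[0%R, 1%R[) (1 + `|F t| `^ p)%:E)%E).
    apply: ge0_le_integral => //; first exact: measurable_funS mG.
    move=> x _; rewrite lee_fin; have [h|h] := leP (`|F x|) 1.
      by rewrite (le_trans h)// lerDl powR_ge0.
    by rewrite (le_trans (le1r_powR (ltW h) p1))// lerDr.
  under eq_integral do rewrite EFinD.
  rewrite ge0_integralD//=; last first.
    by apply: measurable_abs_powR; exact: measurable_funS mF.
  rewrite integral_cst//= [X in (_ * X + _)%E](_ : _ = 1%E); last first.
    by rewrite [LHS]lebesgue_measure_itv/= lte_fin ltr01 oppr0 adde0.
  by rewrite mule1 lte_add_pinfty// ltry.
have Gn (n : nat) : (\int[mu]_(t in `[a, (a + n%:R)%R[) G t < +oo)%E.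
  elim: n => [|n ih]; first by rewrite addr0 set_itvco0 integral_set0 ltry.
  rewrite (@ge0_integral_co_split _ G a (a + n%:R))// ?lerD2l ?ler_nat// ?lerDl ?ler0n//.
  by rewrite lte_add_pinfty// -natr1 addrA ge0_integral_periodic.
apply/integrableP; split; first by apply/measurable_EFinP; exact: measurable_funS mF.
pose n := Num.bound (b - a).
apply: le_lt_trans (Gn n); apply: ge0_subset_integral => //.
  exact: measurable_funS mG.
move=> t /=; rewrite !in_itv/= => /andP[-> tb]/=.
rewrite -ltrBlDl (le_lt_trans (lerB tb (lexx a)))//.
have [ab|ab] := leP 0 (b - a); first exact: archi_boundP.
exact: lt_le_trans ab _.
Qed.

(** Averaging over [0, 1] makes sense at u = 0 too, where it is the identity
([average0]). *)
Definition average u F (x : R) : R := \int[mu]_(t in `[0, 1]) F (x + u * t).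

Lemma average0 F : average 0 F = F.
Proof.
apply/funext => x; rewrite /average.
under eq_Rintegral do rewrite mul0r addr0.
by rewrite Rintegral_cst// [X in fine X]lebesgue_measure_unit mulr1.
Qed.

Lemma averageE u F x : 0 < u -> periodic_integrable F ->
  average u F x = u^-1 * \int[mu]_(y in `[x, x + u]) F y.
Proof.
move=> u0 [mF pF iF].
rewrite (@Rintegral_affine R x u `[x, x + u]%classic F)// mulKf ?gt_eqF//.
have -> : `[x, x + u]%classic = `[x + u * 0, x + u * 1]%classic by rewrite mulr0 addr0 mulr1.
by rewrite preimage_affine_itv.
Qed.

Lemma average_integrable u F x : 0 <= u -> periodic_integrable F ->
  mu.-integrable `[0, 1] (fun t => (F (x + u * t))%:E).
Proof.
rewrite le_eqVlt => /orP[/eqP <- _|u0 [mF pF iF]].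
  rewrite (_ : (fun t => _) = EFin \o cst (F x)); last first.
    by apply/funext => t /=; rewrite mul0r addr0.
  apply: continuous_compact_integrable; first exact: segment_compact.
  by apply: continuous_subspaceT => ?; exact: cvg_cst.
have := integrable_affine x u0 (measurable_itv `[x + u * 0, x + u * 1]) mF (iF _ _).
by rewrite preimage_affine_itv.
Qed.

Lemma periodic_average u F : periodic F 1 -> periodic (average u F) 1.
Proof. by move=> pF x; rewrite /average; apply: eq_Rintegral => t _; rewrite addrAC pF. Qed.

(** Increments of a primitive: continuity and differentiability of averages follow
from those of the primitive. *)
Lemma average_primitive u F a x : 0 < u -> periodic_integrable F -> a <= x ->
  average u F x = u^-1 * (\int[mu]_(y in `[a, x + u]) F y - \int[mu]_(y in `[a, x]) F y).
Proof.
move=> u0 FP ax; rewrite averageE//; congr (_ * _).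
case: FP => mF pF iF.
rewrite (Rintegral_itvB (b := BRight (x + u)))//.
  by rewrite Rintegral_itv_obnd_cbnd//; apply: integrableS (iF x (x + u)) => //; exact: subset_itv_oc_cc.
by rewrite bnd_simp lerDl ltW.
Qed.

Lemma continuous_average u F : 0 < u -> periodic_integrable F -> continuous (average u F).
Proof.
move=> u0 FP x; pose a := x - 1; pose b := x + u + 1.
have [mF pF iF] := FP.
have ab : a < b by rewrite /a /b; lra.
pose P y : R := \int[mu]_(y in `[a, y]) F y.
have cP y : a < y < b -> {for y, continuous P}.
  move=> yab; have := parameterized_integral_continuous (ltW ab) (iF a b).
  move=> /continuous_within_itvP-/(_ ab)[+ _ _]; apply.
  by rewrite in_itv.
have cQ : (u^-1 * (P (y + u) - P y)) @[y --> x] --> u^-1 * (P (x + u) - P x).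
  apply: cvgM; first exact: cvg_cst.
  apply: cvgB; last by apply: cP; rewrite /a /b; lra.
  apply: (@continuous_comp _ _ _ (fun y => y + u) P).
    by apply: cvgD; [exact: cvg_id|exact: cvg_cst].
  by apply: cP; rewrite /a /b; lra.
rewrite /continuous_at (@average_primitive u F a)//; last by rewrite /a; lra.
apply: cvg_trans cQ; apply: near_eq_cvg; near=> y; rewrite (@average_primitive u F a)//.
have yab : a < y < b by near: y; apply: near_in_itvoo; rewrite in_itv/= /a /b; lra.
lra.
Unshelve. all: by end_near. Qed.

Lemma periodic_integrable_average u F : 0 <= u -> periodic_integrable F ->
  periodic_integrable (average u F).
Proof.
rewrite le_eqVlt => /orP[/eqP <-|u0 FP]; first by rewrite average0.
apply: continuous_periodic_integrable; first exact: continuous_average.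
by apply: periodic_average; case: FP.
Qed.

Lemma is_derive_average u F (x : R) : 0 < u -> continuous F -> periodic F 1 ->
  is_derive x 1 (average u F) (u^-1 * (F (x + u) - F x)).
Proof.
move=> u0 cF pF; have FP := continuous_periodic_integrable cF pF; have [mF _ iF] := FP.
pose a := x - 1; pose b := x + u + 1.
pose P y : R := \int[mu]_(y in `[a, y]) F y.
have dP y : a < y < b -> is_derive y 1 P (F y).
  move=> /andP[ay yb]; have [d <-] := continuous_FTC1_closed yb (iF a b) ay (cF y).
  by rewrite derive1E; exact: derivableP.
have d1 : is_derive x 1 (fun y => P (y + u)) (F (x + u)).
  have := @is_derive1_comp _ P (fun y => y + u) x (F (x + u)) 1.
  rewrite mulr1; apply; first by apply: dP; rewrite /a /b; lra.
  by rewrite -[X in is_derive _ _ _ X]addr0; exact: is_deriveD.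
have d2 : is_derive x 1 P (F x) by apply: dP; rewrite /a /b; lra.
have d3 : is_derive x 1 (fun y => u^-1 * (P (y + u) - P y)) (u^-1 * (F (x + u) - F x)).
  exact: is_deriveZ.
apply: (near_eq_is_derive _ d3) => //.
near=> y; rewrite (@average_primitive u F a)//.
have yab : a < y < b by near: y; apply: near_in_itvoo; rewrite in_itv/= /a /b; lra.
lra.
Unshelve. all: by end_near. Qed.

End moving_averages.

(** * Finite differences *)

Section finite_differences.
Context {R : realType}.
Local Notation mu := (@lebesgue_measure R).
Local Notation T := (lebesgueTypeR R).
Implicit Types (f g F G : R -> R) (p h y : R).

Lemma fdiff0 h f : fdiff 0 h f = f.
Proof.
apply/funext => y; rewrite /fdiff big_nat1 bin0 subnn mul0r addr0.
by rewrite expr0 !mul1r.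
Qed.

(** Pascal's rule; the inductions on the order of a difference rest on it. *)
Lemma fdiffS s h f y : fdiff s.+1 h f y = fdiff s h f (y + h) - fdiff s h f y.
Proof.
pose a k := (-1) ^+ k * f (y + (s.+1 - k)%N%:R * h).
have -> : fdiff s.+1 h f y = \sum_(0 <= k < s.+2) 'C(s.+1, k)%:R * a k.
  by apply: eq_bigr => k _; rewrite mulrA.
rewrite big_nat_recl// bin0.
under eq_bigr do rewrite binS natrD mulrDl.
rewrite big_split/= addrA; congr (_ + _).
  have -> : fdiff s h f (y + h) = \sum_(0 <= k < s.+2) 'C(s, k)%:R * a k.
    rewrite [RHS]big_nat_recr//= bin_small// mul0r addr0.
    rewrite /fdiff; apply: eq_big_nat => k /andP[_ ks].
    by rewrite /a subSn// mulrA; congr (_ * f _); rewrite -natr1; ring.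
  by rewrite [RHS]big_nat_recl// bin0.
rewrite /fdiff -sumrN; apply: eq_bigr => k _.
by rewrite /a subSS exprS mulN1r; ring.
Qed.

Lemma fdiffD m s h f : fdiff (m + s) h f = fdiff m h (fdiff s h f).
Proof.
elim: m => [|m ih]; first by rewrite fdiff0.
by apply/funext => y; rewrite addSn fdiffS ih [RHS]fdiffS.
Qed.

Lemma fdiffDr s h f g : fdiff s h (f \+ g) = fdiff s h f \+ fdiff s h g.
Proof.
apply/funext => y; rewrite /fdiff/= -big_split; apply: eq_bigr => k _.
by rewrite mulrDr.
Qed.

Lemma fdiff_cst s h (c : R) : (0 < s)%N -> fdiff s h (fun=> c) = fun=> 0.
Proof.
by case: s => // s _; apply/funext => y; rewrite fdiffS /fdiff subrr.
Qed.

Lemma fdiff_step0 s f : (0 < s)%N -> fdiff s 0 f = fun=> 0.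
Proof. by case: s => // s _; apply/funext => y; rewrite fdiffS addr0 subrr. Qed.

Lemma periodic_fdiff s h f : periodic f 1 -> periodic (fdiff s h f) 1.
Proof. by move=> pf y; apply: eq_bigr => k _; rewrite addrAC pf. Qed.

Lemma fdiff_Lp p s h f : 1 <= p -> measurable_fun [set: T] (f : T -> R) -> periodic f 1 ->
  measurable_fun [set: T] (fdiff s h f : T -> R) /\
  (Lpnorm p (fdiff s h f) <= (2 ^+ s)%:E * Lpnorm p f)%E.
Proof.
move=> p1 mf pf; elim: s => [|s [mh ih]]; first by rewrite fdiff0 expr0 mul1e.
have -> : fdiff s.+1 h f = (fun y => fdiff s h f (y + h)) \- fdiff s h f.
  by apply/funext => y; rewrite fdiffS.
have [mh' e] := Lpnorm_translation h p1 mh (periodic_fdiff s h pf).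
split; first exact: measurable_funB.
apply: le_trans (LpnormB p1 mh' mh) _; rewrite e.
have -> : (Lpnorm p (fdiff s h f) + Lpnorm p (fdiff s h f) = 2%:E * Lpnorm p (fdiff s h f))%E.
  by rewrite -[2]/(1 + 1) EFinD ge0_muleDl// mul1e.
by rewrite exprS EFinM -muleA lee_pmul2l// lte_fin.
Qed.

Lemma is_derive_fdiff s h g y : (forall x, derivable g x 1) ->
  is_derive y 1 (fdiff s h g) (fdiff s h (derive1 g) y).
Proof.
move=> dg.
have d1 (x : R) : is_derive x 1 g (derive1 g x) by rewrite derive1E; exact: derivableP.
elim: s y => [|s ih] y; first by rewrite !fdiff0.
have e : fdiff s.+1 h g = (fun y => fdiff s h g (y + h)) - fdiff s h g.
  by apply/funext => z; rewrite fdiffS.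
rewrite e fdiffS; apply: is_deriveB.
have := @is_derive1_comp _ (fdiff s h g) (fun z => z + h) y (fdiff s h (derive1 g) (y + h)) 1.
rewrite mulr1; apply.
by rewrite -[X in is_derive _ _ _ X]addr0; exact: is_deriveD.
Qed.

Lemma Rintegral_ge0_subset (A B : set R) G : measurable A -> measurable B -> A `<=` B ->
  mu.-integrable B (EFin \o G) -> (forall x, 0 <= G x) ->
  \int[mu]_(x in A) G x <= \int[mu]_(x in B) G x.
Proof.
move=> mA mB AB iB G0; rewrite /Rintegral; apply: fine_le.
- by apply: integrable_fin_num => //; exact: integrableS iB.
- by apply: integrable_fin_num.
- by apply: ge0_subset_integral => //; [case/integrableP: iB|move=> x _; rewrite lee_fin].
Qed.

Lemma periodic_integrable_norm G : periodic_integrable G -> periodic_integrable (fun x => `|G x|).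
Proof.
move=> [mG pG iG]; split; first exact: measurableT_comp.
  by move=> x; rewrite pG.
by move=> a b; exact: integrable_norm.
Qed.

(** The mean value theorem trades one order of the difference for one derivative:
the difference of order s + 2 of g at y is h times that of order s + 1 of g' at
some c in ]y, y + h[, and [c, c + (s + 1) h] is contained in [y, y + (s + 2) h].
The hypothesis on the derivative of order s is the base case, in which that
derivative need not be differentiable. *)
Lemma fdiff_le_integral s h g G y : 0 < h -> periodic_integrable G ->
  (forall j, (j < s)%N -> forall x, derivable (derive1n j g) x 1) ->
  (forall a b, a <= b -> `|derive1n s g b - derive1n s g a| <= \int[mu]_(x in `[a, b]) `|G x|) ->
  `|fdiff s.+1 h g y| <= h ^+ s * \int[mu]_(x in `[y, y + s.+1%:R * h]) `|G x|.
Proof.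
move=> h0 PG; have [mG pG iG] := periodic_integrable_norm PG.
elim: s g y => [|s ih] g y dg gG.
  by rewrite fdiffS !fdiff0 expr0 !mul1r gG// lerDl ltW.
have dg0 x : derivable g x 1 := dg 0%N isT x.
have d1n j : derive1n j (derive1 g) = derive1n j.+1 g by rewrite /derive1n -iterSr.
rewrite fdiffS.
have [c cy ->] : exists2 c, c \in `]y, (y + h)[ &
    fdiff s.+1 h g (y + h) - fdiff s.+1 h g y = fdiff s.+1 h (derive1 g) c * (y + h - y).
  apply: MVT; first by rewrite ltrDl.
    by move=> x _; exact: is_derive_fdiff.
  apply: continuous_subspaceT => x.
  by have [d _] := is_derive_fdiff s.+1 h x dg0; apply: differentiable_continuous; apply/derivable1_diffP.
rewrite (addrC y) addrK normrM (gtr0_norm h0).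
have := ih (derive1 g) c; rewrite !d1n => {}ih.
apply: (@le_trans _ _ (h ^+ s * \int[mu]_(x in `[c, c + s.+1%:R * h]) `|G x| * h)).
  rewrite ler_pM2r//; apply: ih => [j js x|a b ab]; last exact: gG.
  by rewrite d1n; exact: dg.
rewrite mulrAC -exprSr ler_pM2l ?exprn_gt0//.
apply: Rintegral_ge0_subset => //.
move=> t /=; rewrite !in_itv/= => /andP[ct tc]; move: cy; rewrite in_itv/= => /andP[yc cy].
rewrite (le_trans (ltW yc) ct)/= (le_trans tc)// -[s.+2%:R]natr1 mulrDl mul1r.
by rewrite addrA (addrAC y) lerD2r addrC ltW// addrC.
Qed.

End finite_differences.

(** * Differences of functions in W_p^s *)

Section smoothness_bounds.
Context {R : realType}.
Local Notation mu := (@lebesgue_measure R).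
Local Notation T := (lebesgueTypeR R).
Implicit Types (f g F G : R -> R) (p h y a b c : R).

Lemma ae_impl2 (P Q S : R -> Prop) : (forall x, P x -> Q x -> S x) ->
  {ae mu, forall x, P x} -> {ae mu, forall x, Q x} -> {ae mu, forall x, S x}.
Proof. by move=> PQS; apply: (@filterS2 _ _ (ae_filter_ringOfSetsType mu)). Qed.

Lemma Rintegral_cc_split G a b c : (forall a b, mu.-integrable `[a, b] (EFin \o G)) ->
  a <= b -> b <= c ->
  \int[mu]_(x in `[a, c]) G x = \int[mu]_(x in `[a, b]) G x + \int[mu]_(x in `[b, c]) G x.
Proof.
move=> iG ab bc; apply/eqP; rewrite addrC -subr_eq; apply/eqP.
rewrite (Rintegral_itvB (b := BRight c))//.
by rewrite Rintegral_itv_obnd_cbnd//; apply: integrableS (iG b c) => //; exact: subset_itv_oc_cc.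
Qed.

Lemma Rintegral_cc_translation G a b c : measurable_fun [set: R] G ->
  (forall a b, mu.-integrable `[a, b] (EFin \o G)) ->
  \int[mu]_(x in `[a + c, b + c]) G x = \int[mu]_(x in `[a, b]) G (x + c).
Proof.
move=> mG iG; rewrite (@Rintegral_affine R c 1 `[a + c, b + c]%classic G)// mul1r.
have -> : `[a + c, b + c]%classic = `[c + 1 * a, c + 1 * b]%classic by rewrite !mul1r ![c + _]addrC.
rewrite preimage_affine_itv//; apply: eq_Rintegral => t _.
by rewrite mul1r addrC.
Qed.

Lemma abs_continuous_le_integral01 F G a b : abs_continuous 0 1 F ->
  measurable_fun [set: R] G ->
  {ae mu, forall x, derive1 F x = G x} -> 0 <= a -> a <= b -> b <= 1 ->
  (forall a b, mu.-integrable `[a, b] (EFin \o G)) ->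
  `|F b - F a| <= \int[mu]_(x in `[a, b]) `|G x|.
Proof.
move=> acF mG FG a0 ab b1 iG; have [h [hi hE hF]] := abs_continuous_FTC acF.
have iGn : mu.-integrable `[a, b] (EFin \o (fun x => `|G x|)) by exact: integrable_norm.
have hiS D : measurable (D : set (measurableTypeR R)) -> mu.-integrable D (EFin \o h).
  by move=> mD; apply: integrableS hi.
rewrite hE// (le_trans (le_normr_Rintegral _ _))//; first exact: hiS.
have -> : \int[mu]_(x in `]a, b]) `|h x| = \int[mu]_(x in `]a, b[) `|h x|.
  by rewrite Rintegral_itv_bndo_bndc//; apply: integrable_norm; exact: hiS.
have -> : \int[mu]_(x in `[a, b]) `|G x| = \int[mu]_(x in `]a, b[) `|G x|.
  rewrite -Rintegral_itv_obnd_cbnd; last by apply: integrableS iGn => //; exact: subset_itv_oc_cc.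
  by rewrite Rintegral_itv_bndo_bndc//; apply: integrableS iGn => //; exact: subset_itv_oo_cc.
rewrite le_eqVlt; apply/orP; left; apply/eqP; rewrite /Rintegral; congr fine.
have mh : measurable_fun [set: R] h by case/integrableP : hi => /measurable_EFinP.
apply: ae_eq_integral => //.
- by apply/measurable_EFinP; apply: measurableT_comp => //; exact: measurable_funS mh.
- by apply/measurable_EFinP; apply: measurableT_comp => //; exact: measurable_funS mG.
apply: (ae_impl2 _ hF FG) => x hx Gx /=; rewrite in_itv/= => /andP[ax xb].
by rewrite -Gx hx// (le_lt_trans a0 ax) (lt_le_trans xb b1).
Qed.

(** Periodicity carries the estimate on [0, 1] to every cell [z, z + 1] with z
integer, and the cells that meet [a, b] are added up. *)
Lemma abs_continuous_le_integral F G : abs_continuous 0 1 F -> periodic F 1 ->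
  periodic_integrable G -> {ae mu, forall x, derive1 F x = G x} ->
  forall a b, a <= b -> `|F b - F a| <= \int[mu]_(x in `[a, b]) `|G x|.
Proof.
move=> acF pF PG FG; have [mG pG iG] := PG; have [mGn pGn iGn] := periodic_integrable_norm PG.
have cell (z : int) a b : z%:~R <= a -> a <= b -> b <= z%:~R + 1 ->
    `|F b - F a| <= \int[mu]_(x in `[a, b]) `|G x|.
  move=> za ab bz; have h := Rintegral_cc_translation (a - z%:~R) (b - z%:~R) z%:~R mGn iGn.
  rewrite !subrK in h; rewrite h.
  have -> : \int[mu]_(t in `[a - z%:~R, b - z%:~R]) `|G (t + z%:~R)| = \int[mu]_(t in `[a - z%:~R, b - z%:~R]) `|G t|.
    by apply: eq_Rintegral => t _; rewrite (periodic_int _ _ pG).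
  have Fz c : F c = F (c - z%:~R) by rewrite -(periodic_int z (c - z%:~R) pF) subrK.
  rewrite (Fz a) (Fz b).
  by apply: abs_continuous_le_integral01 => //; lra.
suff H n a b : a <= b -> b <= (Num.floor a)%:~R + n.+1%:R -> `|F b - F a| <= \int[mu]_(x in `[a, b]) `|G x|.
  move=> a b ab; apply: (H (Num.bound (b - a))) => //.
  have ba0 : 0 <= b - a by rewrite subr_ge0.
  have := archi_boundP ba0; have := floorD1_gt a; rewrite intrD -natr1; lra.
elim: n b => [|n ih] b ab bn.
  by apply: (cell (Num.floor a)) => //; exact: floor_le.
have [h|h] := leP b ((Num.floor a)%:~R + n.+1%:R); first exact: ih.
have am : a <= (Num.floor a)%:~R + n.+1%:R.
  have := floorD1_gt a; rewrite intrD => /ltW h1; rewrite (le_trans h1)// lerD2l.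
  by rewrite -[1]/(1%:R) ler_nat.
rewrite (Rintegral_cc_split iGn am (ltW h)).
rewrite (_ : F b - F a = (F b - F ((Num.floor a)%:~R + n.+1%:R)) + (F ((Num.floor a)%:~R + n.+1%:R) - F a)); last by ring.
rewrite (le_trans (ler_normD _ _))// addrC lerD//; first exact: ih.
have e : (Num.floor a)%:~R + n.+1%:R = (Num.floor a + n.+1%:Z)%:~R :> R by rewrite intrD.
rewrite e; apply: (cell (Num.floor a + n.+1%:Z)) => //; first by rewrite -e ltW.
by rewrite -e -addrA natr1.
Qed.

Definition is_borel_version f G := [/\ measurable_fun [set: R] G, periodic G 1 &
  {ae mu, forall x, f x = G x}].

Lemma Lpnorm_version p f G : 1 <= p -> measurable_fun [set: T] (f : T -> R) ->
  is_borel_version f G -> Lpnorm p f = Lpnorm p G.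
Proof.
move=> p1 mf [mG _ fG].
exact: (Lpnorm_ae_eq p1 mf (borel_lebesgue_measurable_funT mG) fG).
Qed.

(** A Borel version of a member of L_p is integrable on bounded intervals and has
the same norm. *)
Lemma LpT_version p f : 1 <= p -> LpT p f ->
  exists2 G, is_borel_version f G & periodic_integrable G /\ Lpnorm p f = Lpnorm p G.
Proof.
move=> p1 [mf pf foo]; have [G [mG pG fG]] := ex_borel_version mf pf.
exists G; first by split.
have e : Lpnorm p f = Lpnorm p G by apply: Lpnorm_version.
by split => //; apply: (Lp_periodic_integrable p1) => //; rewrite -e.
Qed.

Lemma derive1_periodic F : periodic F 1 -> periodic (derive1 F) 1.
Proof.
move=> pF x; rewrite /derive1.
set u := (X in lim (X @ _) = _); set v := (X in _ = lim (X @ _)).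
suff -> : u = v by [].
by apply/funext => t; rewrite /u /v /= addrA !pF.
Qed.

Lemma periodic_derive1n F n : periodic F 1 -> periodic (derive1n n F) 1.
Proof.
move=> pF; elim: n => [|n ih]; first by rewrite derive1n0.
by apply: (derive1_periodic (F := derive1n n F)).
Qed.

(** Here G is a Borel version of the derivative of order s, on which all later
estimates of differences of g are based. *)
Lemma Wps_fdiff_le_integral p s g : 1 <= p -> (0 < s)%N -> Wps s p g ->
  exists2 G, periodic_integrable G & Lpnorm p (derive1n s g) = Lpnorm p G /\
    forall h y, 0 < h ->
    `|fdiff s h g y| <= h ^+ s.-1 * \int[mu]_(x in `[y, y + s%:R * h]) `|G x|.
Proof.
case: s => // s p1 _ [pg dg ac Lg].
have [G [mG pG gG] [PG e]] := LpT_version p1 Lg; exists G => //; split => // h y h0.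
apply: fdiff_le_integral => // a b ab.
apply: abs_continuous_le_integral => //; exact: periodic_derive1n.
Qed.

(** The pointwise bound of [Wps_fdiff_le_integral] is s h^s times a moving average
of |g^(s)|, and averaging does not increase the norm. *)
Lemma Wps_fdiff_Lp p s g h : 1 <= p -> (0 < s)%N -> 0 < h -> Wps s p g ->
  measurable_fun [set: T] (g : T -> R) ->
  (Lpnorm p (fdiff s h g) <= (s%:R * h ^+ s)%:E * Lpnorm p (derive1n s g))%E.
Proof.
move=> p1 s0 h0 Wg mg; have pg : periodic g 1 by case: Wg.
have [G PG [-> H]] := Wps_fdiff_le_integral p1 s0 Wg.
have [mG pG iG] := periodic_integrable_norm PG.
have u0 : 0 < s%:R * h by rewrite mulr_gt0// ltr0n.
have cA := continuous_average u0 (periodic_integrable_norm PG).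
have mA : measurable_fun [set: T] (average (s%:R * h) (fun x => `|G x|) : T -> R).
  by apply: borel_lebesgue_measurable_funT; exact: continuous_measurable_fun.
have [mD _] := fdiff_Lp s h p1 mg pg.
have mcA : measurable_fun [set: T]
    ((fun y => (s%:R * h ^+ s) * average (s%:R * h) (fun x => `|G x|) y) : T -> R).
  exact: (measurable_funM (measurable_cst _) mA).
apply: (le_trans (Lpnorm_le (g := fun y => (s%:R * h ^+ s) * average (s%:R * h) (fun x => `|G x|) y) p1 mD mcA _)).
  move=> y; rewrite averageE//.
  apply: (le_trans (H h y h0)); apply: (le_trans _ (ler_norm _)).
  rewrite mulrA; rewrite le_eqVlt; apply/orP; left; apply/eqP; congr (_ * _).
  rewrite invfM mulrACA mulfV ?pnatr_eq0 -?lt0n// mul1r.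
  by rewrite -[in RHS](prednK s0) exprSr mulfK// gt_eqF.
rewrite (LpnormZ _ p1 mA) ger0_norm; last by rewrite mulr_ge0// exprn_ge0// ltW.
apply: lee_pmul => //; [by rewrite lee_fin mulr_ge0// exprn_ge0// ltW|exact: Lpnorm_ge0|].
apply: (@Lpnorm_average R p (fun y t => `|G (y + s%:R * h * t)|)) => //.
  apply: (measurableT_comp mG); apply: measurable_funD => //.
  by apply: measurable_funM.
move=> t _; have [mG0 pG0 _] := PG.
have mGT := borel_lebesgue_measurable_funT mG0.
have [mt <-] := Lpnorm_translation (s%:R * h * t) p1 mGT pG0.
have mn : measurable_fun [set: T]
    ((fun y => `|G (y + s%:R * h * t)|) : T -> R) by exact: (measurableT_comp _ mt).
by apply: (Lpnorm_le p1 mn mt) => x; rewrite normr_id.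
Qed.

End smoothness_bounds.

(** * Iterated moving averages *)

Section iterated_averages.
Context {R : realType}.
Local Notation mu := (@lebesgue_measure R).
Local Notation T := (lebesgueTypeR R).
Implicit Types (f g w F G X : R -> R) (p h y u v : R).

Lemma Rintegral_lincomb (I : Type) (r : seq I) (c : I -> R) (w : I -> R -> R) (D : set R) :
  measurable D -> (forall i, mu.-integrable D (EFin \o w i)) ->
  mu.-integrable D (EFin \o (fun t => \sum_(i <- r) c i * w i t)) /\
  \int[mu]_(t in D) (\sum_(i <- r) c i * w i t) = \sum_(i <- r) c i * \int[mu]_(t in D) w i t.
Proof.
move=> mD iw; elim: r => [|i r [ih1 ih2]].
  split.
    rewrite (_ : _ \o _ = cst 0%E); first exact: integrable0.
    by apply/funext => t /=; rewrite big_nil.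
  rewrite big_nil; under eq_Rintegral do rewrite big_nil.
  by rewrite /Rintegral integral0.
have iw1 : mu.-integrable D (EFin \o (fun t => c i * w i t)).
  rewrite (_ : _ \o _ = fun t => ((c i)%:E * (EFin \o w i) t)%E) //.
  exact: integrableZl.
split.
  rewrite (_ : _ \o _ = ((EFin \o (fun t => c i * w i t)%R) \+ (EFin \o (fun t => \sum_(i <- r) c i * w i t)%R))%E); last first.
    by apply/funext => t /=; rewrite big_cons.
  exact: integrableD.
rewrite big_cons; under eq_Rintegral do rewrite big_cons.
by rewrite RintegralD// RintegralZl// ih2.
Qed.

Lemma fdiffZ s h (c : R) w y : fdiff s h (fun x => c * w x) y = c * fdiff s h w y.
Proof. by rewrite /fdiff mulr_sumr; apply: eq_bigr => k _; rewrite mulrCA. Qed.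

Lemma average_fdiff s h u F : 0 <= u -> periodic_integrable F ->
  average u (fdiff s h F) = fdiff s h (average u F).
Proof.
move=> u0 PF; apply/funext => x; rewrite /average /fdiff.
pose w k t := F (x + (s - k)%N%:R * h + u * t).
have iw k : mu.-integrable `[0, 1]%classic (EFin \o w k) by exact: average_integrable.
have mD : measurable (`[0, 1]%classic : set (measurableTypeR R)) by exact: measurable_itv.
have [_ <-] := Rintegral_lincomb (index_iota 0 s.+1) (fun k => 'C(s, k)%:R * (-1) ^+ k) mD iw.
by apply: eq_Rintegral => t _; apply: eq_bigr => k _; rewrite /w addrAC.
Qed.

Definition averages m u F := iter m (average u) F.

Lemma averages_periodic_integrable m u F : 0 <= u -> periodic_integrable F ->
  periodic_integrable (averages m u F).
Proof. by move=> u0 PF; elim: m => //= m ih; exact: periodic_integrable_average. Qed.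

Lemma continuous_averages m u F : 0 < u -> (0 < m)%N -> periodic_integrable F ->
  continuous (averages m u F).
Proof.
case: m => // m u0 _ PF; apply: continuous_average => //.
by apply: averages_periodic_integrable => //; exact: ltW.
Qed.

Lemma is_derive_averages m u F (x : R) : 0 < u -> (0 < m)%N -> periodic_integrable F ->
  is_derive x 1 (averages m.+1 u F) (u^-1 * fdiff 1 u (averages m u F) x).
Proof.
move=> u0 m0 PF; rewrite fdiffS fdiff0; apply: is_derive_average => //.
  exact: continuous_averages.
by have [] := averages_periodic_integrable m (ltW u0) PF.
Qed.

(** Each of the first j derivatives uses up one average: (A_u F)' = u^(-1) Delta_u F. *)
Lemma derive1n_averages j m u F : 0 < u -> (j < m)%N -> periodic_integrable F ->
  derive1n j (averages m u F) = fun x => u ^- j * fdiff j u (averages (m - j) u F) x.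
Proof.
move=> u0 jm PF; elim: j jm => [|j ih] jm.
  by apply/funext => x; rewrite expr0 invr1 mul1r fdiff0 subn0.
rewrite -[LHS]/(derive1 (derive1n j (averages m u F))) ih; last exact: ltnW.
have mj : (0 < m - j.+1)%N by rewrite subn_gt0.
have e : (m - j = (m - j.+1).+1)%N by rewrite subnSK// ltnW.
apply/funext => x; rewrite e derive1E.
have d (y : R) := is_derive_averages y u0 mj PF.
have dd (y : R) : derivable (averages (m - j.+1).+1 u F) y 1 by case: (d y).
have := is_derive_fdiff j u x dd.
have -> : derive1 (averages (m - j.+1).+1 u F) = fun y => u^-1 * fdiff 1 u (averages (m - j.+1) u F) y.
  by apply/funext => y; rewrite derive1E; case: (d y).
move=> dj; have [_ ->] := @is_deriveZ _ _ _ _ (u ^- j) _ _ _ dj.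
have -> : fdiff j.+1 u (averages (m - j.+1) u F) = fdiff j u (fdiff 1 u (averages (m - j.+1) u F)).
  by rewrite -fdiffD addn1.
by rewrite /GRing.scale/= exprSr invfM -mulrA fdiffZ.
Qed.

Lemma derivable_averages j m u F (x : R) : 0 < u -> (j.+1 < m)%N -> periodic_integrable F ->
  derivable (derive1n j (averages m u F)) x 1.
Proof.
move=> u0 jm PF; rewrite derive1n_averages//; last exact: ltnW.
have mj : (0 < m - j.+1)%N by rewrite subn_gt0.
have e : (m - j = (m - j.+1).+1)%N by rewrite subnSK// ltnW.
rewrite e.
have dd (y : R) : derivable (averages (m - j.+1).+1 u F) y 1.
  by case: (is_derive_averages y u0 mj PF).
have dj := is_derive_fdiff j u x dd.
by have [] := @is_deriveZ _ _ _ _ (u ^- j) _ _ _ dj.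
Qed.

Lemma is_derive_lincomb (I : Type) (r : seq I) (c : I -> R) (w : I -> R -> R) (x : R) :
  (forall i, derivable (w i) x 1) ->
  is_derive x 1 (fun y => \sum_(i <- r) c i * w i y) (\sum_(i <- r) c i * derive1 (w i) x).
Proof.
move=> dw; elim: r => [|i r ih].
  rewrite big_nil (_ : (fun y => _) = cst 0); first exact: is_derive_cst.
  by apply/funext => y; rewrite big_nil.
rewrite big_cons (_ : (fun y => _) = (fun y => c i * w i y) + (fun y => \sum_(i <- r) c i * w i y)); last first.
  by apply/funext => y; rewrite big_cons.
apply: is_deriveD; apply: is_deriveZ.
by rewrite derive1E; exact: derivableP.
Qed.

Lemma derive1n_lincomb (I : Type) (r : seq I) (c : I -> R) (w : I -> R -> R) j :
  (forall i k x, (k < j)%N -> derivable (derive1n k (w i)) x 1) ->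
  derive1n j (fun y => \sum_(i <- r) c i * w i y) = fun y => \sum_(i <- r) c i * derive1n j (w i) y.
Proof.
elim: j => // j ih dw.
rewrite -[LHS]/(derive1 (derive1n j _)) ih; last first.
  by move=> i k x kj; apply: dw; exact: ltnW.
apply/funext => y; rewrite derive1E.
by have [_ ->] := is_derive_lincomb r c (fun i => dw i j y (ltnSn j)).
Qed.

End iterated_averages.

(** * The smooth approximant *)

Section smooth_approximation.
Context {R : realType}.
Local Notation mu := (@lebesgue_measure R).
Local Notation T := (lebesgueTypeR R).
Implicit Types (f g w F G X : R -> R) (p h y u v : R).

(** On [0, 1] the derivative is bounded, so that the function is Lipschitz. *)
Lemma C1_abs_continuous F : (forall x, derivable F x 1) -> continuous (derive1 F) ->
  abs_continuous 0 1 F.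
Proof.
move=> dF cF.
have [c c01 cmax] : exists2 c, c \in `[0, 1]%R & forall t, t \in `[0, 1]%R -> `|derive1 F t| <= `|derive1 F c|.
  apply: (EVT_max ler01 (f := fun x => `|derive1 F x|)); apply: continuous_subspaceT => x.
  by apply: cvg_norm; exact: cF.
pose M := `|derive1 F c| + 1; have M0 : 0 < M by rewrite ltr_wpDl.
have lip u v : 0 <= u -> u <= v -> v <= 1 -> `|F v - F u| <= M * (v - u).
  move=> u0; rewrite le_eqVlt => /orP[/eqP <-|uv v1]; first by rewrite !subrr normr0 mulr0.
  have [d duv ->] : exists2 d, d \in `]u, v[ & F v - F u = derive1 F d * (v - u).
    apply: MVT => //; first by move=> x _; rewrite derive1E; exact: derivableP.
    by apply: continuous_subspaceT => x; apply: differentiable_continuous; apply/derivable1_diffP.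
  rewrite normrM (gtr0_norm (_ : 0 < v - u)) ?subr_gt0//.
  apply: ler_wpM2r; first by rewrite subr_ge0 ltW.
  move: duv; rewrite in_itv/= => /andP[ud dv].
  by apply: le_trans (cmax d _) _; rewrite ?lerDl// in_itv/=; lra.
move=> e e0; exists (e / M); first by rewrite divr_gt0.
move=> m u v uv _ suv.
apply: (@le_lt_trans _ _ (\sum_(i < m) M * (v i - u i))).
  by apply: ler_sum => i _; have [u0 [uvi v1]] := uv i; exact: lip.
by rewrite -mulr_sumr mulrC -ltr_pdivlMr.
Qed.

Lemma continuous_lincomb (I : Type) (r : seq I) (c : I -> R) (w : I -> R -> R) :
  (forall i, continuous (w i)) -> continuous (fun x => \sum_(i <- r) c i * w i x).
Proof.
move=> cw; elim: r => [|i r ih] x.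
  rewrite (_ : (fun y => _) = cst 0); first exact: cvg_cst.
  by apply/funext => y; rewrite big_nil.
rewrite (_ : (fun y => _) = (fun y => c i * w i y) + (fun y => \sum_(i <- r) c i * w i y)); last first.
  by apply/funext => y; rewrite big_cons.
apply: cvgD; last exact: ih.
by apply: cvgM; [exact: cvg_cst|exact: cw].
Qed.

Definition fdiff_coef s k : R := 'C(s, k)%:R * (-1) ^+ k.

(** The mean over (t_1, ..., t_m) in [0, 1]^m of the difference of order s of F at x
with step y + u (t_1 + ... + t_m), with the mean moved inside the sum: the term
of index k sees its argument move by s - k times the step, which is an iterated
moving average of width (s - k) u. *)
Definition averaged_fdiff m s u y F (x : R) : R :=
  \sum_(0 <= k < s.+1) fdiff_coef s k *
    averages m ((s - k)%N%:R * u) F (x + (s - k)%N%:R * y).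

(** Singles out the variable t_(m+1). *)
Lemma averaged_fdiffS m s u y F : 0 <= u -> periodic_integrable F ->
  averaged_fdiff m.+1 s u y F =
  fun x => \int[mu]_(t in `[0, 1]) averaged_fdiff m s u (y + u * t) F x.
Proof.
move=> u0 PF; apply/funext => x; rewrite /averaged_fdiff.
pose w k t := averages m ((s - k)%N%:R * u) F (x + (s - k)%N%:R * y + (s - k)%N%:R * u * t).
have v0 k : 0 <= (s - k)%N%:R * u by rewrite mulr_ge0.
have iw k : mu.-integrable `[0, 1]%classic (EFin \o w k).
  by apply: average_integrable => //; exact: averages_periodic_integrable.
have mD : measurable (`[0, 1]%classic : set (measurableTypeR R)) by exact: measurable_itv.
have [_ e] := Rintegral_lincomb (index_iota 0 s.+1) (fdiff_coef s) mD iw.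
rewrite -[LHS]e; apply: eq_Rintegral => t _; apply: eq_bigr => k _.
by rewrite /w mulrDr mulrA addrA.
Qed.

(** All the steps that are averaged lie in [0, h[, and [Lpnorm_average] is applied
once for each variable. *)
Lemma Lpnorm_averaged_fdiff p m s u y h F : 1 <= p -> (0 < s)%N ->
  periodic_integrable F -> 0 <= u -> 0 <= y -> y + m%:R * u < h ->
  (Lpnorm p (averaged_fdiff m s u y F) <= omega s p F h)%E.
Proof.
move=> p1 s0 PF u0; have [mF pF _] := PF.
elim: m y => [|m ih] y y0 yh.
  have -> : averaged_fdiff 0 s u y F = fdiff s y F by [].
  move: y0; rewrite le_eqVlt => /orP[/eqP y0|y0].
    rewrite -y0 fdiff_step0// Lpnorm0//.
    (* A zero step does not occur in the supremum, but it gives the zero difference. *)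
    have h0 : 0 < h / 2 by rewrite divr_gt0//; lra.
    apply: le_trans (Lpnorm_ge0 p (fdiff s (h / 2) F)) _; apply: ereal_sup_ubound.
    by exists (h / 2) => //=; rewrite in_itv/= h0; lra.
  by apply: ereal_sup_ubound; exists y => //=; rewrite in_itv/= y0; lra.
rewrite averaged_fdiffS//.
apply: (@Lpnorm_average R p (fun x t => averaged_fdiff m s u (y + u * t) F x)) => //.
  apply: measurable_sum => k; apply: measurable_funM => //.
  have [mA _ _] : periodic_integrable (averages m ((s - k)%N%:R * u) F).
    by apply: averages_periodic_integrable => //; rewrite mulr_ge0.
  apply: (measurableT_comp mA); apply: measurable_funD => //.
  apply: measurable_funM => //; apply: measurable_funD => //.
  by apply: measurable_funM.
move=> t /andP[t0 t1]; apply: ih; first by rewrite addr_ge0// mulr_ge0.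
apply: le_lt_trans yh; rewrite -addrA lerD2l -natr1 mulrDl mul1r addrC lerD2l.
by rewrite -[leRHS]mulr1 ler_wpM2l.
Qed.

(** The terms k < s of [averaged_fdiff s.+1 s u 0 F], divided by minus the sign of
the term k = s, which is F up to that sign. There are s + 1 averages: s of them pay for
the derivatives and the last one makes the s-th derivative continuous. *)
Definition smooth_approx s u F (x : R) : R :=
  \sum_(k < s) (- (-1) ^+ s * fdiff_coef s k) * averages s.+1 ((s - k)%N%:R * u) F x.

Lemma averages0 m F : averages m 0 F = F.
Proof. by elim: m => // m; rewrite /averages iterS => ->; rewrite average0. Qed.

Lemma smooth_approx_error s u F :
  F \- smooth_approx s u F = fun x => (-1) ^+ s * averaged_fdiff s.+1 s u 0 F x.
Proof.
apply/funext => x; rewrite /averaged_fdiff big_nat_recr//.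
rewrite subnn !mul0r addr0 averages0 /=.
rewrite {2}/fdiff_coef binn mul1r mulrDr mulrA -expr2 sqrr_sign mul1r addrC.
congr (_ + _); rewrite /smooth_approx big_mkord mulr_sumr -sumrN; apply: eq_bigr => k _.
by rewrite mulr0 addr0 !mulNr opprK !mulrA.
Qed.

Lemma bin_sum_le s : \sum_(k < s) 'C(s, k)%:R <= 2 ^+ s :> R.
Proof.
have -> : 2 ^+ s = \sum_(k < s.+1) 'C(s, k)%:R :> R.
  rewrite -natrX -[(2 ^ s)%N]/((1 + 1) ^ s)%N Pascal natr_sum.
  by apply: eq_bigr => k _; rewrite !exp1n !muln1.
by rewrite big_ord_recr/= lerDl.
Qed.

Section estimates.
Variables (p : R) (s : nat) (u h : R) (F : R -> R).
(* By [uh], sums of s + 1 variables in [0, u] stay below h. *)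
Hypotheses (p1 : 1 <= p) (s0 : (0 < s)%N) (u0 : 0 < u) (uh : s.+1%:R * u < h)
  (mF : measurable_fun [set: R] F) (pF : periodic F 1) (Foo : (Lpnorm p F < +oo)%E).
Let g := smooth_approx s u F.
Let W := omega s p F h.
Let PF : periodic_integrable F := Lp_periodic_integrable p1 mF pF Foo.
Let w (k : 'I_s) := averages s.+1 ((s - k)%N%:R * u) F.
Let v0 (k : 'I_s) : 0 < (s - k)%N%:R * u.
Proof. by rewrite mulr_gt0// ltr0n subn_gt0. Qed.

Let W_ge0 : (0 <= W)%E.
Proof.
have h0 : 0 < h by apply: lt_trans uh; rewrite mulr_gt0.
apply: le_trans (Lpnorm_ge0 p (fdiff s (h / 2) F)) _; apply: ereal_sup_ubound.
by exists (h / 2) => //=; rewrite in_itv/=; lra.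
Qed.

(** Bounds the modulus by 2^s times the norm. *)
Lemma omega_lty : (W < +oo)%E.
Proof.
apply: (@le_lt_trans _ _ ((2 ^+ s)%:E * Lpnorm p F)%E).
  apply: ge_ereal_sup => _ [t _ <-].
  by have [] := fdiff_Lp s t p1 (borel_lebesgue_measurable_funT mF) pF.
by rewrite lte_mul_pinfty// lee_fin exprn_ge0.
Qed.

Lemma Lpnorm_smooth_approx_error : (Lpnorm p (F \- g)%R <= W)%E.
Proof.
rewrite smooth_approx_error.
have m : measurable_fun [set: T] (averaged_fdiff s.+1 s u 0 F : T -> R).
  apply: borel_lebesgue_measurable_funT; apply: measurable_sum => k; apply: measurable_funM => //.
  have [mA _ _] : periodic_integrable (averages s.+1 ((s - k)%N%:R * u) F).
    by apply: averages_periodic_integrable => //; rewrite mulr_ge0// ltW.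
  by apply: (measurableT_comp mA); apply: measurable_funD.
rewrite LpnormZ// normrX normrN1 expr1n mul1e.
by apply: Lpnorm_averaged_fdiff => //; [exact: ltW|rewrite add0r].
Qed.

Let derivable_w k j x : (j < s)%N -> derivable (derive1n j (w k)) x 1.
Proof. by move=> js; apply: derivable_averages. Qed.

Lemma derive1n_smooth_approx j : (j <= s)%N -> derive1n j g =
  fun x => \sum_(k < s) (- (-1) ^+ s * fdiff_coef s k) * derive1n j (w k) x.
Proof.
move=> js; apply: derive1n_lincomb => k i x ij.
by apply: derivable_w; exact: leq_trans js.
Qed.

Lemma derivable_smooth_approx j x : (j < s)%N -> derivable (derive1n j g) x 1.
Proof.
move=> js; rewrite derive1n_smooth_approx; last exact: ltnW.
by case: (@is_derive_lincomb R _ (index_enum 'I_s) (fun k : 'I_s => - (-1) ^+ s * fdiff_coef s k) (fun k => derive1n j (w k)) x) => // k; exact: derivable_w.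
Qed.

Let derive1n_w k : derive1n s (w k) =
  fun x => ((s - k)%N%:R * u) ^- s * average ((s - k)%N%:R * u) (fdiff s ((s - k)%N%:R * u) F) x.
Proof.
by rewrite derive1n_averages// subSnn average_fdiff// ltW.
Qed.

Let PfF k : periodic_integrable (fdiff s ((s - k)%N%:R * u) F).
Proof.
have [m l] := fdiff_Lp s ((s - k)%N%:R * u) p1 (borel_lebesgue_measurable_funT mF) pF.
apply: (Lp_periodic_integrable p1); [|exact: periodic_fdiff|].
  apply: measurable_sum => i; apply: measurable_funM => //.
  by apply: (measurableT_comp mF); exact: measurable_funD.
by apply: le_lt_trans l _; rewrite lte_mul_pinfty// lee_fin exprn_ge0.
Qed.

Lemma continuous_derive1n_smooth_approx : continuous (derive1n s g).
Proof.
rewrite derive1n_smooth_approx//; apply: continuous_lincomb => k.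
rewrite derive1n_w => x; apply: cvgM; first exact: cvg_cst.
by apply: continuous_average.
Qed.

Lemma periodic_smooth_approx : periodic g 1.
Proof.
move=> x; apply: eq_bigr => k _; congr (_ * _).
by have [_ -> _] := averages_periodic_integrable s.+1 (ltW (v0 k)) PF.
Qed.

(** The terms of the s-th derivative are v^(-s) A_v Delta^s_v F with
v = (s - k) u, and u <= v < h. *)
Lemma Lpnorm_derive1n_smooth_approx :
  (Lpnorm p (derive1n s g) <= (2 ^+ s * u ^- s)%:E * W)%E.
Proof.
rewrite derive1n_smooth_approx//.
have cA (k : 'I_s) := continuous_average (v0 k) (PfF k).
have mA k : measurable_fun [set: T] (derive1n s (w k) : T -> R).
  rewrite derive1n_w; apply: borel_lebesgue_measurable_funT; apply: measurable_funM => //.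
  by apply: continuous_measurable_fun; exact: cA.
apply: le_trans (Lpnorm_lincomb _ _ p1 mA) _.
apply: (@le_trans _ _ (\sum_(k < s) ('C(s, k)%:R * u ^- s)%:E * W)%E); last first.
  rewrite -ge0_sume_distrl; last by move=> k _; rewrite lee_fin mulr_ge0// invr_ge0 exprn_ge0// ltW.
  rewrite sumEFin -mulr_suml; apply: lee_wpmul2r => //.
  by rewrite lee_fin ler_wpM2r ?bin_sum_le// invr_ge0 exprn_ge0// ltW.
apply: lee_sum => k _.
rewrite mulNr normrN normrM normrX normrN1 expr1n mul1r /fdiff_coef normrM normrX normrN1 expr1n mulr1 ger0_norm//.
rewrite EFinM -muleA; apply: lee_wpmul2l; first by rewrite lee_fin.
have mAk : measurable_fun [set: T]
    (average ((s - k)%N%:R * u) (fdiff s ((s - k)%N%:R * u) F) : T -> R).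
  by apply: borel_lebesgue_measurable_funT; apply: continuous_measurable_fun; exact: cA.
rewrite derive1n_w (LpnormZ _ p1 mAk).
apply: lee_pmul => //; [exact: Lpnorm_ge0| |].
  rewrite lee_fin ger0_norm; last by rewrite invr_ge0 exprn_ge0// ltW.
  rewrite lef_pV2 ?posrE ?exprn_gt0//; apply: lerXn2r; rewrite ?nnegrE; [exact: ltW|exact: ltW|].
  by rewrite -[leLHS]mul1r ler_pM2r// -[1]/(1%:R) ler_nat subn_gt0.
have [mf pf _] := PfF k.
apply: (@Lpnorm_average R p (fun x t => fdiff s ((s - k)%N%:R * u) F (x + (s - k)%N%:R * u * t))) => //.
  apply: (measurableT_comp mf); apply: measurable_funD => //.
  by apply: measurable_funM.
move=> t _; have [_ ->] := Lpnorm_translation ((s - k)%N%:R * u * t) p1 (borel_lebesgue_measurable_funT mf) pf.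
apply: ereal_sup_ubound; exists ((s - k)%N%:R * u) => //=; rewrite in_itv/= v0/=.
by apply: le_lt_trans uh; rewrite ler_pM2r// ler_nat (leq_trans (leq_subr _ _)).
Qed.

Lemma Wps_smooth_approx : Wps s p g.
Proof.
split; first exact: periodic_smooth_approx.
- by move=> j js x; apply: derivable_smooth_approx; rewrite (leq_trans js)// leq_pred.
- apply: C1_abs_continuous.
    by move=> x; apply: derivable_smooth_approx; rewrite prednK.
  rewrite -[derive1 _]/(derive1n s.-1.+1 g) prednK//.
  exact: continuous_derive1n_smooth_approx.
- split.
  + apply: borel_lebesgue_measurable_funT; apply: continuous_measurable_fun.
    exact: continuous_derive1n_smooth_approx.
  + exact/periodic_derive1n/periodic_smooth_approx.
  + apply: le_lt_trans Lpnorm_derive1n_smooth_approx _.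
    apply: lte_mul_pinfty; [|by []|exact: omega_lty].
    by rewrite lee_fin mulr_ge0// invr_ge0 exprn_ge0// ltW.
Qed.

Lemma continuous_smooth_approx : continuous g.
Proof.
move=> x; apply: differentiable_continuous; apply/derivable1_diffP.
have d : derivable (derive1n 0 g) x 1 by exact: derivable_smooth_approx.
exact: d.
Qed.

Lemma LpT_smooth_approx : LpT p g.
Proof.
have mg : measurable_fun [set: T] (g : T -> R).
  apply: borel_lebesgue_measurable_funT; apply: continuous_measurable_fun.
  exact: continuous_smooth_approx.
split => //; first exact: periodic_smooth_approx.
have mF' := borel_lebesgue_measurable_funT mF.
have -> : g = F \- (F \- g) by apply/funext => x /=; ring.
apply: le_lt_trans (LpnormB p1 mF' _) _; first exact: measurable_funB.
rewrite lte_add_pinfty//; apply: le_lt_trans Lpnorm_smooth_approx_error _.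
exact: omega_lty.
Qed.

End estimates.

End smooth_approximation.

(** * Central differences *)

Section central_differences.
Context {R : realType}.
Local Notation mu := (@lebesgue_measure R).
Local Notation leb := (@completed_lebesgue_measure R).
Local Notation T := (lebesgueTypeR R).
Implicit Types (f g w F G H : R -> R) (p h y u v delta : R).

Lemma Rintegral_completed (D : set R) F : measurable D -> measurable_fun [set: R] F ->
  \int[leb]_(x in (D : set T)) F x = \int[mu]_(x in D) F x.
Proof.
move=> mD mF; rewrite /Rintegral integralE [in RHS]integralE.
have mFD : measurable_fun D (EFin \o F).
  by apply/measurable_EFinP; exact: measurable_funS mF.
congr (fine (_ - _)%E); apply: ge0_integral_completed => //.
  exact: measurable_funepos.
exact: measurable_funeneg.
Qed.

Lemma ae_affine (c u : R) (P : R -> Prop) : 0 < u ->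
  {ae mu, forall x, P x} -> {ae mu, forall x, P (c + u * x)}.
Proof.
move=> u0 [N [mN N0 NP]]; exists ((fun t => c + u * t) @^-1` N); split.
- by rewrite -[X in measurable X]setTI; exact: measurable_affine.
- have := lebesgue_measure_affine c u0 mN; rewrite N0 => /esym/eqP.
  by rewrite mule_eq0 eqe gt_eqF//= => /eqP.
- by move=> x /= Hx; exact: NP.
Qed.

Lemma ae_bigsum (I : Type) (r : seq I) (f F : I -> R -> R) :
  (forall i, {ae mu, forall x, f i x = F i x}) ->
  {ae mu, forall x, \sum_(i <- r) f i x = \sum_(i <- r) F i x}.
Proof.
move=> fF; elim: r => [|i r ih]; first by apply: aeW => x; rewrite !big_nil.
by apply: (ae_impl2 _ (fF i) ih) => x; rewrite !big_cons => -> ->.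
Qed.

(** Term k of the difference of order 2r mirrors term 2r - k, with the same
coefficient. *)
Lemma central_fdiff r (h : R) g x : fdiff (2 * r) h g (x - r%:R * h) =
  \sum_(0 <= k < r) fdiff_coef (2 * r) k * g (x + (r - k)%N%:R * h) +
  fdiff_coef (2 * r) r * g x +
  \sum_(0 <= k < r) fdiff_coef (2 * r) k * g (x - (r - k)%N%:R * h) :> R.
Proof.
rewrite /fdiff -/(fdiff_coef _ _).
rewrite (@big_cat_nat _ _ _ r)//=; last lia.
rewrite -addrA; congr (_ + _).
  apply: eq_big_nat => k /andP[_ kr]; congr (_ * g _).
  rewrite (_ : 2 * r - k = r + (r - k))%N; last lia.
  by rewrite natrD; ring.
rewrite big_ltn; last lia.
congr (_ + _).
  congr (_ * g _); rewrite (_ : 2 * r - r = r)%N; last lia.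
  by rewrite subrK.
rewrite -{1}(add0n r.+1) big_addn (_ : (2 * r).+1 - r.+1 = r)%N; last lia.
rewrite big_nat_rev/= add0n; apply: eq_big_nat => k /andP[_ kr].
rewrite /fdiff_coef (_ : r - k.+1 + r.+1 = 2 * r - k)%N; last lia.
rewrite bin_sub; last lia.
rewrite (_ : (-1) ^+ (2 * r - k) = (-1) ^+ k); last first.
  by rewrite -signr_odd oddB ?oddM /= ?signr_odd//; lia.
congr (_ * g _); rewrite (_ : 2 * r - (2 * r - k) = k)%N; last lia.
by rewrite natrB 1?ltnW//; ring.
Qed.

(** Turns the negative steps of a symmetric average into positive ones. *)
Lemma fdiff_oppr m h g y : fdiff m (- h) g y = (-1) ^+ m * fdiff m h g (y - m%:R * h).
Proof.
elim: m y => [|m ih] y; first by rewrite !fdiff0 mul0r subr0 mul1r.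
rewrite !fdiffS !ih exprS -natr1.
rewrite (_ : y - h - m%:R * h = y - (m%:R + 1) * h); last by ring.
rewrite (_ : y - (m%:R + 1) * h + h = y - m%:R * h); last by ring.
by ring.
Qed.

Lemma fdiff_le_max m h w y (B : R) :
  (forall k, (k <= m)%N -> `|w (y + k%:R * h)| <= B) -> `|fdiff m h w y| <= 2 ^+ m * B.
Proof.
elim: m y => [|m ih] y wB; first by rewrite fdiff0 mul1r; have := wB 0%N isT; rewrite mul0r addr0.
rewrite fdiffS (le_trans (ler_normB _ _))// exprS -mulrA mulr_natl mulr2n lerD//; apply: ih => k km.
  have := wB k.+1 km; rewrite -natr1 mulrDl mul1r (addrC _ h) addrA; exact.
by apply: wB; exact: leqW.
Qed.

(** A difference of order 2r is a difference of order 2r - s of one of order s; the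
windows of the latter all lie in [x - r h, x + r h]. *)
Lemma central_fdiff_le r s h g G x (d : R) : (0 < s)%N -> (s <= 2 * r)%N ->
  periodic_integrable G ->
  (forall h y, 0 < h ->
    `|fdiff s h g y| <= h ^+ s.-1 * \int[mu]_(x in `[y, y + s%:R * h]) `|G x|) ->
  0 < r%:R * h <= d ->
  `|fdiff (2 * r) h g (x - r%:R * h)| <=
    2 ^+ (2 * r) * (d ^+ s.-1 * \int[mu]_(y in `[x - d, x + d]) `|G y|).
Proof.
move=> s0 s2r PG gG /andP[rh0 rhd].
have r0 : (0 < r)%N by lia.
have r1 : 1 <= r%:R :> R by rewrite -[1]/(1%:R) ler_nat.
have h0 : 0 < h by move: rh0; rewrite pmulr_rgt0// (lt_le_trans ltr01).
have hd : h <= d by apply: le_trans rhd; rewrite -[leLHS]mul1r ler_pM2r.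
have [mG pG iG] := periodic_integrable_norm PG.
have int0 (D : set R) : 0 <= \int[mu]_(y in D) `|G y| by apply: Rintegral_ge0.
rewrite -(subnK s2r) fdiffD.
apply: (@le_trans _ _ (2 ^+ (2 * r - s) * (d ^+ s.-1 * \int[mu]_(y in `[x - d, x + d]) `|G y|))).
  apply: fdiff_le_max => k ks; apply: (le_trans (gG _ _ h0)).
  apply: ler_pM; [by rewrite exprn_ge0// ltW|exact: int0| |].
    by apply: lerXn2r => //; rewrite nnegrE ?(ltW h0)// (le_trans (ltW h0)).
  apply: Rintegral_ge0_subset => //.
  move=> t /=; rewrite !in_itv/= => /andP[t1 t2].
  have kh : 0 <= k%:R * h by rewrite mulr_ge0// ltW.
  have ksr : (k%:R + s%:R) * h <= 2 * r%:R * h.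
    by rewrite ler_pM2r// -natrD -natrM ler_nat; lia.
  have : t <= x + d.
    apply: (le_trans t2); move: ksr; rewrite mulrDl => ksr; lra.
  by move=> ->; rewrite andbT; lra.
rewrite subnK//; apply: ler_wpM2r; first by rewrite mulr_ge0// exprn_ge0// (le_trans (ltW h0)).
by rewrite ler_weXn2l ?leq_subr// ler1n.
Qed.

End central_differences.

(** * Generalized Steklov averages at a point *)

Section steklov_error.
Context {R : realType}.
Local Notation mu := (@lebesgue_measure R).
Local Notation leb := (@completed_lebesgue_measure R).
Local Notation T := (lebesgueTypeR R).
Implicit Types (f g w F G H : R -> R) (p h y u v delta : R).

Lemma continuous_integrable_cc w a b : continuous w -> mu.-integrable `[a, b] (EFin \o w).
Proof.
move=> cw; apply: continuous_compact_integrable; first exact: segment_compact.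
exact: continuous_subspaceT.
Qed.

Lemma continuous_affine_comp g (c u : R) : continuous g -> continuous (fun t => g (c + u * t)).
Proof.
move=> cg t; apply: (@continuous_comp _ _ _ (fun t => c + u * t) g); last exact: cg.
apply: cvgD; first exact: cvg_cst.
by apply: cvgM; [exact: cvg_cst|exact: cvg_id].
Qed.

Lemma preimage_ball_itv (x u d : R) : 0 < u ->
  (fun t => x + u * t) @^-1` `[x - u * d, x + u * d] = `[- d, d]%classic.
Proof. by move=> u0; rewrite -mulrN preimage_affine_itv. Qed.

Lemma dilated_integrable F x u d : 0 < u -> periodic_integrable F ->
  mu.-integrable `[- d, d] (fun t => (F (x + u * t))%:E).
Proof.
move=> u0 [mF _ iF].
have := integrable_affine x u0 (measurable_itv `[x - u * d, x + u * d]) mF (iF _ _).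
by rewrite preimage_ball_itv.
Qed.

(** The factor u^(-1) is the price of the change of variable; the window shrinks. *)
Lemma dilated_Rintegral_le H x u d : 0 < u <= 1 -> 0 <= d -> periodic_integrable H ->
  (forall t, 0 <= H t) ->
  \int[mu]_(t in `[- d, d]) H (x + u * t) <= u^-1 * \int[mu]_(t in `[x - d, x + d]) H t.
Proof.
move=> /andP[u0 u1] d0 [mH _ iH] H0.
have e := @Rintegral_affine R x u `[x - u * d, x + u * d]%classic H u0 (measurable_itv _) mH (iH _ _).
rewrite preimage_ball_itv// in e.
rewrite -[leLHS](mulKf (lt0r_neq0 u0)) -e ler_wpM2l ?invr_ge0 ?(ltW u0)//.
have ud : u * d <= d by rewrite -[leRHS]mul1r ler_wpM2r.
apply: Rintegral_ge0_subset => //.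
by move=> t /=; rewrite !in_itv/= => /andP[h1 h2]; lra.
Qed.

Definition steklov_const r : R := (-1) ^+ r.+1 * ('C(2 * r, r)%:R)^-1.

Lemma steklov_const_le1 r : `|steklov_const r| <= 1.
Proof.
rewrite /steklov_const normrM normrX normrN1 expr1n mul1r ger0_norm ?invr_ge0//.
have b0 : (0 < 'C(2 * r, r))%N by rewrite bin_gt0 leq_pmull.
by rewrite invf_le1 ?ltr0n// -[1]/(1%:R) ler_nat.
Qed.

(** Passing to a Borel version makes it possible to integrate term by term. *)
Lemma steklovE r delta f F x : (0 < r)%N -> 0 < delta ->
  measurable_fun [set: T] (f : T -> R) -> is_borel_version f F -> periodic_integrable F ->
  steklov delta r f x = steklov_const r * (2 / delta) *
    \sum_(0 <= k < r) fdiff_coef (2 * r) k *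
      \int[mu]_(t in `[- (delta / 2), delta / 2]) F (x + (r - k)%N%:R / r%:R * t).
Proof.
move=> r0 d0 mf [mF _ fF] PF; rewrite /steklov; congr (_ * _).
pose w k t := F (x + (r - k)%N%:R / r%:R * t).
have mD : measurable (`[- (delta / 2), delta / 2]%classic : set (measurableTypeR R)) by exact: measurable_itv.
have rho0 (k : 'I_r) : 0 < (r - k)%N%:R / r%:R :> R by rewrite divr_gt0 ?ltr0n ?subn_gt0.
have iw (k : 'I_r) : mu.-integrable `[- (delta / 2), delta / 2]%classic (EFin \o w k).
  exact: dilated_integrable.
have [_ e] := Rintegral_lincomb (index_enum 'I_r) (fun k : 'I_r => fdiff_coef (2 * r) k) mD iw.
rewrite [RHS]big_mkord -[RHS]e -Rintegral_completed//; last first.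
  apply: measurable_sum => k; apply: measurable_funM => //; apply: (measurableT_comp mF).
  exact: measurable_affine.
have aeE : {ae mu, forall t : R, \sum_(0 <= nu < r) (-1) ^+ nu * 'C(2 * r, nu)%:R *
       f (x + (r - nu)%:R / r%:R * t) = \sum_(k < r) fdiff_coef (2 * r) k * w k t}.
  suff : {ae mu, forall t : R, \sum_(k < r) (-1) ^+ k * 'C(2 * r, k)%:R *
       f (x + (r - k)%:R / r%:R * t) = \sum_(k < r) fdiff_coef (2 * r) k * w k t}.
    by apply: ae_impl => t <-; rewrite big_mkord.
  apply: ae_bigsum => k.
  by apply: ae_impl (ae_affine x (rho0 k) fF) => t ->; rewrite /fdiff_coef (mulrC 'C(_, _)%:R).
have mw : measurable_fun [set: R] (fun t => \sum_(k < r) fdiff_coef (2 * r) k * w k t).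
  apply: measurable_sum => k; apply: measurable_funM => //; apply: (measurableT_comp mF).
  exact: measurable_affine.
have mfw := ae_eq_lebesgue_measurable mw aeE.
rewrite /Rintegral; congr fine; apply: ae_eq_integral.
- exact: borel_lebesgue_measurable.
- by apply/measurable_EFinP; exact: measurable_funS mfw.
- apply/measurable_EFinP; apply: (measurable_funS _ _ (borel_lebesgue_measurable_funT mw)) => //.
- have [N [mN N0 NP]] := ae_lebesgue_completed aeE; exists N; split => //.
  by apply: subset_trans NP => t /= h e'; apply: h => _; rewrite e'.
Qed.

(** The central difference of order 2r at x with step t/r, integrated over
[- delta/2, delta/2], gives twice the Steklov sum by the substitution t -> - t,
plus a multiple of g(x) from its middle term: up to the factor
[steklov_const r / delta], it is g_(delta, r)(x) - g(x). *)
Lemma steklov_smooth_error r s delta g G x : (0 < s)%N -> (s <= 2 * r)%N -> 0 < delta ->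
  continuous g -> periodic_integrable G ->
  (forall h y, 0 < h ->
    `|fdiff s h g y| <= h ^+ s.-1 * \int[mu]_(x in `[y, y + s%:R * h]) `|G x|) ->
  `|steklov_const r * (2 / delta) *
    (\sum_(0 <= k < r) fdiff_coef (2 * r) k *
      \int[mu]_(t in `[- (delta / 2), delta / 2]) g (x + (r - k)%N%:R / r%:R * t)) - g x| <=
  2 ^+ (2 * r) * delta ^+ s.-1 * \int[mu]_(y in `[x - delta / 2, x + delta / 2]) `|G y|.
Proof.
move=> s0 s2r d0 cg PG gG; have r0 : (0 < r)%N by lia.
have rn0 : r%:R != 0 :> R by rewrite pnatr_eq0 -lt0n.
have r0' : 0 < r%:R :> R by rewrite ltr0n.
set I := `[- (delta / 2), delta / 2]%classic.
have mI : measurable (I : set (measurableTypeR R)) by exact: measurable_itv.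
have muI : fine (mu I) = delta.
  rewrite lebesgue_measure_itv/= lte_fin ifT /=; last lra.
  by rewrite opprK -splitr.
pose wp k t := g (x + (r - k)%N%:R / r%:R * t).
pose wm k t := g (x + (- ((r - k)%N%:R / r%:R)) * t).
have iwp k : mu.-integrable I (EFin \o wp k).
  by apply: continuous_integrable_cc; exact: continuous_affine_comp.
have iwm k : mu.-integrable I (EFin \o wm k).
  by apply: continuous_integrable_cc; exact: continuous_affine_comp.
(* Terms with t and with - t have the same integral over the symmetric interval. *)
have wpm k : \int[mu]_(t in I) wm k t = \int[mu]_(t in I) wp k t.
  have d20 : - (delta / 2) <= delta / 2 by lra.
  have := integration_by_substitution_oppr (G := wp k) d20.
  rewrite opprK => /(_ (continuous_subspaceT (@continuous_affine_comp g x ((r - k)%N%:R / r%:R) cg))) e.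
  rewrite /Rintegral [in RHS]e; congr fine; apply: eq_integral => t _.
  by rewrite /wm /wp /= mulNr mulrN.
pose D t := fdiff (2 * r) (t / r%:R) g (x - t).
have DE t : D t = \sum_(0 <= k < r) fdiff_coef (2 * r) k * wp k t + fdiff_coef (2 * r) r * g x +
    \sum_(0 <= k < r) fdiff_coef (2 * r) k * wm k t.
  rewrite /D -{2}(divfK rn0 t) (mulrC (t / _)) central_fdiff; congr (_ + _ + _).
    by apply: eq_bigr => k _; congr (_ * g _); rewrite mulrA mulrAC.
  by apply: eq_bigr => k _; congr (_ * g _); rewrite mulNr mulrA mulrAC.
have [i1 e1] := Rintegral_lincomb (index_iota 0 r) (fdiff_coef (2 * r)) mI iwp.
have [i2 e2] := Rintegral_lincomb (index_iota 0 r) (fdiff_coef (2 * r)) mI iwm.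
have ic : mu.-integrable I (EFin \o (fun=> fdiff_coef (2 * r) r * g x)).
  by apply: continuous_integrable_cc => ?; exact: cvg_cst.
have i12 : mu.-integrable I (EFin \o (fun t => \sum_(0 <= k < r) fdiff_coef (2 * r) k * wp k t + fdiff_coef (2 * r) r * g x)).
  by move: (integrableD mI i1 ic); congr (integrable _ _ _).
have iD : mu.-integrable I (EFin \o D).
  by move: (integrableD mI i12 i2); congr (integrable _ _ _); apply/funext => t /=; rewrite DE.
set S := \sum_(0 <= k < r) _.
have intD : \int[mu]_(t in I) D t = 2 * S + fdiff_coef (2 * r) r * g x * delta.
  under eq_Rintegral do rewrite DE.
  rewrite RintegralD// RintegralD// e1 e2 Rintegral_cst// muI.
  by under [X in _ + _ + X]eq_bigr do rewrite wpm; rewrite -/S; ring.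
have cr : steklov_const r * fdiff_coef (2 * r) r = -1.
  rewrite /steklov_const /fdiff_coef mulrA -(mulrA _ _^-1) mulVf ?pnatr_eq0 -?lt0n ?bin_gt0 ?leq_pmull//.
  by rewrite mulr1 exprS mulN1r mulNr -expr2 sqrr_sign.
have cle := steklov_const_le1 r.
have -> : steklov_const r * (2 / delta) * S - g x = steklov_const r / delta * \int[mu]_(t in I) D t.
  rewrite intD mulrDr.
  have -> : steklov_const r / delta * (fdiff_coef (2 * r) r * g x * delta) =
      (steklov_const r * fdiff_coef (2 * r) r) * g x.
    by field; rewrite gt_eqF.
  by rewrite cr mulN1r; congr (_ - _); field; rewrite gt_eqF.
set B := \int[mu]_(y in _) `|G y|.
have B0 : 0 <= B by apply: Rintegral_ge0.
have Dle t : - (delta / 2) <= t <= delta / 2 -> `|D t| <= 2 ^+ (2 * r) * ((delta / 2) ^+ s.-1 * B).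
  move=> /andP[t1 t2]; have rt : r%:R * (t / r%:R) = t by rewrite mulrC divfK.
  have [t0|t0|t0] := ltgtP 0 t.
  - have := @central_fdiff_le R r s (t / r%:R) g G x (delta / 2) s0 s2r PG gG.
    by rewrite rt t0 t2 => /(_ isT).
  - have -> : D t = fdiff (2 * r) (- t / r%:R) g (x - (- t)).
      rewrite /D -[t / r%:R]opprK -mulNr fdiff_oppr exprM sqrrN expr1n expr1n mul1r.
      congr (fdiff _ _ _ _); rewrite natrM; field; exact: rn0.
    have := @central_fdiff_le R r s (- t / r%:R) g G x (delta / 2) s0 s2r PG gG.
    have -> : r%:R * (- t / r%:R) = - t by rewrite mulrC divfK.
    by apply; lra.
  - rewrite /D -t0 mul0r (fdiff_step0 _ (leq_trans s0 s2r)) normr0.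
    by rewrite mulr_ge0 ?exprn_ge0// mulr_ge0// exprn_ge0// divr_ge0// ltW.
rewrite normrM normrM normfV (gtr0_norm d0).
apply: (@le_trans _ _ (delta^-1 * (2 ^+ (2 * r) * ((delta / 2) ^+ s.-1 * B) * delta))).
  apply: ler_pM => //; first by rewrite mulr_ge0// invr_ge0 ltW.
    by rewrite -[leRHS]mul1r ler_wpM2r// invr_ge0 ltW.
  apply: le_trans (le_normr_Rintegral mI iD) _.
  set K := 2 ^+ _ * (_ * B) in Dle *.
  have -> : K * delta = \int[mu]_(t in I) K by rewrite Rintegral_cst// muI.
  apply: le_Rintegral => //.
    exact: integrable_norm.
  by apply: continuous_integrable_cc => ?; exact: cvg_cst.
rewrite (mulrC delta^-1) mulfK ?gt_eqF// mulrA ler_wpM2r// ler_wpM2l ?exprn_ge0//.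
by apply: lerXn2r; rewrite ?nnegrE; lra.
Qed.

(** The average of f - g is bounded termwise, each dilation (r - k)/r costing at most
a factor r; g itself is left to [steklov_smooth_error]. *)
Lemma steklov_error r s delta f F g G x : (0 < s)%N -> (s <= 2 * r)%N -> 0 < delta ->
  measurable_fun [set: T] (f : T -> R) -> is_borel_version f F -> periodic_integrable F ->
  continuous g -> periodic g 1 -> periodic_integrable G ->
  (forall h y, 0 < h ->
    `|fdiff s h g y| <= h ^+ s.-1 * \int[mu]_(x in `[y, y + s%:R * h]) `|G x|) ->
  `|steklov delta r f x - g x| <= 2 ^+ (2 * r) * (2 * r%:R) *
    (delta^-1 * \int[mu]_(y in `[x - delta / 2, x + delta / 2]) (`|F y - g y| + delta ^+ s * `|G y|)).
Proof.
move=> s0 s2r d0 mf fF PF cg pg PG gG; have r0 : (0 < r)%N by lia.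
have r0' : 0 < r%:R :> R by rewrite ltr0n.
have r1 : 1 <= r%:R :> R by rewrite -[1]/(1%:R) ler_nat.
have Pg := continuous_periodic_integrable cg pg.
have [mF pF iF] := PF; have [mg _ ig] := Pg.
have PFg : periodic_integrable (F \- g).
  split; [exact: measurable_funB|by move=> t /=; rewrite pF pg|].
  move=> a b; rewrite (_ : EFin \o _ = (EFin \o F) \- (EFin \o g))%E//; exact: integrableB.
have PFgn := periodic_integrable_norm PFg; have [mFg pFg iFg] := PFgn.
have [mGn pGn iGn] := periodic_integrable_norm PG.
rewrite (steklovE x r0 d0 mf fF PF).
set d := delta / 2; have dd0 : 0 < d by rewrite /d divr_gt0.
set A := \int[mu]_(y in `[x - d, x + d]) `|F y - g y|.
set B := \int[mu]_(y in `[x - d, x + d]) `|G y|.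
have A0 : 0 <= A by apply: Rintegral_ge0.
have B0 : 0 <= B by apply: Rintegral_ge0.
have -> : \int[mu]_(y in `[x - d, x + d]) (`|F y - g y| + delta ^+ s * `|G y|) = A + delta ^+ s * B.
  have mI : measurable (`[x - d, x + d]%classic : set (measurableTypeR R)) by exact: measurable_itv.
  have i1 := iGn (x - d) (x + d).
  have i2 : mu.-integrable `[x - d, x + d]%classic (EFin \o (fun y => delta ^+ s * `|G y|)).
    rewrite (_ : EFin \o _ = fun t => ((delta ^+ s)%:E * (EFin \o (fun y => `|G y|)%R) t)%E)//.
    exact: integrableZl.
  by rewrite (RintegralD mI (iFg _ _) i2) RintegralZl.
pose J w k := \int[mu]_(t in `[- d, d]) w (x + (r - k)%N%:R / r%:R * t).
have -> : steklov_const r * (2 / delta) * (\sum_(0 <= k < r) fdiff_coef (2 * r) k * J F k) - g x =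
  steklov_const r * (2 / delta) * (\sum_(0 <= k < r) fdiff_coef (2 * r) k * J (F \- g) k) +
  (steklov_const r * (2 / delta) * (\sum_(0 <= k < r) fdiff_coef (2 * r) k * J g k) - g x).
  rewrite addrA -mulrDr -big_split/=; congr (_ * _ - _).
  apply: eq_big_nat => k /andP[_ kr]; rewrite -mulrDr; congr (_ * _).
  have rho0 : 0 < (r - k)%N%:R / r%:R :> R by rewrite divr_gt0 ?ltr0n ?subn_gt0.
  rewrite /J -RintegralD//; [|exact: dilated_integrable|exact: dilated_integrable].
  by apply: eq_Rintegral => t _ /=; rewrite subrK.
have cle := steklov_const_le1 r.
apply: (le_trans (ler_normD _ _)).
have h1 : `|steklov_const r * (2 / delta) * (\sum_(0 <= k < r) fdiff_coef (2 * r) k * J (F \- g) k)|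
    <= 2 / delta * (2 ^+ (2 * r) * (r%:R * A)).
  have d20 : 0 <= 2 / delta by rewrite divr_ge0// ltW.
  rewrite -mulrA normrM -[leRHS]mul1r; apply: ler_pM => //.
  rewrite normrM ger0_norm// ler_wpM2l//.
  apply: le_trans (ler_norm_sum _ _ _) _.
  apply: (@le_trans _ _ (\sum_(0 <= k < r) 'C(2 * r, k)%:R * (r%:R * A))).
    rewrite big_nat [leRHS]big_nat; apply: ler_sum => k /andP[_ kr].
    rewrite normrM /fdiff_coef normrM normrX normrN1 expr1n mulr1 ger0_norm// ler_wpM2l//.
    have rho0 : 0 < (r - k)%N%:R / r%:R :> R by rewrite divr_gt0 ?ltr0n ?subn_gt0.
    have rho1 : (r - k)%N%:R / r%:R <= 1 :> R by rewrite ler_pdivrMr// mul1r ler_nat leq_subr.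
    rewrite /J; apply: le_trans (le_normr_Rintegral _ _) _ => //; first exact: dilated_integrable.
    apply: (@le_trans _ _ (((r - k)%N%:R / r%:R)^-1 * A)).
      by apply: (@dilated_Rintegral_le (fun y => `|F y - g y|)) => //; [rewrite rho0|exact: ltW].
    rewrite ler_wpM2r// invf_div ler_pdivrMr ?ltr0n ?subn_gt0// -[leLHS]mulr1 ler_wpM2l//.
    by rewrite -[1]/(1%:R) ler_nat subn_gt0.
  rewrite -mulr_suml; apply: ler_wpM2r; first by rewrite mulr_ge0.
  apply: le_trans (bin_sum_le _); rewrite -[in leRHS](big_mkord xpredT (fun k => 'C(2 * r, k)%:R)).
  rewrite (@big_cat_nat _ _ _ r 0 (2 * r))//=; last lia.
  by rewrite lerDl sumr_ge0.
apply: le_trans (lerD h1 (steklov_smooth_error x s0 s2r d0 cg PG gG)) _.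
rewrite -/d -/B mulrDr mulrDr.
have e1 : 2 ^+ (2 * r) * (2 * r%:R) * (delta^-1 * A) = 2 / delta * (2 ^+ (2 * r) * (r%:R * A)) by ring.
rewrite e1 lerD2l.
have -> : 2 ^+ (2 * r) * (2 * r%:R) * (delta^-1 * (delta ^+ s * B)) = (2 * r%:R) * (2 ^+ (2 * r) * delta ^+ s.-1 * B).
  by rewrite -[in LHS](prednK s0) exprS; field; rewrite gt_eqF.
rewrite -[leLHS]mul1r ler_wpM2r//; last lra.
by rewrite mulr_ge0// mulr_ge0// exprn_ge0// ltW.
Qed.

End steklov_error.

(** * Discrete norms at separated nodes *)

Section nodes.
Context {R : realType}.
Local Notation mu := (@lebesgue_measure R).
Local Notation T := (lebesgueTypeR R).
Implicit Types (f g w F G H : R -> R) (p h y u v delta gamma : R).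

Lemma average_powR_le p delta H y : 1 <= p -> 0 < delta -> periodic_integrable H ->
  ((`|delta^-1 * \int[mu]_(t in `[y, y + delta]) H t| `^ p)%:E <=
   (delta^-1)%:E * \int[mu]_(t in `[y, (y + delta)%R[) (`|H t| `^ p)%:E)%E.
Proof.
move=> p1 d0 PH; have [mH _ _] := PH.
rewrite -averageE//.
have mHa : measurable_fun [set: R] (fun t => H (y + delta * t)).
  by apply: (measurableT_comp mH); exact: measurable_affine.
apply: le_trans (Rintegral_jensen p1 mHa) _.
have mHp : measurable_fun [set: R] (fun t => (`|H t| `^ p)%:E) by exact: measurable_abs_powR.
have /measurable_EFinP mHr := mHp.
rewrite integral_itv_bndo_bndc; last exact: measurable_funS mHp.
rewrite (@ge0_integral_affine R y delta `[y, y + delta]%classic (fun t => (`|H t| `^ p)%:E))//; last exact: measurable_funS mHp.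
have -> : `[y, y + delta]%classic = `[y + delta * 0, y + delta * 1]%classic by rewrite mulr0 addr0 mulr1.
by rewrite preimage_affine_itv// muleA -EFinM mulVf ?gt_eqF// mul1e.
Qed.

(** Consecutive nodes are at distance at least 2d, so that [x_k - d, x_k + d[ lies in
[x_k - d, x_(k+1) - d[; for k = 1, ..., n these intervals fill exactly one
period. *)
Lemma nodes_disjoint_sum gamma (x : nat -> nat -> R) n (G : R -> \bar R) (d : R) :
  d = gamma / n%:R / 2 -> 0 < gamma -> separated_nodes gamma x -> (1 <= n)%N ->
  measurable_fun [set: R] G -> (forall t, (0 <= G t)%E) -> (forall t, G (t + 1)%R = G t) ->
  (\sum_(1 <= k < n.+1) \int[mu]_(t in `[(x n k - d)%R, (x n k + d)%R[) G t <=
   \int[mu]_(t in `[0%R, 1%R[) G t)%E.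
Proof.
move=> dE' g0 hx n1 mG G0 pG; have [x0 _ xn1 xlast gap] := hx n n1.
have n0 : 0 < n%:R :> R by rewrite ltr0n.
have d0 : 0 < d by rewrite dE' !divr_gt0.
have dE : d + d = gamma / n%:R by rewrite dE' -splitr.
have mono m : (m <= n)%N -> x n 1%N <= x n m.+1.
  elim: m => // m ih mn; apply: (le_trans (ih (ltnW mn))).
  have := gap m.+1; rewrite mn => /(_ isT); lra.
have step m : (m <= n)%N ->
    (\sum_(1 <= k < m.+1) \int[mu]_(t in `[(x n k - d)%R, (x n k + d)%R[) G t <=
     \int[mu]_(t in `[(x n 1%N - d)%R, (x n m.+1 - d)%R[) G t)%E.
  elim: m => [|m ih] mn.
    by rewrite big_nil integral_ge0.
  rewrite big_nat_recr//=.
  have gm := gap m.+1; have {}gm : gamma / n%:R <= x n m.+2 - x n m.+1 by apply: gm; rewrite mn.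
  rewrite (@ge0_integral_co_split _ G (x n 1%N - d) (x n m.+1 - d) (x n m.+2 - d))//; last 2 first.
  - by rewrite lerD2r mono// ltnW.
  - lra.
  rewrite leeD ?ih ?(ltnW mn)//.
  apply: ge0_subset_integral => //; first exact: measurable_funS mG.
  by move=> t /=; rewrite !in_itv/= => /andP[-> h]/=; lra.
apply: le_trans (step n (leqnn n)) _; rewrite xlast.
rewrite (_ : 1 + x n 1%N - d = x n 1%N - d + 1)%R; last ring.
by rewrite ge0_integral_periodic.
Qed.

(** Jensen's inequality at each node and [nodes_disjoint_sum]: the factor
1 / (n delta) left over is 1 / gamma. *)
Lemma lpnorm_local p gamma delta (x : nat -> nat -> R) n (C : R) w H : 1 <= p -> 0 < gamma ->
  separated_nodes gamma x -> (1 <= n)%N -> 0 < C -> periodic_integrable H ->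
  delta = gamma / n%:R ->
  (forall k, (1 <= k <= n)%N -> `|w (x n k)| <= C * (delta^-1 *
     \int[mu]_(t in `[x n k - delta / 2, x n k + delta / 2]) H t)) ->
  ((lpnorm p x n w)%:E <= (C * gamma `^ (- p^-1))%:E * Lpnorm p H)%E.
Proof.
move=> p1 g0 hx n1 C0 PH dE wH; have p0 : 0 < p by exact: lt_le_trans p1.
have n0 : 0 < n%:R :> R by rewrite ltr0n.
have dl0 : 0 < delta by rewrite dE divr_gt0.
have [mH pH _] := PH.
set L := (\int[mu]_(t in `[0%R, 1%R[) (`|H t| `^ p)%:E)%E.
have L0 : (0 <= L)%E by apply: integral_ge0 => t _; rewrite lee_fin powR_ge0.
rewrite Lpnorm_borelE// -/L /lpnorm.
have gp : C * gamma `^ (- p^-1) = (C `^ p * gamma^-1) `^ p^-1.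
  rewrite powRM ?powR_ge0 ?invr_ge0 ?(ltW g0)// -powRrM mulfV ?gt_eqF// powRr1 ?(ltW C0)//.
  by rewrite -(powR_inv1 (ltW g0)) -powRrM mulN1r.
rewrite gp -!poweR_EFin -poweRM//; last by rewrite lee_fin mulr_ge0 ?powR_ge0 ?invr_ge0 ?(ltW g0).
apply: gt0_ler_poweR; first by rewrite invr_ge0 ltW.
- by rewrite in_itv/= leey andbT lee_fin mulr_ge0 ?invr_ge0// sumr_ge0// => k _; exact: powR_ge0.
- by rewrite in_itv/= leey andbT mule_ge0// lee_fin mulr_ge0 ?powR_ge0 ?invr_ge0 ?(ltW g0).
pose G t := (`|H t| `^ p)%:E.
have mG : measurable_fun [set: R] G by exact: measurable_abs_powR.
have G0 t : (0 <= G t)%E by rewrite lee_fin powR_ge0.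
have pG t : G (t + 1) = G t by rewrite /G pH.
have key k : (1 <= k <= n)%N -> ((`|w (x n k)| `^ p)%:E <= (C `^ p * delta^-1)%:E *
    \int[mu]_(t in `[(x n k - delta / 2)%R, (x n k + delta / 2)%R[) G t)%E.
  move=> kn; have hk := wH k kn.
  have := average_powR_le (x n k - delta / 2) p1 dl0 PH.
  rewrite (_ : x n k - delta / 2 + delta = x n k + delta / 2); last by field.
  pose I := delta^-1 * \int[mu]_(t in `[x n k - delta / 2, x n k + delta / 2]) H t.
  rewrite -/I in hk *; move=> hI.
  apply: (@le_trans _ _ ((C `^ p)%:E * (`|I| `^ p)%:E)%E).
    rewrite -EFinM lee_fin -powRM ?(ltW C0)//.
    apply: ge0_ler_powR; rewrite ?nnegrE ?(ltW p0)//; first by rewrite mulr_ge0// ltW.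
    by apply: (le_trans hk); rewrite ler_wpM2l ?(ltW C0)// ler_norm.
  by rewrite EFinM -muleA; apply: lee_wpmul2l => //; rewrite lee_fin powR_ge0.
rewrite EFinM -sumEFin.
apply: (@le_trans _ _ ((n%:R^-1)%:E * ((C `^ p * delta^-1)%:E * L))%E); last first.
  rewrite muleA -EFinM; apply: lee_wpmul2r => //; rewrite lee_fin le_eqVlt; apply/orP; left; apply/eqP.
  by rewrite dE; field; rewrite !gt_eqF.
apply: lee_wpmul2l; first by rewrite lee_fin invr_ge0.
have c0 : (0 <= (C `^ p * delta^-1)%:E)%E by rewrite lee_fin mulr_ge0 ?powR_ge0 ?invr_ge0 ?(ltW dl0).
apply: le_trans (lee_wpmul2l c0 (nodes_disjoint_sum (congr1 (fun z => z / 2) dE) g0 hx n1 mG G0 pG)).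
rewrite ge0_sume_distrr; last by move=> k _; apply: integral_ge0.
rewrite big_nat [leRHS]big_nat; apply: lee_sum => k kn; apply: key.
by rewrite -ltnS.
Qed.

Lemma lpnorm_ge0 p x n w : 0 <= lpnorm p x n w.
Proof. exact: powR_ge0. Qed.

Lemma lpnorm_eq_abs p x n f w : (forall y, `|f y| = `|w y|) -> lpnorm p x n f = lpnorm p x n w.
Proof. by move=> vw; rewrite /lpnorm; congr (powR _ _); congr (_ * _); apply: eq_bigr => k _; rewrite vw. Qed.

(** Valid for every exponent q > 0, so that it serves both for p and for 1/p. *)
Lemma powR_add_le (q a b : R) : 0 < q -> 0 <= a -> 0 <= b ->
  (a + b) `^ q <= 2 `^ q * (a `^ q + b `^ q).
Proof.
move=> q0; wlog ab : a b / a <= b.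
  move=> H a0 b0; have [ab|/ltW ba] := leP a b; first exact: H.
  by rewrite addrC (addrC (a `^ q)); exact: H.
move=> a0 b0; apply: (@le_trans _ _ ((2 * b) `^ q)).
  by apply: ge0_ler_powR; rewrite ?nnegrE ?addr_ge0 ?mulr_ge0 ?(ltW q0)//; lra.
by rewrite powRM// ler_wpM2l ?powR_ge0// lerDr powR_ge0.
Qed.

(** A triangle inequality with a constant is enough for orders of magnitude. *)
Lemma lpnormD_quasi p x n f w : 1 <= p ->
  lpnorm p x n (f \+ w) <= 4 * (lpnorm p x n f + lpnorm p x n w).
Proof.
move=> p1; have p0 : 0 < p by exact: lt_le_trans p1.
rewrite /lpnorm.
set V := \sum_(1 <= k < n.+1) `|f (x n k)| `^ p.
set W := \sum_(1 <= k < n.+1) `|w (x n k)| `^ p.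
have V0 : 0 <= V by rewrite sumr_ge0// => k _; exact: powR_ge0.
have W0 : 0 <= W by rewrite sumr_ge0// => k _; exact: powR_ge0.
have n0 : 0 <= n%:R^-1 :> R by rewrite invr_ge0.
apply: (@le_trans _ _ ((2 `^ p * (n%:R^-1 * V + n%:R^-1 * W)) `^ p^-1)).
  apply: ge0_ler_powR; rewrite ?nnegrE ?invr_ge0 ?(ltW p0)//.
  - by rewrite mulr_ge0// sumr_ge0// => k _; exact: powR_ge0.
  - by rewrite mulr_ge0 ?powR_ge0// addr_ge0// mulr_ge0.
  rewrite -mulrDr mulrCA ler_wpM2l// -big_split/= mulr_sumr; apply: ler_sum => k _.
  apply: le_trans (powR_add_le p0 (normr_ge0 _) (normr_ge0 _)).
  by apply: ge0_ler_powR; rewrite ?nnegrE ?addr_ge0 ?(ltW p0)// ler_normD.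
have nV : 0 <= n%:R^-1 * V by rewrite mulr_ge0.
have nW : 0 <= n%:R^-1 * W by rewrite mulr_ge0.
rewrite powRM ?powR_ge0 ?addr_ge0// -powRrM mulfV ?gt_eqF// powRr1//.
have ip0 : 0 < p^-1 by rewrite invr_gt0.
have := powR_add_le ip0 nV nW => h.
rewrite (_ : 4 = 2 * 2 :> R); last by ring.
rewrite -mulrA ler_wpM2l//; apply: (le_trans h).
rewrite ler_wpM2r ?addr_ge0 ?powR_ge0//.
rewrite -[leRHS](powRr1 (_ : 0 <= 2))//; apply: ler_powR; first by rewrite ler1n.
by rewrite invf_le1.
Qed.

Lemma omega_version s p f F delta : 1 <= p -> measurable_fun [set: T] (f : T -> R) ->
  periodic f 1 -> is_borel_version f F -> omega s p f delta = omega s p F delta.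
Proof.
move=> p1 mf pf [mF pF fF]; rewrite /omega.
suff -> : (fun h => Lpnorm p (fdiff s h f)) = (fun h => Lpnorm p (fdiff s h F)) by [].
apply/funext => h.
have mTF := borel_lebesgue_measurable_funT mF.
have [m1 _] := fdiff_Lp s h p1 mf pf.
have [m2 _] := fdiff_Lp s h p1 mTF pF.
apply: Lpnorm_ae_eq => //; apply: ae_bigsum => k.
by apply: ae_impl (ae_translation ((s - k)%N%:R * h) fF) => y ->.
Qed.

Lemma omega_ge0 s p f delta : 0 < delta -> (0 <= omega s p f delta)%E.
Proof.
move=> d0; apply: le_trans (Lpnorm_ge0 p (fdiff s (delta / 2) f)) _.
apply: ereal_sup_ubound; exists (delta / 2) => //=; rewrite in_itv/=; lra.
Qed.

Lemma LpTB p f g : 1 <= p -> LpT p f -> LpT p g -> LpT p (f \- g).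
Proof.
move=> p1 [mf pf fo] [mg pg go]; split; first exact: measurable_funB.
  by move=> y /=; rewrite pf pg.
by apply: le_lt_trans (LpnormB p1 mf mg) _; rewrite lte_add_pinfty.
Qed.

(** One function g close to f both in norm and, through the Steklov average of f, at
the nodes. The step u is chosen so that (s + 1) u < 1/n. *)
Lemma smooth_approximation p r s gamma x : 1 <= p -> (0 < s)%N -> (s <= 2 * r)%N ->
  0 < gamma <= 1 -> separated_nodes gamma x ->
  exists2 C : R, 0 < C & forall f n, LpT p f -> (1 <= n)%N -> exists g,
    [/\ Wps s p g, LpT p g,
      (Lpnorm p (f \- g)%R <= omega s p f (n%:R^-1))%E,
      (Lpnorm p (derive1n s g) <= (C * n%:R ^+ s)%:E * omega s p f (n%:R^-1))%E &
      ((lpnorm p x n (steklov (gamma / n%:R) r f \- g)%R)%:E <=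
         C%:E * omega s p f (n%:R^-1))%E].
Proof.
move=> p1 s0 s2r /andP[g0 g1] hx.
pose C1 : R := 2 ^+ s * s.+2%:R ^+ s.
pose C2 : R := 2 ^+ (2 * r) * (2 * r%:R) * gamma `^ (- p^-1).
have r0 : (0 < r)%N by lia.
have C10 : 0 < C1 by rewrite /C1 mulr_gt0// exprn_gt0.
have C00 : 0 < 2 ^+ (2 * r) * (2 * r%:R) :> R by rewrite mulr_gt0 ?exprn_gt0// mulr_gt0// ltr0n.
have C20 : 0 < C2 by rewrite /C2 mulr_gt0// powR_gt0.
exists (C1 + C2 * (1 + C1)); first by rewrite addr_gt0// mulr_gt0// addr_gt0.
move=> f n Lf n1; have n0 : 0 < n%:R :> R by rewrite ltr0n.
have [mf pf foo] := Lf.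
have [F vF [PF e]] := LpT_version p1 Lf.
have [mF pF fF] := vF.
have Foo : (Lpnorm p F < +oo)%E by rewrite -e.
have mTF := borel_lebesgue_measurable_funT mF.
rewrite (omega_version s n%:R^-1 p1 mf pf vF).
set W := omega s p F n%:R^-1.
have W0 : (0 <= W)%E by apply: omega_ge0; rewrite invr_gt0.
pose u : R := (n%:R * s.+2%:R)^-1.
have u0 : 0 < u by rewrite invr_gt0 mulr_gt0.
have uh : s.+1%:R * u < n%:R^-1.
  rewrite /u invfM mulrCA -[ltRHS]mulr1 ltr_pM2l ?invr_gt0// ltr_pdivrMr// mul1r.
  by rewrite ltr_nat.
pose g := smooth_approx s u F.
have Wg : Wps s p g by exact: (@Wps_smooth_approx R p s u n%:R^-1).
have Lg : LpT p g by exact: (@LpT_smooth_approx R p s u n%:R^-1).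
have eg : (Lpnorm p (F \- g)%R <= W)%E by exact: Lpnorm_smooth_approx_error.
have dg : (Lpnorm p (derive1n s g) <= (C1 * n%:R ^+ s)%:E * W)%E.
  have := @Lpnorm_derive1n_smooth_approx R p s u n%:R^-1 F p1 u0 uh mF pF Foo.
  by rewrite /u exprVn invrK exprMn mulrA (mulrAC _ (n%:R ^+ s)).
have cg : continuous g by exact: (@continuous_smooth_approx R p s u F).
clearbody g.
have [mg pg _] := Lg.
have Efg : Lpnorm p (f \- g) = Lpnorm p (F \- g).
  apply: (Lpnorm_ae_eq p1 (measurable_funB mf mg) (measurable_funB mTF mg)).
  by apply: ae_impl fF => y /= ->.
exists g; split => //.
- by rewrite Efg.
- apply: (le_trans dg); apply: lee_wpmul2r => //; rewrite lee_fin ler_wpM2r ?exprn_ge0//.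
  by rewrite lerDl mulr_ge0 ?(ltW C20)// addr_ge0// ltW.
have [G PG [eG HG]] := Wps_fdiff_le_integral p1 s0 Wg.
pose delta := gamma / n%:R; have d0 : 0 < delta by rewrite divr_gt0.
(* The local error of the Steklov average is a mean of [H] around the node. *)
pose H y := `|F y - g y| + delta ^+ s * `|G y|.
have Pg := continuous_periodic_integrable cg pg.
have [mF' pF' iF] := PF; have [mg' _ ig] := Pg; have [mG pG iG] := PG.
have mTG := borel_lebesgue_measurable_funT mG.
have mH : measurable_fun [set: R] H.
  apply: measurable_funD; first by apply: measurableT_comp => //; exact: measurable_funB.
  by apply: measurable_funM => //; exact: measurableT_comp.
have pH : periodic H 1 by move=> y; rewrite /H pF pg pG.
have Hle : (Lpnorm p H <= (1 + C1)%:E * W)%E.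
  have mA : measurable_fun [set: T] ((fun y => `|F y - g y|) : T -> R).
    apply: borel_lebesgue_measurable_funT; apply: measurableT_comp => //.
    exact: measurable_funB.
  have mB0 : measurable_fun [set: T] ((fun y => `|G y|) : T -> R) by exact: measurableT_comp.
  have mB : measurable_fun [set: T] ((fun y => delta ^+ s * `|G y|) : T -> R) by exact: measurable_funM.
  apply: le_trans (LpnormD p1 mA mB) _.
  rewrite EFinD ge0_muleDl ?lee_fin ?(ltW C10)// mul1e; apply: leeD.
    apply: le_trans eg; apply: (Lpnorm_le p1 mA (measurable_funB mTF mg)) => y.
    by rewrite normr_id.
  rewrite LpnormZ// ger0_norm ?exprn_ge0 ?(ltW d0)//.
  apply: (@le_trans _ _ ((delta ^+ s)%:E * ((C1 * n%:R ^+ s)%:E * W))%E).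
    apply: lee_wpmul2l; first by rewrite lee_fin exprn_ge0// ltW.
    apply: le_trans dg; rewrite eG; apply: (Lpnorm_le p1 mB0 mTG) => y.
    by rewrite normr_id.
  rewrite muleA -EFinM; apply: lee_wpmul2r => //; rewrite lee_fin mulrCA -exprMn /delta divfK ?gt_eqF//.
  by rewrite -[leRHS]mulr1 ler_wpM2l ?(ltW C10)// exprn_ile1// ltW.
have PH : periodic_integrable H.
  apply: (Lp_periodic_integrable p1) => //; apply: le_lt_trans Hle _.
  apply: lte_mul_pinfty => //; first by rewrite lee_fin addr_ge0// ltW.
  exact: omega_lty.
apply: (@le_trans _ _ (C2%:E * Lpnorm p H)%E).
  apply: (lpnorm_local p1 g0 hx n1 C00 PH (erefl delta)) => k kn.
  exact: (steklov_error (x n k) s0 s2r d0 mf vF PF cg pg PG HG).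
apply: (@le_trans _ _ (C2%:E * ((1 + C1)%:E * W))%E).
  by apply: lee_wpmul2l => //; rewrite lee_fin ltW.
by rewrite muleA -EFinM; apply: lee_wpmul2r => //; rewrite lee_fin lerDr ltW.
Qed.

End nodes.

(** * Sampling operators *)

Section sampling.
Context {R : realType}.
Local Notation T := (lebesgueTypeR R).
Implicit Types (f g : R -> R) (p : R).

Lemma sampling_opB x phi n f g :
  sampling_op x phi n (f \- g) = sampling_op x phi n f \- sampling_op x phi n g :> (R -> R).
Proof.
by apply/funext => y; rewrite /sampling_op /= -sumrB; apply: eq_bigr => k _; rewrite mulrBl.
Qed.

Lemma LpT_lincomb p (I : eqType) (r : seq I) (c : I -> R) (w : I -> R -> R) : 1 <= p ->
  (forall i, i \in r -> LpT p (w i)) -> LpT p (fun y => \sum_(i <- r) c i * w i y).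
Proof.
move=> p1; elim: r => [|i r ih] Lw.
  rewrite (_ : (fun y => _) = fun=> 0); last by apply/funext => y; rewrite big_nil.
  split; [exact: measurable_cst|by []|by rewrite Lpnorm0// ltry].
rewrite (_ : (fun y => _) = (fun y => c i * w i y) \+ (fun y => \sum_(i <- r) c i * w i y)); last first.
  by apply/funext => y; rewrite big_cons.
have [mi pi fi] := Lw i (mem_head _ _).
have [|m pe fo] := ih; first by move=> j jr; apply: Lw; rewrite in_cons jr orbT.
have mc : measurable_fun [set: T] ((fun y => c i * w i y) : T -> R) by exact: measurable_funM.
split; first exact: measurable_funD.
  by move=> y /=; rewrite pe pi.
apply: le_lt_trans (LpnormD p1 mc m) _; rewrite lte_add_pinfty// LpnormZ//.
by rewrite lte_mul_pinfty// lee_fin.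
Qed.

Lemma LpT_sampling_op p x (phi : nat -> nat -> R -> R) n f : 1 <= p ->
  (forall k, (1 <= k <= n)%N -> LpT p (phi n k)) -> LpT p (sampling_op x phi n f).
Proof.
move=> p1 Lphi; apply: (LpT_lincomb (fun k => f (x n k)) p1) => k.
by rewrite mem_index_iota ltnS; exact: Lphi.
Qed.

Lemma LpT_cst p (c : R) : 1 <= p -> LpT p (fun=> c).
Proof.
move=> p1; split; [exact: measurable_cst|by []|].
rewrite Lpnorm_borelE//; apply: poweR_lty.
rewrite integral_cst; last exact: measurable_itv.
rewrite lte_mul_pinfty ?lee_fin ?powR_ge0//.
by rewrite [ltLHS]lebesgue_measure_itv/= lte_fin ltr01 ltry.
Qed.

Lemma derive1n_cst s (c : R) : (0 < s)%N -> derive1n s (fun=> c) = fun=> 0 :> R.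
Proof.
have d0 (a : R) : derive1 (fun=> a) = (fun=> 0) :> (R -> R).
  by apply/funext => y; rewrite derive1E; exact: derive_cst.
case: s => // s _; elim: s => [|s ih]; first exact: d0.
by rewrite -[LHS]/(derive1 (derive1n s.+1 (fun=> c))) ih d0.
Qed.

Lemma Wps_cst s p (c : R) : 1 <= p -> (0 < s)%N -> Wps s p (fun=> c).
Proof.
move=> p1 s0.
have dc j : derive1n j (fun=> c) = fun=> (if j == 0%N then c else 0).
  by case: j => [//|j]; rewrite derive1n_cst.
split => //.
- by move=> j _ y; rewrite dc; exact: derivable_cst.
- move=> e e0; exists 1 => // m u v _ _ _.
  by rewrite dc big1// => i _; rewrite subrr normr0.
- by rewrite dc; exact: LpT_cst.
Qed.

(** The finitely many exceptional indices are absorbed into the constant, which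
requires the quantity to be finite there. *)
Lemma bigO_powN_all (alpha : R) (E : nat -> \bar R) : (forall n, (1 <= n)%N -> (0 <= E n < +oo)%E) ->
  bigO_powN alpha E ->
  exists2 C : R, 0 < C & forall n, (1 <= n)%N -> (E n <= (C * n%:R `^ (- alpha))%:E)%E.
Proof.
move=> Efin [C [N _ HN]].
pose S : R := \sum_(1 <= k < N) fine (E k) * (k%:R `^ alpha).
have S0 k : (1 <= k)%N -> 0 <= fine (E k) * (k%:R `^ alpha).
  by move=> k1; rewrite mulr_ge0 ?powR_ge0// fine_ge0//; case/andP: (Efin k k1).
have SS0 : 0 <= S by rewrite /S big_nat sumr_ge0// => k /andP[k1 _]; exact: S0.
exists (`|C| + S + 1).
  by rewrite ltr_wpDl// addr_ge0.
move=> n n1; have n0 : 0 < n%:R :> R by rewrite ltr0n.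
have [Nn|nN] := leqP N n.
  apply: (le_trans (HN n Nn)); rewrite lee_fin ler_wpM2r ?powR_ge0//.
  by rewrite -addrA (le_trans (ler_norm _))// lerDl addr_ge0.
have /andP[E0 Eoo] := Efin n n1.
rewrite -(fineK (_ : E n \is a fin_num)) ?ge0_fin_numE// lee_fin.
have -> : fine (E n) = (fine (E n) * n%:R `^ alpha) * n%:R `^ (- alpha).
  by rewrite powRN mulfK// gt_eqF// powR_gt0.
rewrite ler_wpM2r ?powR_ge0//.
apply: (@le_trans _ _ S); last by rewrite -addrA addrCA lerDl addr_ge0.
rewrite /S (@big_cat_nat _ _ _ n)//=; last exact: ltnW.
rewrite [X in _ <= _ + X](big_ltn nN) addrCA lerDl addr_ge0//.
  by rewrite big_nat sumr_ge0// => k /andP[k1 _]; exact: S0.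
by rewrite big_nat sumr_ge0// => k /andP[k1 _]; apply: S0; exact: leq_trans (ltnW k1).
Qed.

Lemma geometric_sum_le (q : R) m : 1 < q -> \sum_(1 <= k < m.+1) q ^+ k <= q / (q - 1) * q ^+ m.
Proof.
move=> q1; have qm : 0 < q - 1 by rewrite subr_gt0.
elim: m => [|m ih].
  by rewrite big_nil mulr_ge0// ?expr0// divr_ge0 ?(ltW qm)//; lra.
rewrite big_nat_recr//=; apply: (le_trans (lerD ih (lexx _))).
rewrite -subr_ge0 (_ : _ - _ = 0)// exprS; field; rewrite gt_eqF//.
Qed.

End sampling.

(** * The inverse theorem for sampling operators *)

Section inverse_estimate.
Context {R : realType}.
Local Notation T := (lebesgueTypeR R).
Variables (p : R) (s : nat) (alpha : R) (x : nat -> nat -> R) (phi : nat -> nat -> R -> R)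
  (K3 K4 : R).
Hypotheses (hp : 1 <= p) (hs : (1 <= s)%N) (ha : 0 < alpha < s%:R)
  (hphi : forall n k, (1 <= k <= n)%N -> LpT p (phi n k))
  (hK3 : 0 < K3) (hK4 : 0 < K4)
  (hJackson : forall (g : R -> R) (n : nat), Wps s p g -> (1 <= n)%N ->
     (Lpnorm p (g \- sampling_op x phi n g)%R
       <= (K3 * n%:R ^- s)%:E * Lpnorm p (derive1n s g))%E)
  (hBernstein : forall (g : R -> R) (nu : nat), LpT p g -> (1 <= nu)%N ->
     let D := (sampling_op x phi (2 ^ nu)%N g
                 \- sampling_op x phi (2 ^ nu.-1)%N g)%R in
     Wps s p D /\
     (Lpnorm p (derive1n s D) <= (K4 * 2 ^+ (s * nu))%:E * Lpnorm p D)%E).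
Variables (f : R -> R) (C1 : R).
Hypotheses (hf : LpT p f) (C10 : 0 < C1)
  (hE : forall n, (1 <= n)%N ->
    (Lpnorm p (f \- sampling_op x phi n f)%R <= (C1 * n%:R `^ (- alpha))%:E)%E).
Local Notation G n := (sampling_op x phi n f).
Let LG n : LpT p (G n).
Proof. by apply: LpT_sampling_op => // k; exact: hphi. Qed.
Let mG n : measurable_fun [set: T] (G n : T -> R). Proof. by have [] := LG n. Qed.
Let pG n : periodic (G n) 1. Proof. by have [] := LG n. Qed.

(** Jackson's inequality for the constant 1 makes D = 1 - G_1(1) vanish almost
everywhere, and G_1 f = f(x_(1,1)) (1 - D). *)
Lemma fdiff_sampling1 h : Lpnorm p (fdiff s h (G 1)) = 0%E.
Proof.
apply/eqP; rewrite eq_le Lpnorm_ge0 andbT.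
have one : (Lpnorm p ((fun=> 1%R) \- sampling_op x phi 1 (fun=> 1%R))%R <= 0)%E.
  have := hJackson (Wps_cst 1 hp hs) (leqnn 1).
  by rewrite derive1n_cst// Lpnorm0// mule0.
pose D := (fun=> 1) \- sampling_op x phi 1 (fun=> 1).
have LD : LpT p D.
  apply: LpTB => //; first exact: LpT_cst.
  by apply: LpT_sampling_op => // k; exact: hphi.
have [mD pD _] := LD.
have -> : fdiff s h (G 1) = fun y => - f (x 1%N 1%N) * fdiff s h D y.
  apply/funext => y; rewrite -fdiffZ.
  have -> : G 1 = (fun=> f (x 1%N 1%N)) \+ (fun y => - f (x 1%N 1%N) * D y).
    apply/funext => z; rewrite /D /sampling_op /= !big_nat1; ring.
  by rewrite fdiffDr fdiff_cst//= add0r.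
have [m l] := fdiff_Lp s h hp mD pD.
rewrite LpnormZ//.
have D0 : Lpnorm p D = 0%E by apply/eqP; rewrite eq_le one Lpnorm_ge0.
move: l; rewrite D0 mule0 => l.
have -> : Lpnorm p (fdiff s h D) = 0%E by apply/eqP; rewrite eq_le l Lpnorm_ge0.
by rewrite mule0.
Qed.

Let a : R := 2 `^ (- alpha).
Let a0 : 0 < a. Proof. exact: powR_gt0. Qed.
Let aE nu : ((2 ^ nu)%N%:R : R) `^ (- alpha) = a ^+ nu.
Proof. by rewrite natrX -powR_mulrn// /a -!powRrM (mulrC nu%:R) powRrM powR_mulrn ?powR_ge0. Qed.
(* The ratio 2^(s - alpha) of the geometric sum below. *)
Let q : R := 2 ^+ s * a.
Let q1 : 1 < q.
Proof.
rewrite /q /a powRN ltr_pdivlMr ?powR_gt0// mul1r -powR_mulrn//.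
rewrite /powR gt_eqF// ltr_expR ltr_pM2r; first by case/andP: ha.
by rewrite ln_gt0// ltr1n.
Qed.

Let C2 : R := C1 * (1 + a^-1).
(** Both G_(2^nu) f and G_(2^(nu-1)) f are close to f. *)
Let D_le nu : (1 <= nu)%N ->
  (Lpnorm p (G (2 ^ nu) \- G (2 ^ nu.-1))%R <= (C2 * a ^+ nu)%:E)%E.
Proof.
move=> nu1.
have [m1 _ _] : LpT p (f \- G (2 ^ nu)%N) by exact: LpTB.
have [m2 _ _] : LpT p (f \- G (2 ^ nu.-1)%N) by exact: LpTB.
have -> : G (2 ^ nu)%N \- G (2 ^ nu.-1)%N = (f \- G (2 ^ nu.-1)%N) \- (f \- G (2 ^ nu)%N).
  by apply/funext => y /=; ring.
apply: le_trans (LpnormB hp m2 m1) _.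
apply: (@le_trans _ _ ((C1 * a ^+ nu.-1)%:E + (C1 * a ^+ nu)%:E)%E).
  by apply: leeD; rewrite -aE; apply: hE; rewrite expn_gt0.
rewrite -EFinD lee_fin le_eqVlt; apply/orP; left; apply/eqP.
by rewrite /C2 -[in RHS](prednK nu1) -[in X in _ + X](prednK nu1) exprS; field; rewrite gt_eqF.
Qed.

(** Telescoping: G_(2^m) f is G_1 f plus the dyadic blocks, to which the Bernstein
inequality applies. *)
Lemma fdiff_sampling_le h m : 0 < h ->
  (Lpnorm p (fdiff s h (G (2 ^ m))) <=
    (s%:R * h ^+ s * K4 * C2 * \sum_(1 <= k < m.+1) q ^+ k)%:E)%E.
Proof.
move=> h0; elim: m => [|m ih].
  by rewrite expn0 fdiff_sampling1 big_nil mulr0.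
have [WD] := hBernstein hf (ltn0Sn m); rewrite [m.+1.-1]/=.
set D := _ \- _ => dD.
have [mD pD _] : LpT p D by exact: LpTB.
have -> : G (2 ^ m.+1)%N = G (2 ^ m)%N \+ D by apply/funext => y; rewrite /D/=; ring.
rewrite fdiffDr.
have [m1 _] := fdiff_Lp s h hp (mG (2 ^ m)) (@pG (2 ^ m)).
have [m2 _] := fdiff_Lp s h hp mD pD.
apply: le_trans (LpnormD hp m1 m2) _.
rewrite big_nat_recr//= mulrDr EFinD; apply: leeD => //.
apply: le_trans (Wps_fdiff_Lp hp hs h0 WD mD) _.
have sh : 0 <= s%:R * h ^+ s by rewrite mulr_ge0// exprn_ge0// ltW.
have Kp : 0 <= K4 * 2 ^+ (s * m.+1) by rewrite mulr_ge0 ?(ltW hK4)// exprn_ge0.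
apply: (@le_trans _ _ ((s%:R * h ^+ s)%:E * ((K4 * 2 ^+ (s * m.+1))%:E * (C2 * a ^+ m.+1)%:E))%E).
  apply: lee_wpmul2l; first by rewrite lee_fin.
  apply: (le_trans dD); apply: lee_wpmul2l; first by rewrite lee_fin.
  by have := D_le (ltn0Sn m).
rewrite -!EFinM lee_fin /q exprMn -exprM le_eqVlt; apply/orP; left; apply/eqP.
by ring.
Qed.

(** For h < 1/n and 2^m <= n < 2^(m+1), f - G_(2^m) f contributes O(2^(-alpha m));
the geometric sum of [fdiff_sampling_le] is of the size of its last term
h^s 2^((s - alpha) m), which is also at most 2^(-alpha m). *)
Lemma omega_sampling_le : exists2 C : R, 0 < C & forall n, (1 <= n)%N ->
  (omega s p f (n%:R^-1) <= (C * n%:R `^ (- alpha))%:E)%E.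
Proof.
have a1 : 0 < a^-1 by rewrite invr_gt0.
have C20 : 0 < C2 by rewrite mulr_gt0// addr_gt0.
have Q0 : 0 < q / (q - 1).
  by rewrite divr_gt0 ?subr_gt0// (lt_trans ltr01).
pose C := (2 ^+ s * C1 + s%:R * K4 * C2 * (q / (q - 1))) * a^-1.
have s0 : 0 < s%:R :> R by rewrite ltr0n.
have CC0 : 0 < 2 ^+ s * C1 + s%:R * K4 * C2 * (q / (q - 1)).
  by apply: addr_gt0; do ?apply: mulr_gt0 => //; exact: exprn_gt0.
exists C; first exact: mulr_gt0.
move=> n n1; have n0 : 0 < n%:R :> R by rewrite ltr0n.
pose m := trunc_log 2 n.
have /andP[m1 m2] := trunc_log_bounds (isT : (1 < 2)%N) n1.
have am : a ^+ m <= a^-1 * n%:R `^ (- alpha).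
  rewrite -ler_pdivrMl ?invr_gt0// invrK -exprS -aE.
  rewrite !powRN lef_pV2 ?posrE ?powR_gt0 ?ltr0n ?expn_gt0//.
  have al0 : 0 <= alpha by case/andP: ha => /ltW.
  by apply: ge0_ler_powR; rewrite ?nnegrE// ler_nat ltnW.
apply: ge_ereal_sup => _ [h + <-]; rewrite /= in_itv/= => /andP[h0 hn].
have [mf pf _] := hf.
have [mfG pfG _] : LpT p (f \- G (2 ^ m)%N) by exact: LpTB.
have -> : fdiff s h f = fdiff s h (f \- G (2 ^ m)%N) \+ fdiff s h (G (2 ^ m)%N).
  by rewrite -fdiffDr; congr (fdiff s h _); apply/funext => y /=; ring.
have [mm1 l1] := fdiff_Lp s h hp mfG pfG.
have [mm2 _] := fdiff_Lp s h hp (mG (2 ^ m)) (@pG (2 ^ m)).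
apply: le_trans (LpnormD hp mm1 mm2) _.
apply: (@le_trans _ _ ((2 ^+ s)%:E * (C1 * a ^+ m)%:E +
   (s%:R * h ^+ s * K4 * C2 * \sum_(1 <= k < m.+1) q ^+ k)%:E)%E).
  apply: leeD; last exact: fdiff_sampling_le.
  apply: (le_trans l1); apply: lee_wpmul2l; first by rewrite lee_fin exprn_ge0.
  by rewrite -aE; apply: hE; rewrite expn_gt0.
rewrite -EFinM -EFinD lee_fin.
apply: (@le_trans _ _ ((2 ^+ s * C1 + s%:R * K4 * C2 * (q / (q - 1))) * a ^+ m)); last first.
  by rewrite /C -[leRHS]mulrA ler_wpM2l// ltW.
rewrite mulrDl -(mulrA (2 ^+ s)) lerD2l.
have hm : h ^+ s * q ^+ m <= a ^+ m.
  rewrite /q exprMn mulrA -[leRHS]mul1r ler_wpM2r ?exprn_ge0 ?(ltW a0)//.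
  rewrite -exprM mulnC exprM -exprMn exprn_ile1//.
    by rewrite mulr_ge0 ?(ltW h0)// exprn_ge0.
  rewrite -ler_pdivlMr ?exprn_gt0// mul1r (le_trans (ltW hn))// lef_pV2 ?posrE ?exprn_gt0//.
  by rewrite -natrX ler_nat.
apply: (@le_trans _ _ (s%:R * K4 * C2 * (q / (q - 1)) * (h ^+ s * q ^+ m))); last first.
  by rewrite ler_wpM2l// ltW// (mulr_gt0 (mulr_gt0 (mulr_gt0 s0 hK4) C20) Q0).
have -> : s%:R * K4 * C2 * (q / (q - 1)) * (h ^+ s * q ^+ m) =
  s%:R * h ^+ s * K4 * C2 * (q / (q - 1) * q ^+ m) by ring.
rewrite ler_wpM2l ?geometric_sum_le// ltW//.
exact: (mulr_gt0 (mulr_gt0 (mulr_gt0 s0 (exprn_gt0 s h0)) hK4) C20).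
Qed.

End inverse_estimate.

(** * Equivalence of the two rates *)

Unset Implicit Arguments.

Theorem corollary4p3 (R : realType) (p : R) (r s : nat) (alpha gamma : R)
  (x : nat -> nat -> R) (phi : nat -> nat -> R -> R) (K1 K2 K3 K4 : R)
  (hp : 1 <= p) (hr : (1 <= r)%N) (hs : (1 <= s)%N) (hsr : (s <= 2 * r)%N)
  (halpha : 0 < alpha < s%:R) (hgamma : 0 < gamma <= 1)
  (hphi : forall n k, (1 <= k <= n)%N -> LpT p (phi n k))
  (hx : separated_nodes gamma x)
  (hK1 : 0 < K1) (hK2 : 0 < K2) (hK3 : 0 < K3) (hK4 : 0 < K4)
  (hMZ : forall (g : R -> R) (n : nat), LpT p g -> (1 <= n)%N ->
     ((K2 * lpnorm p x n g)%:E <= Lpnorm p (sampling_op x phi n g))%E /\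
     (Lpnorm p (sampling_op x phi n g) <= (K1 * lpnorm p x n g)%:E)%E)
  (hJackson : forall (g : R -> R) (n : nat), Wps s p g -> (1 <= n)%N ->
     (Lpnorm p (g \- sampling_op x phi n g)%R
       <= (K3 * n%:R ^- s)%:E * Lpnorm p (derive1n s g))%E)
  (hBernstein : forall (g : R -> R) (nu : nat), LpT p g -> (1 <= nu)%N ->
     let D := (sampling_op x phi (2 ^ nu)%N g
                 \- sampling_op x phi (2 ^ nu.-1)%N g)%R in
     Wps s p D /\
     (Lpnorm p (derive1n s D) <= (K4 * 2 ^+ (s * nu))%:E * Lpnorm p D)%E)
  (f : R -> R) (hf : LpT p f) :
  bigO_powN alpha (fun n => Lpnorm p (f \- sampling_op x phi n f)%R)
  <->
  bigO_powN alpha (fun n =>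
    ((lpnorm p x n (steklov (gamma / n%:R) r f \- f)%R)%:E
       + omega s p f (n%:R^-1))%E).
Proof.
have [g0 g1] := andP hgamma.
have LG n u : LpT p (sampling_op x phi n u) by apply: LpT_sampling_op => // k; exact: hphi.
have [C C0 approx] := smooth_approximation hp hs hsr hgamma hx.
have [mf pf foo] := hf.
have npow_ge0 n : 0 <= n%:R `^ (- alpha) by exact: powR_ge0.
(* The Jackson inequality for the smooth approximant of f. *)
have Jg n g : (1 <= n)%N -> Wps s p g ->
    (Lpnorm p (derive1n s g) <= (C * n%:R ^+ s)%:E * omega s p f n%:R^-1)%E ->
    (Lpnorm p (g \- sampling_op x phi n g)%R <= (K3 * C)%:E * omega s p f n%:R^-1)%E.
  move=> n1 Wg dg; have n0 : 0 < n%:R :> R by rewrite ltr0n.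
  apply: le_trans (hJackson g n Wg n1) _.
  apply: (@le_trans _ _ ((K3 * n%:R ^- s)%:E * ((C * n%:R ^+ s)%:E * omega s p f n%:R^-1))%E).
    apply: lee_wpmul2l => //; rewrite lee_fin mulr_ge0 ?(ltW hK3)// invr_ge0 exprn_ge0//.
  rewrite muleA -EFinM; apply: lee_wpmul2r; first by rewrite omega_ge0// invr_gt0.
  rewrite lee_fin le_eqVlt; apply/orP; left; apply/eqP; field.
  by rewrite expf_eq0 gt_eqF// andbF.
split=> H.
- have Efin n : (1 <= n)%N -> (0 <= Lpnorm p (f \- sampling_op x phi n f)%R < +oo)%E.
    by move=> _; rewrite Lpnorm_ge0/=; have [_ _] := LpTB hp hf (LG n f).
  have [C1 C10 hE] := bigO_powN_all Efin H.
  have [C2 C20 hW] := omega_sampling_le hp hs halpha hphi hK4 hJackson hBernstein hf C10 hE.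
  pose B : R := 4 * (C * C2 + K2^-1 * (K3 * C * C2 + C2 + C1)) + C2.
  exists B; exists 1%N => // n /= n1.
  set e := n%:R `^ (- alpha); have e0 : 0 <= e by exact: npow_ge0.
  have We := hW n n1; rewrite -/e in We.
  have [g [Wg Lg fg dg sg]] := approx f n hf n1.
  have gf : lpnorm p x n (g \- f) <= K2^-1 * ((K3 * C * C2 + C2 + C1) * e).
    rewrite -ler_pdivrMl ?invr_gt0// invrK -lee_fin.
    have [h1 _] := hMZ (g \- f) n (LpTB hp Lg hf) n1; apply: (le_trans h1).
    have [m1 _ _] : LpT p (f \- sampling_op x phi n f) by exact: LpTB.
    have [m2 _ _] : LpT p (g \- sampling_op x phi n g) by exact: LpTB.
    have [m3 _ _] : LpT p (f \- g) by exact: LpTB.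
    (* G_n(g - f) is recovered from the three errors. *)
    have -> : sampling_op x phi n (g \- f) =
        ((f \- sampling_op x phi n f) \- (g \- sampling_op x phi n g)) \- (f \- g).
      by rewrite sampling_opB; apply/funext => y /=; ring.
    apply: le_trans (LpnormB hp (measurable_funB m1 m2) m3) _.
    apply: le_trans (leeD (LpnormB hp m1 m2) (lexx _)) _.
    apply: (@le_trans _ _ ((C1 * e)%:E + (K3 * C * (C2 * e))%:E + (C2 * e)%:E)%E).
      apply: leeD; last exact: le_trans fg We.
      apply: leeD; first exact: hE.
      apply: (le_trans (Jg n g n1 Wg dg)); rewrite [leRHS]EFinM; apply: lee_wpmul2l => //.
      by rewrite lee_fin mulr_ge0// ltW.
    by rewrite -!EFinD lee_fin le_eqVlt; apply/orP; left; apply/eqP; ring.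
  have sf : lpnorm p x n (steklov (gamma / n%:R) r f \- f) <=
      4 * (C * (C2 * e) + K2^-1 * ((K3 * C * C2 + C2 + C1) * e)).
    have -> : steklov (gamma / n%:R) r f \- f =
        (steklov (gamma / n%:R) r f \- g) \+ (g \- f) by apply/funext => y /=; ring.
    apply: le_trans (lpnormD_quasi _ _ _ _ hp) _; rewrite ler_wpM2l//; apply: lerD => //.
    rewrite -lee_fin; apply: (le_trans sg); rewrite [leRHS]EFinM; apply: lee_wpmul2l => //.
    by rewrite lee_fin ltW.
  apply: le_trans (leeD (_ : (_ <= (4 * (C * (C2 * e) + K2^-1 * ((K3 * C * C2 + C2 + C1) * e)))%:E)%E) We) _.
    by rewrite lee_fin.
  rewrite -EFinD lee_fin /B le_eqVlt; apply/orP; left; apply/eqP.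
  by rewrite -/e; ring.
- case: H => C1 [N _ HN].
  exists (C1 + K3 * C * C1 + K1 * (4 * (C1 + C * C1))); exists (maxn N 1) => // n /=.
  rewrite geq_max => /andP[Nn n1]; have n0 : 0 < n%:R :> R by rewrite ltr0n.
  set e := n%:R `^ (- alpha); have := HN n Nn; rewrite /= -/e => h.
  have W0 : (0 <= omega s p f n%:R^-1)%E by rewrite omega_ge0// invr_gt0.
  have We : (omega s p f n%:R^-1 <= (C1 * e)%:E)%E.
    by apply: le_trans h; rewrite leeDr// lee_fin lpnorm_ge0.
  have sf : lpnorm p x n (steklov (gamma / n%:R) r f \- f) <= C1 * e.
    by rewrite -lee_fin; apply: le_trans h; rewrite leeDl.
  have [g [Wg Lg fg dg sg]] := approx f n hf n1.
  have gf : lpnorm p x n (g \- f) <= 4 * (C1 * e + C * (C1 * e)).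
    have -> : g \- f = (steklov (gamma / n%:R) r f \- f) \+ (g \- steklov (gamma / n%:R) r f).
      by apply/funext => y /=; ring.
    apply: le_trans (lpnormD_quasi _ _ _ _ hp) _; rewrite ler_wpM2l//; apply: lerD => //.
    rewrite (lpnorm_eq_abs _ _ _ (w := steklov (gamma / n%:R) r f \- g)); last first.
      by move=> y /=; rewrite distrC.
    rewrite -lee_fin; apply: (le_trans sg); rewrite [leRHS]EFinM; apply: lee_wpmul2l => //.
    by rewrite lee_fin ltW.
  have [m1 _ _] : LpT p (f \- g) by exact: LpTB.
  have [m2 _ _] : LpT p (g \- sampling_op x phi n g) by exact: LpTB.
  have [m3 _ _] := LG n (g \- f).
  have -> : f \- sampling_op x phi n f =
      ((f \- g) \+ (g \- sampling_op x phi n g)) \+ sampling_op x phi n (g \- f).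
    by rewrite sampling_opB; apply/funext => y /=; ring.
  apply: le_trans (LpnormD hp (measurable_funD m1 m2) m3) _.
  apply: le_trans (leeD (LpnormD hp m1 m2) (lexx _)) _.
  apply: (@le_trans _ _ ((C1 * e)%:E + (K3 * C * (C1 * e))%:E + (K1 * (4 * (C1 * e + C * (C1 * e))))%:E)%E).
    apply: leeD; first apply: leeD; first exact: le_trans fg We.
      apply: (le_trans (Jg n g n1 Wg dg)); rewrite [leRHS]EFinM; apply: lee_wpmul2l => //.
      by rewrite lee_fin mulr_ge0// ltW.
    have [_ h2] := hMZ (g \- f) n (LpTB hp Lg hf) n1; apply: (le_trans h2).
    by rewrite lee_fin ler_wpM2l// ltW.
  by rewrite -!EFinD lee_fin le_eqVlt; apply/orP; left; apply/eqP; ring.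
Qed.
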